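(* Let $d\ge 2$ be an integer and let $s>d/2$ be real. There exists a constant $c>0$ depending only on $d$ and $s$ such that the following holds. Let $\mathcal X=\{x_{n,k}: n=1,2,\dots,\ k=1,\dots,l_n\}\subset\mathbb S^d$ be a Marcinkiewicz-Zygmund family with associated weight $\tau=\{\tau_{n,k}\}\subset(0,\infty)$, with constants $A,B>0$ and global condition number $\kappa=B/A$. Let $L_n$ be the associated weighted least squares operators and let $I_n$ be the associated least squares quadrature rules. Then for every $f\in H^{s}(\mathbb S^d)$ and every $n\in\{1,2,\dots\}$, $$\|f-L_nf\|_2\le c\,(1+\kappa^2)^{1/2}\,n^{-s}\,\|f\|_{H^s}$$ and $$\Big|\int_{\mathbb S^d}f(x)\,d\sigma(x)-I_n(f)\Big|\le c\,(1+\kappa^2)^{1/2}\,n^{-s}\,\|f\|_{H^s}.$$ In particular $c$ does not depend on $f$, $\kappa$, $n$ or the family $\mathcal X$.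
   Context: Sphere and polynomials. $\mathbb S^d=\{x\in\mathbb R^{d+1}:|x|=1\}$, $d\ge2$, with the rotation-invariant measure $\sigma$ normalized by $\int_{\mathbb S^d}d\sigma=1$. Functions are real-valued; $\langle f,g\rangle=\int_{\mathbb S^d}f g\,d\sigma$ and $\|f\|_2=\langle f,f\rangle^{1/2}$. $\Pi_n^d$ is the space of restrictions to $\mathbb S^d$ of polynomials on $\mathbb R^{d+1}$ of total degree $\le n$. Sobolev space. For $\ell\ge0$ let $\mathcal H_\ell^d$ be the space of spherical harmonics of degree $\ell$ (restrictions to $\mathbb S^d$ of harmonic homogeneous polynomials of degree $\ell$ on $\mathbb R^{d+1}$), with dimension $N(d,\ell)$ and a fixed $L_2$-orthonormal basis $Y_{\ell,k}$, $k=1,\dots,N(d,\ell)$. For $s>0$, $H^s(\mathbb S^d)$ is the space of $f\in L_2(\mathbb S^d)$ for which $$\|f\|_{H^s}=\Big(\sum_{\ell=0}^\infty(1+\ell(\ell+d-1))^{s}\sum_{k=1}^{N(d,\ell)}|\langle f,Y_{\ell,k}\rangle|^2\Big)^{1/2}<\infty .$$ For $s>d/2$, $H^s(\mathbb S^d)$ is continuously embedded in $C(\mathbb S^d)$; elements of $H^s(\mathbb S^d)$ are identified with their continuous representatives, so point values make sense. Marcinkiewicz-Zygmund (MZ) family. A doubly-indexed set of points $\mathcal X=\{x_{n,k}:n=1,2,\dots,\ k=1,\dots,l_n\}\subset\mathbb S^d$ with weights $\tau_{n,k}\in(0,\infty)$ is an MZ family with associated weight $\tau=\{\tau_{n,k}\}$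 if there are constants $A,B>0$ independent of $n$ such that for all $n\ge1$ $$A\|p\|_2^2\le\sum_{k=1}^{l_n}|p(x_{n,k})|^2\tau_{n,k}\le B\|p\|_2^2\qquad\text{for all }p\in\Pi_n^d .$$ The ratio $\kappa=B/A$ is its global condition number. Weighted least squares operator. For $f\in C(\mathbb S^d)$, $L_nf$ is the (unique) minimizer $$L_nf=\arg\min_{p\in\Pi_n^d}\sum_{k=1}^{l_n}|f(x_{n,k})-p(x_{n,k})|^2\tau_{n,k}.$$ Least squares quadrature. Let $E_n(x,y)$ be the reproducing kernel of $\Pi_n^d$ with respect to $\langle\cdot,\cdot\rangle$, i.e. $E_n(\cdot,x)\in\Pi_n^d$ and $p(x)=\langle p,E_n(\cdot,x)\rangle$ for $p\in\Pi_n^d$, $x\in\mathbb S^d$. Put $\tilde e_{n,k}=\tau_{n,k}^{1/2}E_n(\cdot,x_{n,k})$ and let $T_n:\Pi_n^d\to\Pi_n^d$ be the frame operator $T_np=\sum_{k=1}^{l_n}\langle p,\tilde e_{n,k}\rangle\tilde e_{n,k}$, which is invertible by the MZ inequalities. Put $e_{n,k}=T_n^{-1}\tilde e_{n,k}$ and $w_{n,k}=\tau_{n,k}^{1/2}\int_{\mathbb S^d}e_{n,k}\,d\sigma$. Then $$I_n(f)=\sum_{k=1}^{l_n}w_{n,k}f(x_{n,k}).$$ *)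

(* Defs.v *)
From HB Require Import structures.
From mathcomp Require Import all_boot all_order all_algebra.
From mathcomp Require Import all_classical all_reals all_analysis.
(* The notations of [mpoly] clash with those of MathComp-Analysis. *)
From mathcomp Require Import -(notations) mpoly.

Set Implicit Arguments.
Unset Strict Implicit.
Unset Printing Implicit Defensive.

Import Order.TTheory GRing.Theory Num.Theory.
Import numFieldNormedType.Exports.

Local Open Scope classical_set_scope.
Local Open Scope ring_scope.

Definition unit_sphere (R : realType) (d : nat) : set 'rV[R]_d.+1 :=
  [set x | \sum_i x ord0 i ^+ 2 = 1].

Lemma unit_sphere_delta (R : realType) (d : nat) :
  unit_sphere (delta_mx ord0 ord0 : 'rV[R]_d.+1).
Proof.
rewrite /unit_sphere /= (bigD1 ord0) //= mxE eqxx expr1n big1 ?addr0 // => i.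
by move=> /negbTE i0; rewrite mxE eqxx i0 /= expr0n.
Qed.

(* S^d as a type, with the subspace topology inherited from R^(d+1). *)
Definition sphere (R : realType) (d : nat) : Type :=
  set_type (@unit_sphere R d).

HB.instance Definition _ (R : realType) (d : nat) :=
  Topological.copy (sphere R d) (set_type (@unit_sphere R d)).
HB.instance Definition _ (R : realType) (d : nat) :=
  isPointed.Build (sphere R d)
    (SigSub (mem_set (unit_sphere_delta R d))).

Definition sphere_val (R : realType) (d : nat) (x : sphere R d)
  : 'rV[R]_d.+1 := set_val x.

Notation borel_sphere R d := (g_sigma_algebraType (@open (sphere R d))).

Definition rotation_invariant (R : realType) (d : nat)
    (sigma : probability (borel_sphere R d) R) : Prop :=
  forall Q : 'M[R]_d.+1, Q *m Q^T = 1%:M -> \det Q = 1 ->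
  forall A : set (borel_sphere R d), measurable A ->
    sigma [set x | exists2 y, A y & sphere_val y = sphere_val x *m Q]
    = sigma A.

Section functions_on_the_sphere.
Variables (R : realType) (d : nat).

Definition poly_restr (p : mpoly d.+1 R) (x : sphere R d) : R :=
  meval (fun i => sphere_val x ord0 i) p.

(* [mmeasure mdeg p] is 1 + the total degree of [p], and 0 if [p = 0]. *)
Definition Pi_space (n : nat) : set (sphere R d -> R) :=
  [set f | exists2 p : mpoly d.+1 R,
     (mmeasure (@mdeg d.+1) p <= n.+1)%N & f = poly_restr p].

Definition laplacian (p : mpoly d.+1 R) : mpoly d.+1 R :=
  \sum_(i < d.+1) mderiv i (mderiv i p).

Definition harmonics (l : nat) : set (sphere R d -> R) :=
  [set f | exists p : mpoly d.+1 R,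
     [/\ p \is ishomog1 l (@mdeg d.+1), laplacian p = 0 & f = poly_restr p]].

Variable sigma : probability (borel_sphere R d) R.

Definition inner (f g : sphere R d -> R) : R := \int[sigma]_x (f x * g x).

Definition norm2 (f : sphere R d -> R) : R := Num.sqrt (inner f f).

Definition harmonic_orthonormal_basis (N : nat -> nat)
    (Y : forall l, 'I_(N l) -> sphere R d -> R) : Prop :=
  forall l,
  [/\ forall k, harmonics l (Y l k),
      forall j k, inner (Y l j) (Y l k) = (j == k)%:R
    & forall h, harmonics l h ->
        exists a : 'I_(N l) -> R, h = fun x => \sum_k a k * Y l k x].

Section sobolev.
Variables (N : nat -> nat) (Y : forall l, 'I_(N l) -> sphere R d -> R).
Variable s : R.

Definition sobolev_sum (f : sphere R d -> R) : \bar R :=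
  (\sum_(0 <= l <oo)
     ((1 + (l * (l + d - 1))%N%:R) `^ s
      * \sum_(k < N l) `|inner f (@Y l k)| ^+ 2)%R%:E)%E.

Definition sobolev : set (sphere R d -> R) :=
  [set f | f \in Lfun sigma 2%:E /\ (sobolev_sum f < +oo)%E].

Definition sobolev_norm (f : sphere R d -> R) : R :=
  Num.sqrt (fine (sobolev_sum f)).

End sobolev.

(* The index [n = 0] is unused: families are indexed by [n >= 1]. *)
Definition MZ_family (l : nat -> nat) (x : forall n, 'I_(l n) -> sphere R d)
    (tau : forall n, 'I_(l n) -> R) (A B : R) : Prop :=
  [/\ 0 < A, 0 < B,
      forall n k, (0 < n)%N -> 0 < tau n k
    & forall n, (0 < n)%N -> forall p, Pi_space n p ->
        A * norm2 p ^+ 2 <= \sum_(k < l n) `|p (x n k)| ^+ 2 * tau n k /\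
        \sum_(k < l n) `|p (x n k)| ^+ 2 * tau n k <= B * norm2 p ^+ 2].

Definition repr_kernel (n : nat) : sphere R d -> sphere R d -> R :=
  xget (fun _ _ => 0)
    [set E | (forall x, Pi_space n (fun y => E y x)) /\
             (forall p, Pi_space n p ->
                forall x, p x = inner p (fun y => E y x))].

(* One level [n] of a family: [m] points [x] with weights [tau]. *)
Section one_level.
Variables (n m : nat) (x : 'I_m -> sphere R d) (tau : 'I_m -> R).

Definition lsq_error (f p : sphere R d -> R) : R :=
  \sum_(k < m) `|f (x k) - p (x k)| ^+ 2 * tau k.

Definition least_squares (f : sphere R d -> R) : sphere R d -> R :=
  xget (fun=> 0)
    [set p | Pi_space n p /\
             forall q, Pi_space n q -> lsq_error f p <= lsq_error f q].

Definition frame_vector (k : 'I_m) : sphere R d -> R :=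
  fun y => Num.sqrt (tau k) * repr_kernel n y (x k).

Definition frame_operator (p : sphere R d -> R) : sphere R d -> R :=
  fun y => \sum_(k < m) inner p (frame_vector k) * frame_vector k y.

(* [frame_operator] is inverted as an operator on [Pi_space n]. *)
Definition dual_frame_vector (k : 'I_m) : sphere R d -> R :=
  'pinv_(fun _ _ => 0) (Pi_space n) frame_operator (frame_vector k).

Definition lsq_weight (k : 'I_m) : R :=
  Num.sqrt (tau k) * \int[sigma]_y dual_frame_vector k y.

Definition lsq_quadrature (f : sphere R d -> R) : R :=
  \sum_(k < m) lsq_weight k * f (x k).

End one_level.

End functions_on_the_sphere.

(* Main.v *)
(** Rotation invariance of the measure is only used through its infinitesimal
    form, [int d_i F = (k + d) int x_i F] for homogeneous [F] of degree [k].
    It makes harmonics of different degrees orthogonal and shows that zonal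
    convolution with [t ^ k] multiplies degree-[l] harmonics by an explicit
    constant.

    The heart of the matter is to transfer the upper Marcinkiewicz-Zygmund bound
    from degree [n] to any degree [m >= n] with loss [(m / n) ^ d].  A polynomial
    of degree [m] is written as the convolution of a polynomial of comparable
    [L_2] norm with [peak t ^ 2 * t ^ 2K], where [peak] is a power of a Chebyshev
    quotient concentrated near [t = 1] and [-1]; by Cauchy-Schwarz the sampled
    sum is then controlled by the samples of [peak], which has degree at most
    [n] and small [L_2] norm.

    Splitting [f] into dyadic blocks, this bounds the sampled energy of the part
    of [f] of degree above [n] by a multiple of [n ^ (-2s)], because [s > d / 2]
    makes the block losses summable.  Convolution with a positive zonal kernel
    reduces [f] to a polynomial, so no pointwise convergence of the harmonic
    expansion is needed.  The lower bound turns sampled error of the minimizer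
    into [L_2] error.  Finally the frame-dual sum solves the normal equations,
    so the quadrature rule integrates a minimizer. *)

Require Import Defs.
From HB Require Import structures.
From mathcomp Require Import all_boot all_order all_algebra.
From mathcomp Require Import ring lra zify.
From mathcomp Require Import all_classical all_reals all_analysis.
From mathcomp Require Import -(notations) mpoly.

Set Implicit Arguments.
Unset Strict Implicit.
Unset Printing Implicit Defensive.

Import Order.TTheory GRing.Theory Num.Theory.
Import numFieldNormedType.Exports.

Local Open Scope classical_set_scope.
Local Open Scope ring_scope.

(** * Multipliers of zonal monomials *)

(** The points of level [n] are tested on [Pi_space n] only and need not be separated, so a
    polynomial of degree [m > n] is controlled at them only through one of degree at most [n]. The
    kernel must reconcile two scales. Its multipliers have to be comparable to its integral up to
    degree [m], so its mass should sit in caps of radius about [1 / m]; [t ^ 2K] does this with [K]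
    of order [m ^ 2]. It must also be dominated by the square of a polynomial of degree at most [n],
    which lives at scale [1 / n]. The loss [(m / n) ^ d] is the ratio of the integral of [peak ^ 2],
    of order [n ^ - d], to that of [t ^ 2K], of order [m ^ - d]. An even kernel annihilates odd
    harmonics, so odd degrees get an extra factor [t] and the two parities are treated apart. Every
    integral is reduced to moments of [t], which are compared with binomial coefficients; neither
    Gamma functions nor angular coordinates enter. *)

Section zonal_multipliers.
Variables (R : realType) (d : nat).

(** The integral of [t ^ k], where [t] is the inner product with a fixed point of the sphere (see
    [int_linpX]); the recurrence comes from [int_mderiv]. *)
Fixpoint zonal_moment (k : nat) : R :=
  match k with
  | 0 => 1
  | 1 => 0
  | k.+2 => k.+1%:R / (k.+1 + d)%:R * zonal_moment k
  end.

(** The Funk-Hecke multiplier of [t ^ k] on harmonics of degree [l] (see [int_linpX_harmonic]):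
    integration by parts lowers both degrees by one. At [k = 0] the factor [k] vanishes, so the
    truncated [k.-1] is harmless. *)
Fixpoint zonal_mult (k l : nat) : R :=
  match l with
  | 0 => zonal_moment k
  | l.+1 => k%:R / (k + l + d)%:R * zonal_mult k.-1 l
  end.

Lemma zonal_momentSS k :
  zonal_moment k.+2 = k.+1%:R / (k.+1 + d)%:R * zonal_moment k.
Proof. by []. Qed.

Lemma zonal_moment_double_gt0 K : 0 < zonal_moment K.*2.
Proof.
elim: K => [|K IH]; first exact: ltr01.
rewrite doubleS zonal_momentSS.
by rewrite mulr_gt0 // divr_gt0 // ltr0n.
Qed.

Lemma zonal_moment_odd K : zonal_moment K.*2.+1 = 0.
Proof. by elim: K => [|K IH] //; rewrite doubleS zonal_momentSS IH mulr0. Qed.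

Lemma zonal_moment_ge0 k : 0 <= zonal_moment k.
Proof.
rewrite -(odd_double_half k); case: (odd k).
  by rewrite zonal_moment_odd.
by rewrite add0n ltW // zonal_moment_double_gt0.
Qed.

Lemma zonal_mult_ge0 k l : 0 <= zonal_mult k l.
Proof.
by elim: l k => [|l IH] k /=; rewrite ?zonal_moment_ge0 // mulr_ge0 // divr_ge0.
Qed.

Lemma le_zonal_moment_SS k : zonal_moment k.+2 <= zonal_moment k.
Proof.
rewrite zonal_momentSS ler_piMl ?zonal_moment_ge0 // ler_pdivrMr ?ltr0n //.
by rewrite mul1r ler_nat leq_addr.
Qed.

Lemma zonal_moment_double_le J K : (J <= K)%N ->
  zonal_moment K.*2 <= zonal_moment J.*2.
Proof.
move=> /subnK <-; elim: (K - J)%N => [|i IH] //.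
by rewrite addSn doubleS; apply: le_trans IH; exact: le_zonal_moment_SS.
Qed.

Lemma zonal_mult_lower (r : R) (k l : nat) : 0 <= r ->
  (l <= k)%N -> (forall i, (i < l)%N ->
     r <= (k - i)%N%:R / (k - i + (l - i.+1) + d)%N%:R) ->
  r ^+ l * zonal_moment (k - l) <= zonal_mult k l.
Proof.
move=> r0; elim: l k => [|l IH] k lk H /=; first by rewrite subn0 expr0 mul1r.
case: k lk H => // k lk H /=.
rewrite exprS -mulrA; apply: ler_pM => //.
- by rewrite mulr_ge0 ?exprn_ge0 ?zonal_moment_ge0.
- by have := H 0%N isT; rewrite subn0 subn1.
- rewrite subSS; apply: IH => // i il.
  by have := H i.+1; rewrite subSS; apply.
Qed.

Lemma bernoulli_ineq (x : R) n : -1 <= x -> 1 + n%:R * x <= (1 + x) ^+ n.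
Proof.
move=> x1; elim: n => [|n IH]; first by rewrite mul0r addr0.
rewrite exprS -natr1; apply: (@le_trans _ _ ((1 + x) * (1 + n%:R * x))).
  have := mulr_ge0 (ler0n R n) (sqr_ge0 x); nra.
by rewrite ler_wpM2l //; lra.
Qed.

(* The relative loss is at most [L * (L + d) / (2K - L)]. *)
Lemma zonal_mult_half (L K l : nat) : (0 < L)%N -> (l <= L)%N ->
  (L + 2 * (L * (L + d)) <= K.*2)%N ->
  zonal_moment K.*2 / 2 <= zonal_mult (odd l + K.*2) l.
Proof.
move=> L0 lL HK.
have LK : (L <= K.*2)%N by apply: leq_trans HK; rewrite leq_addr.
set kap := (K.*2 - L)%N.
have kap_ge : (2 * (L * (L + d)) <= kap)%N by rewrite leq_subRL // .
have kap0 : (0 < kap)%N.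
  by apply: leq_trans kap_ge; rewrite !muln_gt0 addn_gt0 L0.
pose r : R := kap%:R / (kap + L + d)%N%:R.
have r0 : 0 <= r by rewrite divr_ge0.
have lk : (l <= odd l + K.*2)%N.
  by apply: leq_trans lL (leq_trans LK _); rewrite leq_addl.
(* Adding [odd l] to the exponent makes the order of the remaining moment even; an odd moment would
   be zero. *)
have E : (odd l + K.*2 - l)%N = (K - l./2).*2.
  by rewrite -{2}(odd_double_half l) subnDl doubleB.
have := @zonal_mult_lower r (odd l + K.*2) l r0 lk.
move=> /(_ _)/wrap[|H].
  move=> i il; rewrite /r.
  have ki : (kap <= odd l + K.*2 - i)%N.
    rewrite /kap; apply: (@leq_trans (K.*2 - i)%N).
      by rewrite leq_sub2l // (leq_trans (ltnW il)).
    by rewrite leq_sub2r // leq_addl.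
  rewrite ler_pdivrMr ?ltr0n ?addn_gt0 ?kap0 // mulrAC ler_pdivlMr; last first.
    by rewrite ltr0n !addn_gt0 (leq_trans kap0 ki).
  rewrite -!natrM ler_nat -!addnA !mulnDr leq_add ?[(kap * (_ - i))%N]mulnC //.
  rewrite leq_add // leq_mul //.
  by apply: leq_trans (leq_subr _ _) lL.
apply: le_trans H; rewrite E mulrC.
apply: ler_pM; rewrite ?zonal_moment_ge0 //.
  apply: (@le_trans _ _ (1 + l%:R * (r - 1))); last first.
    by rewrite -{2}[r](subrKC 1) bernoulli_ineq //; lra.
  have -> : r - 1 = - (L + d)%:R / (kap + L + d)%:R.
    have D0 : (kap + L + d)%:R != 0 :> R by rewrite pnatr_eq0 -lt0n !addn_gt0 kap0.
    apply: (mulIf D0); rewrite mulrBl /r !divfK // mul1r !natrD; lra.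
  rewrite mulNr mulrN mulrA lerBrDr -lerBrDl.
  rewrite ler_pdivrMr ?ltr0n ?addn_gt0 ?kap0 //.
  have -> : 1 - 2^-1 = 2^-1 :> R by lra.
  rewrite [leRHS]mulrC ler_pdivlMr // -!natrM ler_nat.
  apply: leq_trans (_ : kap <= _)%N; last by rewrite -addnA leq_addr.
  apply: leq_trans kap_ge; rewrite mulnC leq_mul2l /=.
  by rewrite leq_mul2r lL orbT.
by rewrite zonal_moment_double_le // leq_subr.
Qed.

Lemma mulr_bin_succ k :
  k.+1%:R * 'C(k.+1 + d, d)%:R = (k.+1 + d)%:R * 'C(k + d, d)%:R :> R.
Proof. by rewrite -!natrM -[(k + d)%N]/(k.+1 + d).-1 mul_bin_down addnK. Qed.

(** The moment is a product of ratios [(2j + 1) / (2j + 1 + d)]. The square of one ratio nearly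
    cancels the growth of the binomial coefficient over two steps; the leftover [(a + 1) * (a + d +
    2) / ((a + d + 1) * (a + 2))] with [a = 2J] is at most 1. Hence decay of order
    [J ^ (- d / 2)]. *)
Lemma zonal_moment_double_upper J :
  zonal_moment J.*2 ^+ 2 * 'C(J.*2 + d, d)%:R <= 1.
Proof.
elim: J => [|J IH]; first by rewrite /= add0n binn expr1n mulr1.
rewrite doubleS zonal_momentSS; apply: le_trans IH.
have B1 := mulr_bin_succ J.*2; have B2 := mulr_bin_succ J.*2.+1.
move: B1 B2.
set m := zonal_moment J.*2.
set C0 : R := 'C(_, _)%:R; set C1 : R := 'C(_, _)%:R; set C2 : R := 'C(_, _)%:R.
have a0 : 0 < J.*2.+1%:R :> R by rewrite ltr0n.
have b0 : 0 < J.*2.+2%:R :> R by rewrite ltr0n.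
rewrite !addSn -![in X in X -> _]natr1 -![(_ + d).+1%:R]natr1 natrD.
rewrite -![_.+1%:R]natr1.
set a : R := J.*2%:R; set e : R := d%:R.
have A0 : 0 <= a by rewrite ler0n.
have E0 : 0 <= e by rewrite ler0n.
move=> B1 B2.
rewrite natrD in B2; rewrite -/a -/e in B2.
have b1 : a + 1 != 0 by apply: lt0r_neq0; lra.
have b2 : a + 1 + 1 != 0 by apply: lt0r_neq0; lra.
have b3 : a + e + 1 != 0 by apply: lt0r_neq0; lra.
have -> : C2 = (a + e + 1 + 1) * ((a + e + 1) * C1 / (a + 1)) / (a + 1 + 1).
  by rewrite -B1 [_ * C0]mulrC mulfK // -B2 [_ * C2]mulrC mulfK.
have -> : ((a + 1) / (a + e + 1) * m) ^+ 2 *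
   ((a + e + 1 + 1) * ((a + e + 1) * C1 / (a + 1)) / (a + 1 + 1)) =
   m ^+ 2 * C1 * ((a + 1) * (a + e + 1 + 1) / ((a + e + 1) * (a + 1 + 1))).
  by field; apply/and3P; split.
have P : 0 <= m ^+ 2 * C1 by rewrite mulr_ge0 ?sqr_ge0 ?ler0n.
apply: ler_piMr => //; rewrite ler_pdivrMr; first nra.
by rewrite mulr_gt0; lra.
Qed.

(** The same cancellation with the binomial coefficient shifted by one index, which puts the
    leftover ratio above 1; equality at [K = 0] fixes the factor [d + 1]. *)
Lemma zonal_moment_double_lower K :
  1 <= zonal_moment K.+1.*2 ^+ 2 * (d.+1%:R * 'C(K.*2.+1 + d, d)%:R).
Proof.
elim: K => [|K IH].
  by rewrite /= mulr1 add1n binSn mul1r exprVn -expr2 mulVf.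
apply: (le_trans IH); rewrite (doubleS K.+1) zonal_momentSS !doubleS.
have B1 := mulr_bin_succ K.*2.+1; have B2 := mulr_bin_succ K.*2.+2.
move: B1 B2.
set m := zonal_moment _.
set C0 : R := 'C(_, _)%:R; set C1 : R := 'C(_, _)%:R; set C2 : R := 'C(_, _)%:R.
have C1_ge0 : 0 <= C1 by rewrite ler0n.
rewrite !natrD; set a : R := K.*2.+2%:R; set e : R := d%:R.
rewrite -![K.*2.+3%:R]natr1 -/a -[d.+1%:R]natr1 -/e.
have A0 : 0 < a by rewrite ltr0n.
have E0 : 0 <= e by rewrite ler0n.
move=> B1 B2.
have b0 : a != 0 by apply: lt0r_neq0.
have b1 : a + 1 != 0 by apply: lt0r_neq0; lra.
have b2 : a + e != 0 by apply: lt0r_neq0; lra.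
have b3 : a + 1 + e != 0 by apply: lt0r_neq0; lra.
have -> : C2 = (a + 1 + e) * ((a + e) * C1 / a) / (a + 1).
  by rewrite -B1 [_ * C0]mulrC mulfK // -B2 [_ * C2]mulrC mulfK.
have -> : ((a + 1) / (a + 1 + e) * m) ^+ 2 *
   ((e + 1) * ((a + 1 + e) * ((a + e) * C1 / a) / (a + 1))) =
   m ^+ 2 * ((e + 1) * C1) * ((a + 1) * (a + e) / ((a + 1 + e) * a)).
  by field; apply/and3P; split.
have P : 0 <= m ^+ 2 * ((e + 1) * C1).
  by apply: mulr_ge0; [exact: sqr_ge0|rewrite mulr_ge0 // addr_ge0].
apply: ler_peMr => //; rewrite ler_pdivlMr; first nra.
by rewrite mulr_gt0; lra.
Qed.

Lemma expn_le_ffact n k : (n.+1 ^ k <= (n + k) ^_ k)%N.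
Proof.
elim: k => [|k IH]; first by rewrite ffactn0.
by rewrite expnS addnS ffactSS leq_mul // ltnS leq_addr.
Qed.

Lemma bin_le_expn n k : ('C(n, k) <= n ^ k)%N.
Proof.
apply: (@leq_trans (n ^_ k)); first by rewrite -bin_ffact leq_pmulr // fact_gt0.
by elim: k => [|k IH] //; rewrite ffactnSr expnSr leq_mul // leq_subr.
Qed.

Lemma zonal_moment_double_le_pow J :
  zonal_moment J.*2 <= Num.sqrt d`!%:R * (Num.sqrt J.+1%:R)^-1 ^+ d.
Proof.
rewrite -ler_sqr ?nnegrE ?zonal_moment_ge0 ?mulr_ge0 ?exprn_ge0 ?invr_ge0 ?sqrtr_ge0 //.
rewrite exprMn sqr_sqrtr ?ler0n // exprAC exprVn sqr_sqrtr ?ler0n //.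
rewrite exprVn ler_pdivlMr ?exprn_gt0 ?ltr0n //.
rewrite -[leRHS]mulr1; apply: le_trans (ler_wpM2l (ler0n R d`!) (zonal_moment_double_upper J)).
rewrite mulrCA ler_wpM2l ?sqr_ge0 // -natrX -natrM ler_nat mulnC bin_ffact.
apply: leq_trans (expn_le_ffact _ _); case: (d) => [|e]; first by rewrite !expn0.
by rewrite leq_exp2r // ltnS -addnn leq_addr.
Qed.

Lemma zonal_moment_double_ge_pow K : (0 < K)%N ->
  1 <= zonal_moment K.*2 ^+ 2 * (d.+1%:R * (K.*2 + d)%:R ^+ d).
Proof.
case: K => // K _; apply: le_trans (zonal_moment_double_lower K) _.
rewrite ler_wpM2l ?sqr_ge0 // ler_wpM2l // -natrX ler_nat.
apply: leq_trans (bin_le_expn _ _) _; 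
case: (d) => [|e]; first by rewrite !expn0.
by rewrite leq_exp2r // leq_add2r.
Qed.

(** Each term is at most [2 * (y - x)] for consecutive square roots [x], [y]: combine
    [(x - y) ^ 2 >= 0] with [y ^ 2 - x ^ 2 = 1]. *)
Lemma sum_inv_sqrt_le M :
  \sum_(K < M) (Num.sqrt K.+1%:R)^-1 <= 2 * Num.sqrt M%:R :> R.
Proof.
elim: M => [|M IH]; first by rewrite big_ord0 sqrtr0 mulr0.
rewrite big_ord_recr /=; apply: le_trans (lerD IH (lexx _)) _.
set x := Num.sqrt M%:R; set y := Num.sqrt M.+1%:R.
have y0 : 0 < y by rewrite sqrtr_gt0 ltr0n.
have x0 : 0 <= x by exact: sqrtr_ge0.
have xx : x ^+ 2 = M%:R by rewrite sqr_sqrtr.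
have yy : y ^+ 2 = M%:R + 1 by rewrite sqr_sqrtr // natr1.
rewrite -(ler_pM2r y0) mulrDl mulVf ?gt_eqF //; have := sqr_ge0 (x - y); nra.
Qed.

End zonal_multipliers.

(** * Chebyshev polynomials and the peak polynomial *)

Section chebyshev.
Variable R : realType.

(* [chebyshev n] is the pair [(T_n, U_(n-1))]. *)
Fixpoint chebyshev (n : nat) : {poly R} * {poly R} :=
  if n is n'.+1 then
    let: (T, U) := chebyshev n' in ('X * T - (1 - 'X^2) * U, 'X * U + T)
  else (1, 0).

Lemma chebyshevS n : chebyshev n.+1 =
  ('X * (chebyshev n).1 - (1 - 'X^2) * (chebyshev n).2,
   'X * (chebyshev n).2 + (chebyshev n).1).
Proof. by rewrite /=; case: (chebyshev n). Qed.

Lemma size_chebyshev n :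
  (size (chebyshev n).1 <= n.+1)%N /\ (size (chebyshev n).2 <= n)%N.
Proof.
elim: n => [|n [IH1 IH2]]; first by rewrite size_poly1 size_poly0.
rewrite chebyshevS /=; split.
  apply: leq_trans (size_polyD _ _) _; rewrite size_polyN geq_max; apply/andP; split.
    apply: leq_trans (size_polyMleq _ _) _; rewrite size_polyX.
    by rewrite !addSn add0n /=.
  have [->|U0] := eqVneq (chebyshev n).2 0; first by rewrite mulr0 size_poly0.
  apply: leq_trans (size_polyMleq _ _) _.
  apply: (@leq_trans (3 + n).-1); last by [].
  rewrite -!subn1 leq_sub2r // leq_add //.
  apply: leq_trans (size_polyD _ _) _.
  by rewrite size_polyN size_poly1 size_polyXn.
apply: leq_trans (size_polyD _ _) _; rewrite geq_max IH1 andbT.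
apply: leq_trans (size_polyMleq _ _) _; rewrite size_polyX.
by rewrite !addSn add0n /= .
Qed.

(** The polynomial form of [cos ^ 2 + sin ^ 2 = 1], used below in place of an angle. *)
Lemma chebyshev_pell n (t : R) :
  (chebyshev n).1.[t] ^+ 2 + (1 - t ^+ 2) * (chebyshev n).2.[t] ^+ 2 = 1.
Proof.
elim: n => [|n IH]; first by rewrite /= hornerC horner0 expr0n mulr0 addr0 expr1n.
rewrite chebyshevS /= !hornerE /= -[RHS]IH; ring.
Qed.

Lemma chebyshev_le n (t : R) : -1 <= t <= 1 ->
  `|(chebyshev n).1.[t]| <= 1 /\ `|(chebyshev n).2.[t]| <= n%:R.
Proof.
move=> /andP[t1 t2].
have H k : `|(chebyshev k).1.[t]| <= 1.
  rewrite -ler_sqr ?nnegrE // expr1n real_normK ?num_real //.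
  rewrite -(chebyshev_pell k t) lerDl mulr_ge0 ?sqr_ge0 //; nra.
split=> //; elim: n => [|n IH]; first by rewrite /= horner0 normr0.
rewrite chebyshevS /= !hornerE /= -natr1.
apply: le_trans (ler_normD _ _) (lerD _ (H _)).
rewrite normrM; apply: le_trans (IH); rewrite ler_piMl //.
by rewrite ler_norml t1.
Qed.

(** Both bounds are linear in [1 - t] and feed each other in the induction; [chebyshev_le] controls
    the terms that carry a factor [1 - t]. *)
Lemma chebyshev_near1 n (t : R) : 0 <= t <= 1 ->
  1 - n%:R ^+ 2 * (1 - t) <= (chebyshev n).1.[t] /\
  n%:R - n%:R ^+ 3 * (1 - t) <= (chebyshev n).2.[t].
Proof.
move=> /andP[t0 t1]; elim: n => [|n [IH1 IH2]].
  by rewrite /= !hornerE !expr0n /= !mul0r subr0.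
have [|A1 A2] := @chebyshev_le n t; first by rewrite t1 andbT; lra.
rewrite chebyshevS /= !hornerE /= -natr1.
have n0 : 0 <= n%:R :> R by rewrite ler0n.
move: IH1 IH2 A1 A2; rewrite !ler_norml.
set T := _.1.[t]; set U := _.2.[t]; set N : R := n%:R.
move=> IH1 IH2 /andP[A1 A1'] /andP[A2 A2'].
have N0 : 0 <= N by [].
have w0 : 0 <= 1 - t by lra.
split.
  have h1 : (1 - t) * T <= 1 - t by nra.
  have h2 : (1 - t) * ((1 + t) * U) <= (1 - t) * (2 * N).
    by rewrite ler_wpM2l //; nra.
  nra.
have h1 : (1 - t) * U <= (1 - t) * N by rewrite ler_wpM2l.
have h2 : 0 <= (1 - t) * (2 * N ^+ 2 + 2 * N + 1).
  by rewrite mulr_ge0 // !addr_ge0 // mulr_ge0 // sqr_ge0.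
nra.
Qed.

Lemma chebyshev_opp n (t : R) :
  (chebyshev n).1.[- t] = (-1) ^+ n * (chebyshev n).1.[t] /\
  (chebyshev n).2.[- t] = - (-1) ^+ n * (chebyshev n).2.[t].
Proof.
elim: n => [|n [IH1 IH2]]; first by rewrite /= !hornerE.
rewrite chebyshevS !hornerE /= !IH1 !IH2 [(-1) ^+ n.+1]exprS; split; ring.
Qed.

Variable d : nat.

(** [U_(N-1) / N] is 1 at [t = 1], and by the Pell identity its square is at most
    [1 / (N ^ 2 * (1 - t ^ 2))]. The power [d] is matched to [int_geometric_le], where each factor
    uses up one half power of the decay of the moments. *)
Definition peak (N : nat) : {poly R} := (N%:R^-1 *: (chebyshev N).2) ^+ d.

Lemma size_peak N : (0 < N)%N -> (size (peak N) <= (d * N.-1).+1)%N.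
Proof.
move=> N0; apply: leq_trans (size_poly_exp_leq _ _) _; rewrite ltnS mulnC leq_mul //.
rewrite -!subn1 leq_sub2r //; apply: leq_trans (size_scale_leq _ _) _.
by have [] := size_chebyshev N.
Qed.

Section peak_bounds.
Variables (N : nat) (t : R).
Hypotheses (N0 : (0 < N)%N) (t1 : -1 <= t <= 1).

Let u := (chebyshev N).2.[t] / N%:R.
Let Npos : 0 < N%:R :> R. Proof. by rewrite ltr0n. Qed.

Let peakE : (peak N).[t] ^+ 2 = (u ^+ 2) ^+ d.
Proof. by rewrite /peak horner_exp hornerZ mulrC exprAC. Qed.

Let u2_ge0 : 0 <= u ^+ 2. Proof. exact: sqr_ge0. Qed.

Let u2_le1 : u ^+ 2 <= 1.
Proof.
have [_ H] := chebyshev_le N t1.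
rewrite -[leLHS]real_normK ?num_real // expr_le1 // normrM normfV.
by rewrite ler_pdivrMr ?normr_gt0 ?gt_eqF // mul1r (ger0_norm (ltW Npos)).
Qed.

Lemma peak_le1 : (peak N).[t] ^+ 2 <= 1.
Proof. by rewrite peakE exprn_ile1. Qed.

(** By parity only [|t|] matters. [chebyshev_near1] gives a loss linear in [1 - |t| <= 1 - t ^ 2];
    squaring and Bernoulli multiply it by [2] and by [d]. *)
Lemma peak_near1 : 1 - (2 * d)%:R * N%:R ^+ 2 * (1 - t ^+ 2) <= (peak N).[t] ^+ 2.
Proof.
have w0 : 0 <= 1 - t ^+ 2 by move: t1; case/andP => ? ?; nra.
have A : 1 - N%:R ^+ 2 * (1 - t ^+ 2) <= `|u|.
  have E : `|(chebyshev N).2.[`|t|]| = `|(chebyshev N).2.[t]|.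
    case: (ger0P t) => // _; have [_ ->] := chebyshev_opp N t.
    by rewrite normrM normrN normrX normrN1 expr1n mul1r.
  have nt : 0 <= `|t| <= 1 by rewrite normr_ge0 ler_norml.
  have [_ H] := chebyshev_near1 N nt.
  have {}H := le_trans H (ler_norm _); rewrite E in H.
  rewrite /u normrM normfV (ger0_norm (ltW Npos)) ler_pdivlMr //.
  apply: le_trans H; rewrite mulrBl mul1r lerD2l lerN2.
  rewrite [leRHS]mulrAC -exprSr ler_wpM2l ?exprn_ge0 ?ler0n //.
  have := real_normK (num_real t); case/andP: nt; nra.
have B : 1 - 2 * N%:R ^+ 2 * (1 - t ^+ 2) <= u ^+ 2.
  rewrite -[leRHS]real_normK ?num_real // -mulrA.
  have z0 : 0 <= N%:R ^+ 2 * (1 - t ^+ 2) by rewrite mulr_ge0 ?sqr_ge0.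
  move: (normr_ge0 u) A z0; set z := N%:R ^+ 2 * _ => a0 A z0.
  by case: (leP z 1) => z1; nra.
rewrite peakE; have H : -1 <= u ^+ 2 - 1 by rewrite lerBrDr addNr.
have := bernoulli_ineq d H; rewrite subrKC; apply: le_trans.
rewrite lerD2l natrM [2 * d%:R]mulrC -!mulrA -mulrN ler_wpM2l ?ler0n //.
rewrite mulrA; lra.
Qed.

(** The bound [1 / (M * (1 - t ^ 2))] with [M = N ^ 2] is not polynomial; the geometric sum [S]
    replaces it, so that moments can integrate it. Split [M] as [M * (1 - t ^ 2M) + M * t ^ 2M]:
    after multiplication by [u ^ 2], the first part is at most [S] by the Pell identity and the
    second because [M * t ^ 2M <= S]. *)
Lemma peak_le_geometric : (peak N).[t] ^+ 2 <=
  (2 / (N ^ 2)%:R * \sum_(K < N ^ 2) t ^+ K.*2) ^+ d.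
Proof.
have w0 : 0 <= 1 - t ^+ 2 by move: t1; case/andP => ? ?; nra.
have M0 : 0 < (N ^ 2)%:R :> R by rewrite ltr0n expn_gt0 N0.
rewrite peakE; set S := \sum_(K < _) _.
have S0 : 0 <= S by apply: sumr_ge0 => K _; rewrite -mul2n exprM exprn_ge0 ?sqr_ge0.
have P : 0 <= 2 / (N ^ 2)%:R * S by rewrite mulr_ge0 // divr_ge0 // ltW.
apply: lerXn2r; rewrite ?nnegrE //.
have E : (1 - t ^+ 2) * S = 1 - (t ^+ 2) ^+ (N ^ 2).
  rewrite /S; under eq_bigr do rewrite -mul2n exprM.
  by rewrite -[in RHS](expr1n _ (N ^ 2)) subrXX; congr (_ * _); apply: eq_bigr => K _; rewrite expr1n mul1r.
have H : (N ^ 2)%:R * (t ^+ 2) ^+ (N ^ 2) <= S.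
  rewrite mulr_natl -[X in _ *+ X]card_ord -sumr_const; apply: ler_sum => K _.
  rewrite -mul2n exprM ler_wiXn2l ?sqr_ge0 //; first by lra.
  exact: ltnW.
have V : u ^+ 2 * ((N ^ 2)%:R * (1 - t ^+ 2)) <= 1.
  rewrite /u exprMn exprVn mulrA natrX divfK ?expf_neq0 ?gt_eqF // mulrC.
  by rewrite -[leRHS](chebyshev_pell N t) lerDr sqr_ge0.
rewrite mulrAC ler_pdivlMr //.
have : u ^+ 2 * ((N ^ 2)%:R * (t ^+ 2) ^+ (N ^ 2)) <= u ^+ 2 * S by rewrite ler_wpM2l.
have : u ^+ 2 * S <= S by rewrite ler_piMl.
have : u ^+ 2 * ((N ^ 2)%:R * (1 - t ^+ 2)) * S <= S by rewrite ler_piMl.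
have -> : u ^+ 2 * ((N ^ 2)%:R * (1 - t ^+ 2)) * S = u ^+ 2 * (N ^ 2)%:R - u ^+ 2 * ((N ^ 2)%:R * (t ^+ 2) ^+ (N ^ 2)).
  rewrite -!mulrA E; ring.
lra.
Qed.

End peak_bounds.
End chebyshev.

(** * Continuity and integration on the sphere *)

Section real_continuity.
Variables (R : realType) (T : topologicalType).
Implicit Types (f g : T -> R).

Lemma continuous_ext f g : f =1 g -> continuous g -> continuous f.
Proof. by move=> /funext ->. Qed.

Lemma continuous_add f g : continuous f -> continuous g ->
  continuous (fun x => f x + g x).
Proof. by move=> cf cg x; exact: continuousD (cf x) (cg x). Qed.

Lemma continuous_sub f g : continuous f -> continuous g ->
  continuous (fun x => f x - g x).
Proof. by move=> cf cg x; exact: continuousB (cf x) (cg x). Qed.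

Lemma continuous_mul f g : continuous f -> continuous g ->
  continuous (fun x => f x * g x).
Proof. by move=> cf cg x; exact: continuousM (cf x) (cg x). Qed.

Lemma continuous_const (c : R) : continuous (fun _ : T => c).
Proof. by move=> x; exact: cst_continuous. Qed.

Lemma continuous_norm f : continuous f -> continuous (fun x => `|f x|).
Proof. by move=> cf x; apply: (@cvg_norm _ R T (nbhs x) _ f (f x)); exact: (cf x). Qed.

Lemma continuous_pow f n : continuous f -> continuous (fun x => f x ^+ n).
Proof.
move=> cf; elim: n => [|n IH]; first exact: continuous_const.
under eq_fun do rewrite exprS; exact: continuous_mul.
Qed.

Lemma continuous_sum (I : Type) (r : seq I) (P : pred I) (F : I -> T -> R) :
  (forall i, continuous (F i)) -> continuous (fun x => \sum_(i <- r | P i) F i x).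
Proof.
move=> cF; elim: r => [|i r IH].
  by under eq_fun do rewrite big_nil; exact: continuous_const.
under eq_fun do rewrite big_cons; case: (P i) => //; exact: continuous_add.
Qed.

End real_continuity.

(** * Compactness of the sphere and inner products of its points *)

Section sphere_topology.
Variables (R : realType) (d : nat).
Implicit Types (x y : sphere R d) (f g : sphere R d -> R).

Lemma sphere_valP x : \sum_i sphere_val x ord0 i ^+ 2 = 1.
Proof. exact: (set_valP x). Qed.

Lemma sphere_val_inj : injective (@sphere_val R d).
Proof. by move=> x y /val_inj. Qed.

Lemma sphere_val_continuous : continuous (@sphere_val R d).
Proof. by move=> x; exact: initial_continuous. Qed.

Lemma sphere_coord_continuous i : continuous (fun x => sphere_val x ord0 i).
Proof.
move=> x; apply: (@continuous_comp _ _ _ (@sphere_val R d) (fun M : 'rV_d.+1 => M ord0 i)).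
  exact: sphere_val_continuous.
exact: coord_continuous.
Qed.

Lemma sphere_coord_le1 x i : `|sphere_val x ord0 i| <= 1.
Proof.
rewrite -(@expr_le1 _ 2) // real_normK ?num_real // -(sphere_valP x).
by rewrite (bigD1 i) //= lerDl sumr_ge0 // => j _; exact: sqr_ge0.
Qed.

Lemma unit_sphere_compact : compact (@unit_sphere R d).
Proof.
apply: bounded_closed_compact.
  exists 1; split => // M M1 x xS /=; apply: ltW; apply: le_lt_trans M1.
  rewrite /Num.norm /= mx_normrE; apply: bigmax_le => // -[i j] _ /=.
  by rewrite ord1; exact: (sphere_coord_le1 (SigSub (mem_set xS)) j).
have -> : @unit_sphere R d = (fun x : 'rV[R]_d.+1 => \sum_i x ord0 i ^+ 2) @^-1` [set 1].
  by [].
apply: closed_comp => [x _|]; last exact: closed_eq.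
move: x.
apply: continuous_sum => i; apply: continuous_pow; exact: coord_continuous.
Qed.

Lemma sphere_compact : compact [set: sphere R d].
Proof.
move=> F PF _.
have GS : (@sphere_val R d @ F) (@unit_sphere R d).
  by apply: (@filterS _ F _ setT) => [x _|]; [exact: sphere_valP|exact: filterT].
have [a [aS ca]] := unit_sphere_compact (fmap_proper_filter _ PF) GS.
exists (SigSub (mem_set aS)); split=> // A B FA /= [_ [[W oW <-] /= Wa WB]].
have /= := ca (@sphere_val R d @` A) W.
case.
- by apply: filterS FA => x Ax; exists x.
- exact: open_nbhs_nbhs.
by move=> _ [[y Ay <-] Wy]; exists y; split=> //; exact: WB.
Qed.

Lemma sphere_continuous_bounded f : continuous f ->
  exists2 M, 0 <= M & forall x, `|f x| <= M.
Proof.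
move=> cf.
have [c _ H] := @compact_EVT_max _ R (fun x => `|f x|) setT (ex_intro _ point I)
  sphere_compact (continuous_subspaceT (continuous_norm cf)).
by exists `|f c| => // x; apply: H; rewrite inE.
Qed.

Lemma sphere_continuous_max f : continuous f ->
  exists c, forall x, `|f x| <= `|f c|.
Proof.
move=> cf.
have [c _ H] := @compact_EVT_max _ R (fun x => `|f x|) setT (ex_intro _ point I)
  sphere_compact (continuous_subspaceT (continuous_norm cf)).
by exists c => x; apply: H; rewrite inE.
Qed.

Definition dotp x y : R := \sum_i sphere_val x ord0 i * sphere_val y ord0 i.

Lemma dotpC x y : dotp x y = dotp y x.
Proof. by apply: eq_bigr => i _; rewrite mulrC. Qed.

Lemma dotp_dist x y :
  1 - dotp x y = 2^-1 * \sum_i (sphere_val x ord0 i - sphere_val y ord0 i) ^+ 2.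
Proof.
under eq_bigr do rewrite sqrrB.
rewrite big_split /= sumrB !sphere_valP sumrMnl -/(dotp x y) -mulr_natr; lra.
Qed.

Lemma dotp_itv x y : -1 <= dotp x y <= 1.
Proof.
apply/andP; split; last by rewrite -subr_ge0 dotp_dist mulr_ge0 // sumr_ge0 // => i _; exact: sqr_ge0.
have : 0 <= \sum_i (sphere_val x ord0 i + sphere_val y ord0 i) ^+ 2.
  by rewrite sumr_ge0 // => i _; exact: sqr_ge0.
under eq_bigr do rewrite sqrrD.
rewrite big_split /= big_split /= !sphere_valP sumrMnl -/(dotp x y) -mulr_natr; lra.
Qed.

Lemma dotp_continuous x : continuous (dotp x).
Proof.
apply: continuous_sum => i; apply: continuous_mul; first exact: continuous_const.
exact: sphere_coord_continuous.
Qed.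

(* Compactness in a form that can be integrated against a zonal kernel. *)
Lemma sphere_uniform_continuity f (e : R) : continuous f -> 0 < e ->
  exists C : R, forall x y, `|f x - f y| <= e + C * (1 - dotp x y).
Proof.
move=> cf e0; have [M M0 fM] := sphere_continuous_bounded cf.
have := (iffLR (compact_near_coveringP _)) sphere_compact _ (pinfty_nbhs R)
  (fun C x => forall y, `|f x - f y| <= e + C * (1 - dotp x y)) _.
case.
- move=> z _.
  have nz : \forall x \near z, `|f z - f x| < e / 2.
    have /cvgr_dist_lt := cf z; apply; lra.
  have [_ [[W oW <-] /= Wz WB]] := nz.
  have /nbhs_ballP[r /= r0 rW] : nbhs (sphere_val z) W by exact: open_nbhs_nbhs.
  have near_z x : (forall i, `|sphere_val z ord0 i - sphere_val x ord0 i| < r) ->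
      `|f z - f x| < e / 2.
    move=> H; apply: (WB x); apply: rW; split=> // i j; rewrite ord1; exact: H.
  have nz2 : \forall x \near z, forall i, `|sphere_val z ord0 i - sphere_val x ord0 i| < r / 2.
    have : nbhs (sphere_val z) [set v : 'rV[R]_d.+1 | forall i, `|sphere_val z ord0 i - v ord0 i| < r / 2].
      apply/nbhs_ballP; exists (r / 2) => /=; first by rewrite divr_gt0.
      by move=> v [_ zv] i; exact: zv.
    by move=> /(@sphere_val_continuous z).
  (* If some coordinates of [x] and [y] differ by at least [r / 2], then
     [1 - dotp x y >= r ^ 2 / 8], and for such [C] the second term dominates the trivial bound
     [2 * M]. *)
  exists ([set x | forall i, `|sphere_val z ord0 i - sphere_val x ord0 i| < r / 2],
          [set C | 2 * M / (r ^+ 2 / 8) <= C]).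
    split=> //=; exists (2 * M / (r ^+ 2 / 8)); split; first exact: num_real.
    by move=> C; exact: ltW.
  move=> [x C] [/= zx rC] y.
  have C0 : 0 <= C by apply: le_trans rC; rewrite !mulr_ge0 // invr_ge0 mulr_ge0 // sqr_ge0.
  have D0 : 0 <= 1 - dotp x y by rewrite subr_ge0; case/andP: (dotp_itv x y).
  have [zy|] := pselect (forall i, `|sphere_val z ord0 i - sphere_val y ord0 i| < r).
    have h1 := near_z _ zy.
    have h2 : `|f z - f x| < e / 2.
      by apply: near_z => i; apply: lt_trans (zx i) _; lra.
    have : `|f x - f y| <= e.
      rewrite -(subrK (f z) (f x)) -addrA (le_trans (ler_normD _ _)) // distrC; lra.
    by move=> /le_trans; apply; rewrite lerDl mulr_ge0.
  move=> /existsNP[i /negP]; rewrite -leNgt => ry.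
  have xy : r / 2 <= `|sphere_val x ord0 i - sphere_val y ord0 i|.
    have := ler_distD (sphere_val x ord0 i) (sphere_val z ord0 i) (sphere_val y ord0 i).
    have := zx i; lra.
  have dxy : r ^+ 2 / 8 <= 1 - dotp x y.
    rewrite dotp_dist (bigD1 i) //= mulrDr.
    have : 0 <= 2^-1 * \sum_(j | j != i) (sphere_val x ord0 j - sphere_val y ord0 j) ^+ 2.
      by rewrite mulr_ge0 // sumr_ge0 // => j _; exact: sqr_ge0.
    have := real_normK (num_real (sphere_val x ord0 i - sphere_val y ord0 i)).
    nra.
  have r8 : 0 < r ^+ 2 / 8 by rewrite divr_gt0 // exprn_gt0.
  have : `|f x - f y| <= 2 * M.
    by rewrite (le_trans (ler_normB _ _)) // mulr_natl mulr2n lerD.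
  move=> /le_trans; apply.
  have : 2 * M <= C * (1 - dotp x y).
    rewrite -(divfK (lt0r_neq0 r8) (2 * M)); apply: ler_pM => //; last exact: ltW.
    by rewrite divr_ge0 ?mulr_ge0 // ltW.
  lra.
- move=> C [Creal H]; exists (C + 1) => x y; apply: (H (C + 1)) => //.
  by rewrite ltrDl.
Qed.

End sphere_topology.

Ltac cont :=
  lazymatch goal with
  | |- continuous (fun _ => ?c) => exact: continuous_const
  | |- continuous (fun x => @?f x - @?g x) =>
      apply: (@continuous_sub _ _ f g); cont
  | |- continuous (fun x => @?f x + @?g x) =>
      apply: (@continuous_add _ _ f g); cont
  | |- continuous (fun x => @?f x * @?g x) =>
      apply: (@continuous_mul _ _ f g); cont
  | |- continuous (fun x => (@?f x) ^+ ?n) =>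
      apply: (@continuous_pow _ _ f n); cont
  | |- continuous (fun x => `| @?f x |) =>
      apply: (@continuous_norm _ _ f); cont
  | |- continuous (fun x => \sum_(i <- ?r | @?P i) (@?F x i)) =>
      apply: continuous_sum; intro; cbv beta; cont
  | |- continuous _ => solve [assumption | exact: sphere_coord_continuous
      | exact: dotp_continuous | trivial]
  end.

(** * Integration of continuous functions *)

Section sphere_integral.
Variables (R : realType) (d : nat) (sigma : probability (borel_sphere R d) R).
Implicit Types (f g : sphere R d -> R).

Lemma sphere_continuous_measurable f : continuous f ->
  measurable_fun [set: borel_sphere R d] f.
Proof.
move=> /continuousP cf; apply: (measurability _ (measurable_realfun.RGenOpens.measurableE R)).
move=> /= _ [_ [a [b ->]] <-]; apply: measurableI => //.
by apply: sub_sigma_algebra; apply: cf; exact: interval_open.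
Qed.

Lemma sphere_integrable f : continuous f ->
  sigma.-integrable [set: borel_sphere R d] (EFin \o f).
Proof.
move=> cf; apply: measurable_bounded_integrable => //.
- by apply: (@le_lt_trans _ _ 1%E); [exact: probability_le1|rewrite ltry].
- exact: sphere_continuous_measurable.
- have [M M0 fM] := sphere_continuous_bounded cf.
  exists M; split => [|K MK x _]; first exact: ger0_real.
  exact: le_trans (fM x) (ltW MK).
Qed.

Lemma intD f g : continuous f -> continuous g ->
  \int[sigma]_x (f x + g x) = \int[sigma]_x f x + \int[sigma]_x g x.
Proof. by move=> cf cg; rewrite RintegralD //; exact: sphere_integrable. Qed.

Lemma intB f g : continuous f -> continuous g ->
  \int[sigma]_x (f x - g x) = \int[sigma]_x f x - \int[sigma]_x g x.
Proof. by move=> cf cg; rewrite RintegralB //; exact: sphere_integrable. Qed.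

Lemma intZ f (c : R) : continuous f ->
  \int[sigma]_x (c * f x) = c * \int[sigma]_x f x.
Proof. by move=> cf; rewrite RintegralZl //; exact: sphere_integrable. Qed.

Lemma int_cst (c : R) : \int[sigma]_x c = c.
Proof. by rewrite Rintegral_cst //= [sigma _]probability_setT mulr1. Qed.

Lemma int_le f g : continuous f -> continuous g -> (forall x, f x <= g x) ->
  \int[sigma]_x f x <= \int[sigma]_x g x.
Proof. by move=> cf cg fg; apply: le_Rintegral => //; exact: sphere_integrable. Qed.

Lemma int_ge0 f : (forall x, 0 <= f x) -> 0 <= \int[sigma]_x f x.
Proof. by move=> f0; apply: Rintegral_ge0. Qed.

Lemma int_ext f g : f =1 g -> \int[sigma]_x f x = \int[sigma]_x g x.
Proof. by move=> fg; apply: eq_Rintegral => x _. Qed.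

Lemma int_sum (I : Type) (r : seq I) (P : pred I) (F : I -> sphere R d -> R) :
  (forall i, continuous (F i)) ->
  \int[sigma]_x (\sum_(i <- r | P i) F i x) = \sum_(i <- r | P i) \int[sigma]_x F i x.
Proof.
move=> cF; elim: r => [|i r IH].
  by rewrite big_nil; under eq_Rintegral do rewrite big_nil; rewrite int_cst.
rewrite big_cons; under eq_Rintegral do rewrite big_cons.
case: (P i) => //; rewrite intD ?IH //; exact: continuous_sum.
Qed.

Lemma int_norm_le f : continuous f -> `|\int[sigma]_x f x| <= \int[sigma]_x `|f x|.
Proof. by move=> cf; apply: le_normr_Rintegral => //; exact: sphere_integrable. Qed.

(** The integral of [w * (t * f + g) ^ 2] is a nonnegative quadratic in [t]; the inequality is its
    value at [- b / a]. *)
Lemma int_cauchy_schwarz (w f g : sphere R d -> R) :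
  continuous w -> continuous f -> continuous g -> (forall x, 0 <= w x) ->
  (\int[sigma]_x (w x * (f x * g x))) ^+ 2 <=
  (\int[sigma]_x (w x * f x ^+ 2)) * (\int[sigma]_x (w x * g x ^+ 2)).
Proof.
move=> cw cf cg w0.
set a := \int[sigma]_x (w x * f x ^+ 2); set b := \int[sigma]_x (w x * (f x * g x)).
set c := \int[sigma]_x (w x * g x ^+ 2).
have a0 : 0 <= a by apply: int_ge0 => x; rewrite mulr_ge0 ?sqr_ge0.
have c0 : 0 <= c by apply: int_ge0 => x; rewrite mulr_ge0 ?sqr_ge0.
have cff := continuous_mul cw (continuous_pow (n:=2) cf).
have cgg := continuous_mul cw (continuous_pow (n:=2) cg).
have cfg := continuous_mul cw (continuous_mul cf cg).
have Q t : 0 <= t ^+ 2 * a + (2 * t) * b + c.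
  rewrite /a /b /c -!intZ // -!intD //; try by cont.
  apply: int_ge0 => x.
  have -> : t ^+ 2 * (w x * f x ^+ 2) + 2 * t * (w x * (f x * g x)) + w x * g x ^+ 2 =
    w x * (t * f x + g x) ^+ 2 by ring.
  by rewrite mulr_ge0 ?sqr_ge0.
have [a00|an0] := eqVneq a 0.
  have [->|b0] := eqVneq b 0; first by rewrite expr0n mulr_ge0.
  (* With [a = 0] the quadratic is affine in [t], and a nonzero slope would make it negative at this
     point. *)
  have := Q (- (c + 1) / b); rewrite a00 mulr0 add0r.
  have -> : 2 * (- (c + 1) / b) * b = - 2 * (c + 1) by field.
  lra.
have {}a0 : 0 < a by rewrite lt_def an0.
have := mulr_ge0 (Q (- b / a)) (ltW a0).
have -> : ((- b / a) ^+ 2 * a + 2 * (- b / a) * b + c) * a = a * c - b ^+ 2 by field.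
lra.
Qed.

End sphere_integral.

(** Induction over the generators of the algebra: statements of Leibniz type pass to products
    without computing on monomials. *)
Lemma mpoly_alg_ind (R : realType) (n : nat) (P : mpoly n R -> Prop) :
  (forall c, P (mpolyC n c)) -> (forall i, P (mpolyX R (mnm1 i))) ->
  (forall p q, P p -> P q -> P (p + q)) ->
  (forall p q, P p -> P q -> P (p * q)) -> forall p, P p.
Proof.
move=> PC PX PD PM; apply: mpolyind; first by rewrite -mpolyC0; exact: PC.
move=> c m p _ _ Pp; apply: (PD) => //; rewrite -mul_mpolyC; apply: (PM) => //.
rewrite mpolyXE_id; apply: (big_ind P) => [|p' q'|i _]; [by rewrite -mpolyC1; exact: PC|exact: PM|].
 elim: (m i) => [|k IH]; first by rewrite expr0 -mpolyC1; exact: PC.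
by rewrite exprS; apply: PM.
Qed.

Lemma continuous_rV (R : realType) (T : topologicalType) n (h : T -> 'rV[R]_n) :
  (forall i, continuous (fun x => h x ord0 i)) -> continuous h.
Proof.
move=> ch x; apply/cvg_ballP => e e0.
have : \forall y \near x, forall i, ball (h x ord0 i) e (h y ord0 i).
  by apply: filter_forall => i; have /cvg_ballP := ch i x; apply.
by apply: filterS => y Hy; split=> // i j; rewrite ord1.
Qed.

(** * Rotation invariance and infinitesimal rotations *)

Section mpoly_sphere.
Variables (R : realType) (d : nat).
Implicit Types (p q : mpoly d.+1 R) (x y : sphere R d).

Lemma mderiv_var (k j : 'I_d.+1) : mderiv j (mpolyX R (mnm1 k)) = mpolyC d.+1 (k == j)%:R.
Proof.
rewrite mderivX mnm1E; have [->|kj] := eqVneq k j; last by rewrite scale0r mpolyC0.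
rewrite scale1r mpolyC1 -mpolyX0; congr mpolyX.
by apply/mnmP => t; rewrite mnmBE subnn mnm0E.
Qed.

Lemma poly_restrD p q x : poly_restr (p + q) x = poly_restr p x + poly_restr q x.
Proof. exact: mevalD. Qed.
Lemma poly_restrB p q x : poly_restr (p - q) x = poly_restr p x - poly_restr q x.
Proof. exact: mevalB. Qed.
Lemma poly_restrM p q x : poly_restr (p * q) x = poly_restr p x * poly_restr q x.
Proof. exact: mevalM. Qed.
Lemma poly_restrZ c p x : poly_restr (c *: p) x = c * poly_restr p x.
Proof. exact: mevalZ. Qed.
Lemma poly_restrC c x : poly_restr (mpolyC d.+1 c) x = c.
Proof. exact: mevalC. Qed.
Lemma poly_restr0 x : poly_restr 0 x = 0.
Proof. exact: meval0. Qed.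
Lemma poly_restrX i x : poly_restr (mpolyX R (mnm1 i)) x = sphere_val x ord0 i.
Proof. exact: mevalXU. Qed.
Lemma poly_restr_sum (I : Type) (r : seq I) (P : pred I) (F : I -> mpoly d.+1 R) x :
  poly_restr (\sum_(i <- r | P i) F i) x = \sum_(i <- r | P i) poly_restr (F i) x.
Proof. by rewrite /poly_restr raddf_sum. Qed.
Lemma poly_restrXn p n x : poly_restr (p ^+ n) x = poly_restr p x ^+ n.
Proof. by rewrite /poly_restr rmorphXn. Qed.

Lemma poly_restr_continuous p : continuous (poly_restr p).
Proof.
elim/mpoly_alg_ind: p => [c|i|p q cp cq|p q cp cq].
- by apply: continuous_ext (poly_restrC c) _; cont.
- exact: continuous_ext (poly_restrX i) (@sphere_coord_continuous R d i).
- by apply: continuous_ext (poly_restrD p q) _; cont.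
- by apply: continuous_ext (poly_restrM p q) _; cont.
Qed.

Section rotation.
Variable sigma : probability (borel_sphere R d) R.
Hypothesis rot_inv : rotation_invariant sigma.

Section rotate.
Variable Q : 'M[R]_d.+1.
Hypothesis QQ : Q *m Q^T = 1%:M.

Lemma unit_sphere_rotate x : unit_sphere (sphere_val x *m Q).
Proof.
have E (v : 'rV[R]_d.+1) : \sum_i v ord0 i ^+ 2 = (v *m v^T) ord0 ord0.
  by rewrite mxE; apply: eq_bigr => i _; rewrite mxE expr2.
by rewrite /unit_sphere /= E trmx_mul mulmxA -(mulmxA _ Q) QQ mulmx1 -E sphere_valP.
Qed.

Definition rotate x : sphere R d := SigSub (mem_set (unit_sphere_rotate x)).

Lemma rotate_continuous : continuous rotate.
Proof.
have c1 : continuous (fun x => sphere_val x *m Q).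
  apply: continuous_rV => i.
  apply: (@continuous_ext _ _ _ (fun x => \sum_j sphere_val x ord0 j * Q j i)) => [x|].
    by rewrite mxE.
  cont.
apply/continuousP => _ [W oW <-].
by have /continuousP := c1; apply.
Qed.

Lemma int_rotate f : \det Q = 1 -> continuous f ->
  \int[sigma]_x f (rotate x) = \int[sigma]_x f x.
Proof.
move=> dQ cf.
have mh : measurable_fun [set: borel_sphere R d] (rotate : borel_sphere R d -> borel_sphere R d).
  apply: (@measurability _ _ (borel_sphere R d) (borel_sphere R d) setT rotate (@open (sphere R d))) => // _ [U oU <-].
  rewrite setTI; apply: sub_sigma_algebra.
  by have /continuousP := rotate_continuous; apply.
have cfr : continuous (fun x => f (rotate x)).
  move=> x; apply: continuous_comp; [exact: rotate_continuous|exact: cf].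
rewrite /Rintegral; congr fine.
have := @integral_pushforward _ _ _ _ R _ mh sigma setT (EFin \o f) _ _ _.
rewrite preimage_setT => <- //.
- apply: eq_measure_integral => A mA _.
  rewrite /pushforward -[RHS](rot_inv QQ dQ mA); congr (sigma _).
  apply/seteqP; split=> x /=; first by move=> Ax; exists (rotate x).
  by move=> [y Ay yx]; have <- : y = rotate x by apply: sphere_val_inj.
- by apply/measurable_realfun.measurable_EFinP; exact: sphere_continuous_measurable.
- exact: sphere_integrable.
Qed.

End rotate.

(** * Plane rotations and their generators *)

Section givens.
Variables i j : 'I_d.+1.
Hypothesis ij : i != j.

(** The rotation of the [(i, j)] plane with cosine [a] and sine [b]. It is defined for all [a] and
    [b], so that products follow complex multiplication. *)
Definition givens (a b : R) : 'M[R]_d.+1 :=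
  1%:M + (a - 1) *: (delta_mx i i + delta_mx j j)
       + b *: (delta_mx i j - delta_mx j i).

Lemma givens_mul a b a' b' :
  givens a b *m givens a' b' = givens (a * a' - b * b') (a * b' + b * a').
Proof.
rewrite /givens.
set A := delta_mx i i + delta_mx j j; set B := delta_mx i j - delta_mx j i.
have ji : (j == i) = false by rewrite eq_sym (negbTE ij).
have D := @mul_delta_mx_cond R d.+1 d.+1 d.+1.
have AA : A *m A = A.
  by rewrite /A !mulmxDl !mulmxDr !D !eqxx ji (negbTE ij) !mulr1n !mulr0n !addr0 add0r.
have AB : A *m B = B.
  by rewrite /A /B !mulmxDl !mulmxBr !D !eqxx ji (negbTE ij) !mulr1n !mulr0n !subr0 sub0r.
have BA : B *m A = B.
  by rewrite /A /B !mulmxBl !mulmxDr !D !eqxx ji (negbTE ij) !mulr1n !mulr0n !addr0 add0r.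
have BB : B *m B = - A.
  by rewrite /A /B !mulmxBl !mulmxBr !D !eqxx ji (negbTE ij) !mulr1n !mulr0n !subr0 sub0r opprD.
rewrite !mulmxDl !mulmxDr !mul1mx !mulmx1 -!scalemxAl -!scalemxAr AA AB BA BB.
rewrite !scalerA; apply/matrixP => k l; rewrite !mxE; ring.
Qed.

Lemma givens_tr a b : (givens a b)^T = givens a (- b).
Proof.
apply/matrixP => k l; rewrite !mxE eq_sym.
rewrite ![(l == _) && (k == _)]andbC; ring.
Qed.

Lemma givens10 : givens 1 0 = 1%:M.
Proof. by rewrite /givens subrr !scale0r !addr0. Qed.

Lemma givens_orth a b : a ^+ 2 + b ^+ 2 = 1 -> givens a b *m (givens a b)^T = 1%:M.
Proof.
move=> ab; rewrite givens_tr givens_mul -givens10; congr givens; last by ring.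
by rewrite -ab; ring.
Qed.

(* [givens c s] with [c^2 + s^2 = 1] is the square of another rotation, hence
   has determinant 1. *)
Lemma givens_det a b : a ^+ 2 + b ^+ 2 = 1 ->
  \det (givens (a * a - b * b) (a * b + b * a)) = 1.
Proof.
move=> ab; rewrite -givens_mul det_mulmx -{2}(det_tr (givens a b)) -det_mulmx.
by rewrite givens_orth // det1.
Qed.

Lemma givens_val (v : 'rV[R]_d.+1) a b k : (v *m givens a b) ord0 k =
  v ord0 k + (a - 1) * (v ord0 i * (k == i)%:R + v ord0 j * (k == j)%:R)
  + b * (v ord0 i * (k == j)%:R - v ord0 j * (k == i)%:R).
Proof.
have E (u w : 'I_d.+1) : (v *m delta_mx u w) ord0 k = v ord0 u * (k == w)%:R.
  rewrite mxE (bigD1 u) //= mxE eqxx /= big1 ?addr0 // => t tu.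
  by rewrite mxE (negbTE tu) /= mulr0.
rewrite /givens !mulmxDr mulmx1 -!scalemxAr mulmxDr mulmxBr.
move: (E i i) (E j j) (E i j) (E j i).
move: (v *m _) (v *m _) (v *m _) (v *m _) => V1 V2 V3 V4 e1 e2 e3 e4.
by rewrite !mxE e1 e2 e3 e4.
Qed.

Definition rot_deriv p : mpoly d.+1 R :=
  mpolyX R (mnm1 i) * mderiv j p - mpolyX R (mnm1 j) * mderiv i p.

(** With [c] and [s] a cosine and a sine, [1 - c] is of second order in the angle, and
    [s ^ 2 <= 2 * (1 - c)] absorbs the product of the two first-order terms in the Leibniz case. The
    constant is uniform in the point and in the rotation, which allows integration. *)
Lemma rot_deriv_taylor p : exists2 C : R, 0 <= C &
  forall c s (x y : sphere R d), 0 <= c -> c ^+ 2 + s ^+ 2 = 1 ->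
    sphere_val y = sphere_val x *m givens c s ->
    `|poly_restr p y - poly_restr p x - s * poly_restr (rot_deriv p) x| <= C * (1 - c).
Proof.
elim/mpoly_alg_ind: p => [a|k|p q [Cp Cp0 Hp] [Cq Cq0 Hq]|p q [Cp Cp0 Hp] [Cq Cq0 Hq]].
- exists 0 => // c s x y _ _ _; rewrite mul0r !poly_restrC /rot_deriv !mderivC.
  by rewrite !mulr0 subr0 poly_restr0 mulr0 !subrr normr0.
- exists 2 => // c s x y c0 cs yx.
  have c1 : 0 <= 1 - c by have := sqr_ge0 s; nra.
  rewrite /rot_deriv poly_restrB !poly_restrM !mderiv_var !poly_restrC !poly_restrX yx givens_val.
  set u := sphere_val x ord0 i; set v := sphere_val x ord0 j.
  have -> : sphere_val x ord0 k + (c - 1) * (u * (k == i)%:R + v * (k == j)%:R) +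
    s * (u * (k == j)%:R - v * (k == i)%:R) - sphere_val x ord0 k -
    s * (u * (k == j)%:R - v * (k == i)%:R) = - (u * (k == i)%:R + v * (k == j)%:R) * (1 - c) by ring.
  rewrite normrM normrN (ger0_norm c1) ler_wpM2r //.
  apply: le_trans (ler_normD _ _) _; rewrite -[leRHS]/(1 + 1); apply: lerD.
    by rewrite normrM -[leRHS]mulr1 ler_pM // ?sphere_coord_le1 // normr_nat; case: (_ == _).
  by rewrite normrM -[leRHS]mulr1 ler_pM // ?sphere_coord_le1 // normr_nat; case: (_ == _).
- exists (Cp + Cq); first exact: addr_ge0.
  move=> c s x y c0 cs yx; have := Hp c s x y c0 cs yx; have := Hq c s x y c0 cs yx.
  rewrite /rot_deriv !mderivD !poly_restrB !poly_restrM !poly_restrD => h1 h2.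
  rewrite mulrDl; apply: le_trans (lerD h2 h1); apply: le_trans (ler_normD _ _).
  rewrite le_eqVlt; apply/orP; left; apply/eqP; congr `|_|; ring.
have [Mp Mp0 hMp] := sphere_continuous_bounded (@poly_restr_continuous p).
have [Mq Mq0 hMq] := sphere_continuous_bounded (@poly_restr_continuous q).
have [Np Np0 hNp] := sphere_continuous_bounded (@poly_restr_continuous (rot_deriv p)).
have [Nq Nq0 hNq] := sphere_continuous_bounded (@poly_restr_continuous (rot_deriv q)).
exists (Cp * Mq + (Mp + Np) * Cq + 2 * Np * Nq).
  by rewrite !addr_ge0 // !mulr_ge0 // addr_ge0.
move=> c s x y c0 cs yx; have := Hp c s x y c0 cs yx; have := Hq c s x y c0 cs yx.
have := hMp x; have := hMq y; have := hNp x; have := hNq x.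
have -> : poly_restr (rot_deriv (p * q)) x =
   poly_restr (rot_deriv p) x * poly_restr q x + poly_restr p x * poly_restr (rot_deriv q) x.
  rewrite /rot_deriv !mderivM !(poly_restrB, poly_restrM, poly_restrD); ring.
rewrite !poly_restrM.
set P := poly_restr p x; set P' := poly_restr p y; set Q := poly_restr q x.
set Q' := poly_restr q y; set DP := poly_restr (rot_deriv p) x; set DQ := poly_restr (rot_deriv q) x.
move=> hDQ hDP hQ' hP hq hp.
have c1 : 0 <= 1 - c by have := sqr_ge0 s; nra.
have s1 : `|s| <= 1.
  by rewrite -(@expr_le1 _ 2) // real_normK ?num_real //; have := sqr_ge0 c; nra.
have -> : P' * Q' - P * Q - s * (DP * Q + P * DQ) =
  (P' - P - s * DP) * Q' + (P + s * DP) * (Q' - Q - s * DQ) + s ^+ 2 * (DP * DQ) by ring.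
apply: le_trans (ler_normD _ _) _; rewrite [leRHS]mulrDl; apply: lerD.
  apply: le_trans (ler_normD _ _) _; rewrite [leRHS]mulrDl; apply: lerD.
    by rewrite normrM [leRHS]mulrAC; apply: ler_pM.
  rewrite normrM -mulrA; apply: ler_pM => //.
  apply: le_trans (ler_normD _ _) _; apply: lerD => //; rewrite normrM.
  by rewrite -[leRHS]mul1r; apply: ler_pM.
have hs : s ^+ 2 <= 2 * (1 - c) by nra.
have hD : `|DP * DQ| <= Np * Nq by rewrite normrM ler_pM.
rewrite normrM (ger0_norm (sqr_ge0 s)).
have -> : 2 * Np * Nq * (1 - c) = 2 * (1 - c) * (Np * Nq) by ring.
by rewrite ler_pM ?sqr_ge0.
Qed.

(** Invariance cancels the terms of order zero, so [s] times the integral is bounded by the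
    second-order remainder; a small angle then forces the integral to vanish. *)
Lemma int_rot_deriv p : \int[sigma]_x poly_restr (rot_deriv p) x = 0.
Proof.
have [C C0 H] := rot_deriv_taylor p.
set I0 := Rintegral _ _ _.
have key (b : R) : 0 < b -> b <= 1 / 2 -> b * `|I0| <= C * (2 * b ^+ 2).
  move=> b0 b1; pose a := Num.sqrt (1 - b ^+ 2).
  have aa : a ^+ 2 + b ^+ 2 = 1.
    by rewrite /a sqr_sqrtr ?subrK // subr_ge0; nra.
  have a0 : 0 <= a by exact: sqrtr_ge0.
  have a1 : 1 / 2 <= a by nra.
  (* Doubling the angle makes [givens_det] applicable; then [1 - c = 2 * b ^ 2], and [a >= 1 / 2]
     gives [s >= b]. *)
  pose c := a * a - b * b; pose s := a * b + b * a.
  have c0 : 0 <= c by rewrite /c; nra.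
  have cs : c ^+ 2 + s ^+ 2 = 1.
    rewrite /c /s; have -> : 1 = (a ^+ 2 + b ^+ 2) ^+ 2 by rewrite aa expr1n.
    ring.
  have QQ := givens_orth cs.
  have cp := @poly_restr_continuous p; have cd := @poly_restr_continuous (rot_deriv p).
  have cr : continuous (fun x => poly_restr p (rotate QQ x)).
    move=> x; apply: continuous_comp; [exact: rotate_continuous|exact: cp].
  have E : s * I0 = - \int[sigma]_x (poly_restr p (rotate QQ x) - poly_restr p x
      - s * poly_restr (rot_deriv p) x).
    rewrite !intB ?intZ //; try by cont.
    by rewrite int_rotate ?givens_det // subrr sub0r opprK.
  have s0 : b <= s by rewrite /s; nra.
  apply: (@le_trans _ _ (s * `|I0|)); first by rewrite ler_wpM2r.
  have s0' : 0 <= s by lra.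
  rewrite -(ger0_norm s0') -normrM E normrN.
  apply: le_trans (int_norm_le _ _) _; first by cont.
  have -> : C * (2 * b ^+ 2) = \int[sigma]_x (C * (1 - c)).
    rewrite int_cst /c; congr (C * _); move: aa; rewrite !expr2; lra.
  apply: int_le => [||x]; try by cont.
  exact: H.
apply/eqP; rewrite -normr_le0 leNgt; apply/negP => I0gt.
(* For this [b], [key] yields [|I0| <= 2 * C * b <= |I0| / 2], a contradiction. *)
pose b := Num.min (1 / 2) (`|I0| / (4 * (C + 1))).
have b0 : 0 < b by rewrite /b lt_min divr_gt0 //= divr_gt0 // mulr_gt0 //; lra.
have b1 : b <= 1 / 2 by rewrite /b ge_min lexx.
have b2 : b <= `|I0| / (4 * (C + 1)) by rewrite /b ge_min lexx orbT.
have := key b b0 b1; rewrite [b ^+ 2]expr2 mulrCA mulrA [X in _ <= X]mulrC -mulrA.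
move: b2; rewrite ler_pdivlMr; last by lra.
move=> b2; rewrite -subr_ge0.
nra.
Qed.

End givens.

Lemma euler_homog p k : p \is ishomog1 k (@mdeg d.+1) ->
  \sum_i mpolyX R (mnm1 i) * mderiv i p = k%:R *: p.
Proof.
move=> /dhomogP hp.
rewrite {2}[p]mpolyE scaler_sumr.
have E i : mpolyX R (mnm1 i) * mderiv i p =
    \sum_(m <- msupp p) (mcoeff m p * (m i)%:R) *: mpolyX R m.
  rewrite {1}[p]mpolyE raddf_sum /= mulr_sumr; apply: eq_bigr => m _.
  rewrite mderivZ mderivX scalerA -scalerAr -mpolyXD.
  have [->|mi] := eqVneq (m i) 0%N; first by rewrite mulr0 !scale0r.
  by rewrite addmC submK // lep1mP.
under eq_bigr do rewrite E.
rewrite exchange_big /=; apply: eq_big_seq => m mp.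
rewrite -scaler_suml -mulr_sumr -natr_sum scalerA mulrC; congr (_ * _ *: _).
by rewrite -mdegE hp.
Qed.

(** Sum over [j != i] the vanishing integrals of the generators applied to [x_j * p]: on the unit
    sphere, with Euler's identity, the integrand becomes [d_i p - (k + d) * x_i * p]. *)
Lemma int_mderiv p k i : p \is ishomog1 k (@mdeg d.+1) ->
  \int[sigma]_x poly_restr (mderiv i p) x =
  (k + d)%:R * \int[sigma]_x poly_restr (mpolyX R (mnm1 i) * p) x.
Proof.
move=> hp.
have cP q : continuous (poly_restr q) by exact: poly_restr_continuous.
apply/eqP; rewrite -subr_eq0 -intZ // -intB //; last by cont.
apply/eqP; transitivity (\sum_(j < d.+1 | j != i) \int[sigma]_x
  poly_restr (rot_deriv j i (mpolyX R (mnm1 j) * p)) x); last first.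
  by rewrite big1 // => j ji; rewrite int_rot_deriv.
rewrite -int_sum //; apply: int_ext => x.
under eq_bigr => j ji do
  rewrite /rot_deriv !mderivM !mderiv_var eqxx (negbTE ji) mpolyC0 mul0r add0r mpolyC1 mul1r
    poly_restrB !poly_restrM poly_restrD poly_restrM !poly_restrX.
have E1 : \sum_(j | j != i) sphere_val x ord0 j ^+ 2 = 1 - sphere_val x ord0 i ^+ 2.
  by rewrite -(sphere_valP x) [in RHS](bigD1 i) //= addrC addrK.
have E2 : \sum_(j | j != i) sphere_val x ord0 j * poly_restr (mderiv j p) x =
    k%:R * poly_restr p x - sphere_val x ord0 i * poly_restr (mderiv i p) x.
  rewrite -poly_restrZ -(euler_homog hp) poly_restr_sum [in RHS](bigD1 i) //=.
  rewrite poly_restrM poly_restrX addrC addrK.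
  by apply: eq_bigr => j _; rewrite poly_restrM poly_restrX.
transitivity ((\sum_(j | j != i) sphere_val x ord0 j ^+ 2) * poly_restr (mderiv i p) x
  - sphere_val x ord0 i * (d%:R * poly_restr p x +
     \sum_(j | j != i) sphere_val x ord0 j * poly_restr (mderiv j p) x)).
  rewrite E1 E2 poly_restrM poly_restrX natrD; ring.
have -> : d%:R * poly_restr p x = \sum_(j < d.+1 | j != i) poly_restr p x.
  by rewrite sumr_const cardC1 card_ord mulr_natl.
rewrite mulr_suml -big_split /= mulr_sumr -sumrB; apply: eq_bigr => j _; ring.
Qed.

End rotation.
End mpoly_sphere.

(** * Harmonic polynomials *)

Section homogeneous.
Variables (R : realType) (d : nat).
Implicit Types (p q F P : mpoly d.+1 R) (x y : sphere R d).

Local Notation homog k := (ishomog1 k (@mdeg d.+1)).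
Local Notation var i := (mpolyX R (mnm1 i)).

Lemma homog_mderiv p k i : p \is homog k -> mderiv i p \is homog k.-1.
Proof.
move=> /dhomogP hp; apply/dhomogP => m; rewrite mcoeff_msupp mcoeff_mderiv => H.
have /hp : mnm_add m (mnm1 i) \in msupp p.
  by rewrite mcoeff_msupp; apply: contraNneq H => ->; rewrite mul0rn.
by rewrite /= mdegD mdeg1 addn1 => <-.
Qed.

Lemma homog0_mderiv p i : p \is homog 0 -> mderiv i p = 0.
Proof.
move=> hp; apply/mpolyP => m; rewrite mcoeff_mderiv mcoeff0.
by rewrite (dhomog_nemf_coeff hp) ?mul0rn //= mdegD mdeg1 addn1.
Qed.

Lemma homog0_restr p x y : p \is homog 0 -> poly_restr p x = poly_restr p y.
Proof.
move=> /dhomogP hp; suff -> : p = mpolyC d.+1 (mcoeff mnm0 p) by rewrite !poly_restrC.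
apply/mpolyP => m; rewrite mcoeffC; have [<-|m0] := eqVneq mnm0 m; first by rewrite mulr1.
rewrite mulr0; apply/eqP; apply: contraNT m0; rewrite -mcoeff_msupp => /hp /eqP.
by rewrite mdeg_eq0 eq_sym.
Qed.

Lemma homog_var i : var i \is homog 1.
Proof. by rewrite dhomogX /= mdeg1. Qed.

Lemma laplacianD p q : laplacian (p + q) = laplacian p + laplacian q.
Proof. by rewrite /laplacian -big_split; apply: eq_bigr => i _; rewrite !mderivD. Qed.

Lemma laplacianB p q : laplacian (p - q) = laplacian p - laplacian q.
Proof. by rewrite /laplacian -sumrB; apply: eq_bigr => i _; rewrite !mderivB. Qed.

Lemma laplacianZ c p : laplacian (c *: p) = c *: laplacian p.
Proof. by rewrite /laplacian scaler_sumr; apply: eq_bigr => i _; rewrite !mderivZ. Qed.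

Lemma laplacian0 : laplacian 0 = 0 :> mpoly d.+1 R.
Proof. by rewrite /laplacian big1 // => i _; rewrite !mderiv0. Qed.

Lemma laplacian_mderiv i p : laplacian (mderiv i p) = mderiv i (laplacian p).
Proof.
rewrite /laplacian raddf_sum; apply: eq_bigr => j _ /=.
by rewrite (mderiv_comm i j p) (mderiv_comm i j).
Qed.

Lemma homog_laplacian p k : p \is homog k -> laplacian p \is homog k.-2.
Proof. by move=> hp; apply: rpred_sum => i _; do 2 apply: homog_mderiv. Qed.

Lemma laplacian_low p k : (k < 2)%N -> p \is homog k -> laplacian p = 0.
Proof.
move=> k2 hp; rewrite /laplacian big1 // => i _; apply: homog0_mderiv.
by move: k2 hp; case: k => [|[]] // _ /(homog_mderiv i).
Qed.

Definition rsq : mpoly d.+1 R := \sum_i var i ^+ 2.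

Lemma homog_rsq : rsq \is homog 2.
Proof. by apply: rpred_sum => i _; rewrite expr2 (@dhomogM _ _ _ 1 _ 1) ?homog_var. Qed.

Lemma rsq_restr x : poly_restr rsq x = 1.
Proof.
rewrite -(sphere_valP x) poly_restr_sum; apply: eq_bigr => i _.
by rewrite poly_restrXn poly_restrX.
Qed.

Lemma mderiv_rsq i : mderiv i rsq = 2 *: var i.
Proof.
rewrite raddf_sum (bigD1 i) //= big1 ?addr0 => [|j ji].
  by rewrite expr2 mderivM mderiv_var eqxx mpolyC1 mulr1 mul1r -mulr2n scaler_nat.
by rewrite expr2 mderivM mderiv_var (negbTE ji) mpolyC0 mulr0 mul0r addr0.
Qed.

Lemma laplacian_rsq p k : p \is homog k ->
  laplacian (rsq * p) = rsq * laplacian p + (4 * k + 2 * d.+1)%:R *: p.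
Proof.
move=> hp; rewrite /laplacian.
have E i : mderiv i (mderiv i (rsq * p)) =
    rsq * mderiv i (mderiv i p) + (4 *: (var i * mderiv i p) + 2 *: p).
  rewrite !(mderivM, mderivD) mderiv_rsq mderivZ mderiv_var eqxx mpolyC1.
  rewrite (_ : 4 = 2 + 2 :> R); last by rewrite -natrD.
  rewrite -!mul_mpolyC mpolyCD; ring.
under eq_bigr do rewrite E.
rewrite !big_split /= -mulr_sumr -scaler_sumr (euler_homog hp) sumr_const card_ord.
by rewrite scalerA -[X in _ + (_ + X)]scaler_nat scalerA -scalerDl natrD !natrM [d.+1%:R * _]mulrC.
Qed.

(* On homogeneous polynomials, [rsq * laplacian + b] is triangular for the
   filtration by powers of [rsq]. *)
Lemma laplacian_solve m (b : R) p : 0 < b -> p \is homog m ->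
  exists2 q, q \is homog m & rsq * laplacian q + b *: q = p.
Proof.
elim/ltn_ind: m b p => m IH b p b0 hp.
case: (ltnP m 2) => m2.
  exists (b^-1 *: p); first by rewrite rpredZ.
  by rewrite laplacianZ (laplacian_low m2 hp) scaler0 mulr0 add0r scalerA divff ?gt_eqF // scale1r.
have m2' : (m - 2 < m)%N by rewrite ltn_subrL //= (leq_trans _ m2).
have hL : - (b^-1 *: laplacian p) \is homog (m - 2)%N.
  by rewrite rpredN rpredZ // subn2 homog_laplacian.
have [|v hv Hv] := IH (m - 2)%N m2' (b + (4 * (m - 2) + 2 * d.+1)%:R) _ _ hL.
  by rewrite ltr_pwDl.
have hrv : rsq * v \is homog m by rewrite -(subnKC m2); apply: dhomogM => //; exact: homog_rsq.
exists (b^-1 *: p + rsq * v); first by rewrite rpredD // rpredZ.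
rewrite laplacianD laplacianZ (laplacian_rsq hv) scalerDr scalerA divff ?gt_eqF // scale1r.
have -> : rsq * (b^-1 *: laplacian p + (rsq * laplacian v + (4 * (m - 2) + 2 * d.+1)%:R *: v)) + (p + b *: (rsq * v)) =
   p + rsq * (b^-1 *: laplacian p + (rsq * laplacian v + (b + (4 * (m - 2) + 2 * d.+1)%:R) *: v)).
  rewrite scalerDl [b *: v + _]addrC !mulrDr -!addrA -scalerAr [RHS]addrC -!addrA.
  by do 3 congr (_ + _); rewrite [LHS]addrC scalerAr.
by rewrite Hv subrr mulr0 addr0.
Qed.

(** The Fischer decomposition. By [laplacian_rsq], requiring [laplacian (rsq * q) = laplacian p] is
    the equation of [laplacian_solve] with [b = 4 * k + 2 * d.+1]. *)
Lemma harmonic_split k p : p \is homog k.+2 ->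
  exists h q, [/\ h \is homog k.+2, laplacian h = 0, q \is homog k & p = h + rsq * q].
Proof.
move=> hp; have hL : laplacian p \is homog k by exact: homog_laplacian hp.
have [|q hq Hq] := @laplacian_solve k (4 * k + 2 * d.+1)%:R _ _ hL.
  by rewrite ltr0n addn_gt0 orbC.
exists (p - rsq * q), q; split => //; last by rewrite subrK.
  by rewrite rpredB // -add2n; apply: dhomogM => //; exact: homog_rsq.
by rewrite laplacianB (laplacian_rsq hq) Hq subrr.
Qed.

(** The form [y |-> dotp x y] as a polynomial, which brings powers of [t] into the homogeneous
    calculus. *)
Definition linp x : mpoly d.+1 R := \sum_i sphere_val x ord0 i *: var i.

Lemma linp_restr x y : poly_restr (linp x) y = dotp x y.
Proof.
by rewrite poly_restr_sum; apply: eq_bigr => i _; rewrite poly_restrZ poly_restrX.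
Qed.

Lemma homog_linp x : linp x \is homog 1.
Proof. by apply: rpred_sum => i _; rewrite rpredZ // homog_var. Qed.

Lemma homog_linpX x k : linp x ^+ k \is homog k.
Proof. by have := dhomogMn k (homog_linp x); rewrite mul1n. Qed.

Lemma mderiv_linpX x i k :
  mderiv i (linp x ^+ k.+1) = (k.+1%:R * sphere_val x ord0 i) *: linp x ^+ k.
Proof.
have E : mderiv i (linp x) = mpolyC d.+1 (sphere_val x ord0 i).
  rewrite raddf_sum (bigD1 i) //= big1 ?addr0 => [|j ji].
    by rewrite mderivZ mderiv_var eqxx mpolyC1 -mul_mpolyC mulr1.
  by rewrite mderivZ mderiv_var (negbTE ji) mpolyC0 scaler0.
elim: k => [|k IH]; first by rewrite expr1 expr0 E mul1r -mul_mpolyC mulr1.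
rewrite exprS mderivM E IH -scalerAr -exprS mul_mpolyC -scalerDl; congr (_ *: _).
by rewrite -[in RHS]natr1; ring.
Qed.

(** * Integrals against harmonics and the Funk-Hecke formula *)

Section harmonic_integrals.
Variable sigma : probability (borel_sphere R d) R.
Hypothesis rot_inv : rotation_invariant sigma.
Hypothesis d_gt0 : (0 < d)%N.

Local Notation "'int' p" := (\int[sigma]_x poly_restr p x) (at level 10, p at level 8).

Lemma int_polyD p q : int (p + q) = int p + int q.
Proof.
rewrite (int_ext _ (poly_restrD p q)) intD //; exact: poly_restr_continuous.
Qed.
Lemma int_polyZ c p : int (c *: p) = c * int p.
Proof. rewrite (int_ext _ (poly_restrZ c p)) intZ //; exact: poly_restr_continuous. Qed.
Lemma int_poly0 : int 0 = 0.
Proof. by rewrite (int_ext _ (@poly_restr0 R d)) int_cst. Qed.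
Lemma int_poly_sum (I : Type) (r : seq I) (P : pred I) (F : I -> mpoly d.+1 R) :
  int (\sum_(i <- r | P i) F i) = \sum_(i <- r | P i) int (F i).
Proof.
rewrite (int_ext _ (poly_restr_sum r P F)) int_sum // => i; exact: poly_restr_continuous.
Qed.

(** Green's formula for homogeneous polynomials: apply [int_mderiv] to [F * mderiv i P] and sum over
    [i]. Euler's identity gives the left-hand side, and harmonicity removes the Laplacian term. *)
Lemma int_harmonic F P k l : F \is homog k -> P \is homog l.+1 -> laplacian P = 0 ->
  (k + l + d)%:R * (l.+1%:R * int (F * P)) = \sum_i int (mderiv i F * mderiv i P).
Proof.
move=> hF hP LP.
rewrite -int_polyZ scalerAr -(euler_homog hP) mulr_sumr int_poly_sum mulr_sumr.
have E i : (k + l + d)%:R * int (F * (var i * mderiv i P)) =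
    int (mderiv i F * mderiv i P) + int (F * mderiv i (mderiv i P)).
  rewrite mulrCA -int_polyD -mderivM.
  by rewrite -(@int_mderiv _ _ _ rot_inv _ (k + l)%N) //; exact: dhomogM hF (homog_mderiv i hP).
rewrite (eq_bigr _ (fun i _ => E i)) big_split /= -[X in _ + X]int_poly_sum -mulr_sumr.
by rewrite -/(laplacian P) LP mulr0 int_poly0 addr0.
Qed.

(** Each use of [int_harmonic] differentiates both factors, and the one of lower degree is exhausted
    first. *)
Lemma int_homog_harmonic F P k l : (k < l)%N -> F \is homog k -> P \is homog l ->
  laplacian P = 0 -> int (F * P) = 0.
Proof.
elim: k l F P => [|k IH] [|l] // F P kl hF hP LP; have := int_harmonic hF hP LP.
  rewrite big1 => [|i _]; last by rewrite homog0_mderiv // mul0r int_poly0.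
  by move=> /eqP; rewrite !mulf_eq0 !pnatr_eq0 /= add0n addn_eq0 -[d == 0]negbK -lt0n d_gt0 andbF /= => /eqP.
rewrite big1 => [|i _]; last first.
  apply: (IH l _ _ _ (homog_mderiv i hF) (homog_mderiv i hP)) => //.
  by rewrite laplacian_mderiv LP mderiv0.
by move=> /eqP; rewrite !mulf_eq0 !pnatr_eq0 /= => /eqP.
Qed.

Lemma int_linpX x k : int (linp x ^+ k) = zonal_moment R d k.
Proof.
have rec j : (j + d)%:R * int (linp x ^+ j.+1) =
    \sum_i sphere_val x ord0 i * int (mderiv i (linp x ^+ j)).
  rewrite exprS {2}/linp mulr_suml int_poly_sum mulr_sumr; apply: eq_bigr => i _.
  rewrite -scalerAl int_polyZ (@int_mderiv _ _ _ rot_inv _ j) ?homog_linpX //; ring.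
elim/ltn_ind: k => -[|[|k]] IH.
- by rewrite expr0 -mpolyC1 (int_ext _ (poly_restrC _)) int_cst.
- have := rec 0%N; rewrite big1 => [/eqP|i _]; last first.
    by rewrite expr0 -mpolyC1 mderivC int_poly0 mulr0.
  by rewrite mulf_eq0 pnatr_eq0 add0n -[d == 0]negbK -lt0n d_gt0 => /eqP ->.
- rewrite zonal_momentSS -IH //; have := rec k.+1.
  under eq_bigr do rewrite mderiv_linpX int_polyZ mulrA mulrCA -expr2.
  rewrite -mulr_suml -mulr_sumr sphere_valP mulr1 => H.
  by rewrite mulrAC -H mulrC mulKf // pnatr_eq0.
Qed.

(** [int_harmonic] differentiates both factors. Differentiating [linp x ^ k] brings out the
    coordinates of [x], so Euler's identity reassembles the derivatives of [P] at [x]. *)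
Lemma int_linpX_harmonic x k l P : P \is homog l -> laplacian P = 0 ->
  int (linp x ^+ k * P) = zonal_mult R d k l * poly_restr P x.
Proof.
elim: l k P => [|l IH] k P hP LP.
  rewrite /= -(int_linpX x) [RHS]mulrC -intZ; last exact: poly_restr_continuous.
  by apply: int_ext => y; rewrite poly_restrM mulrC (homog0_restr y x hP).
case: k => [|k].
  by rewrite /= !mul0r (@int_homog_harmonic _ _ 0 l.+1) ?homog_linpX // mul0r.
have := int_harmonic (homog_linpX x k.+1) hP LP.
under eq_bigr => i _.
  rewrite mderiv_linpX -scalerAl int_polyZ.
  rewrite (IH k _ (homog_mderiv i hP)); last by rewrite laplacian_mderiv LP mderiv0.
  over.
have -> : \sum_i k.+1%:R * sphere_val x ord0 i * (zonal_mult R d k l * poly_restr (mderiv i P) x)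
   = k.+1%:R * zonal_mult R d k l * (l.+1%:R * poly_restr P x).
  rewrite -poly_restrZ -(euler_homog hP) poly_restr_sum mulr_sumr; apply: eq_bigr => i _.
  rewrite poly_restrM poly_restrX; ring.
move=> H; rewrite [zonal_mult _ _ _ _]/=.
have l0 : l.+1%:R != 0 :> R by rewrite pnatr_eq0.
have kl0 : (k.+1 + l + d)%:R != 0 :> R by rewrite pnatr_eq0.
by apply: (mulfI l0); apply: (mulfI kl0); rewrite [LHS]H; field.
Qed.

Definition zonal_eigen (g : {poly R}) (l : nat) : R :=
  \sum_(i < size g) g`_i * zonal_mult R d i l.

Lemma horner_dotp_continuous (g : {poly R}) x : continuous (fun y => g.[dotp x y]).
Proof.
apply: (@continuous_ext _ _ _ (fun y => \sum_(i < size g) g`_i * dotp x y ^+ i)).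
  by move=> y; rewrite horner_coef.
by cont.
Qed.

Lemma funk_hecke (g : {poly R}) x l (Y : sphere R d -> R) : harmonics l Y ->
  \int[sigma]_y (g.[dotp x y] * Y y) = zonal_eigen g l * Y x.
Proof.
move=> [P [hP LP ->]].
rewrite /zonal_eigen mulr_suml.
transitivity (\sum_(i < size g) \int[sigma]_y poly_restr (g`_i *: (linp x ^+ i * P)) y); last first.
  by apply: eq_bigr => i _; rewrite int_polyZ (int_linpX_harmonic x i hP LP) mulrA.
rewrite -int_poly_sum; apply: int_ext => y.
rewrite horner_coef mulr_suml poly_restr_sum; apply: eq_bigr => i _.
by rewrite poly_restrZ poly_restrM poly_restrXn linp_restr mulrA.
Qed.

Lemma int_horner_dotp (g : {poly R}) x :
  \int[sigma]_y g.[dotp x y] = zonal_eigen g 0.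
Proof.
have h1 : @harmonics R d 0 (fun=> 1).
  exists 1; split; first exact: dhomog1.
    by rewrite /laplacian big1 // => i _; rewrite -mpolyC1 !mderivC.
  by apply/funext => y; rewrite -mpolyC1 poly_restrC.
by rewrite -[RHS]mulr1 -(funk_hecke g x h1); apply: int_ext => y; rewrite mulr1.
Qed.

Lemma harmonics_continuous l (Y : sphere R d -> R) : harmonics l Y -> continuous Y.
Proof. by move=> [P [_ _ ->]]; exact: poly_restr_continuous. Qed.

Lemma harmonics_orth l l' (Y Y' : sphere R d -> R) : l != l' ->
  harmonics l Y -> harmonics l' Y' -> inner sigma Y Y' = 0.
Proof.
move=> ll [P [hP LP ->]] [P' [hP' LP' ->]].
have E : inner sigma (poly_restr P) (poly_restr P') = int (P * P').
  by apply: int_ext => y; rewrite poly_restrM.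
rewrite E; case: (ltngtP l l') ll => // lt _.
  exact: (@int_homog_harmonic _ _ l l').
by rewrite mulrC; exact: (@int_homog_harmonic _ _ l' l).
Qed.

End harmonic_integrals.

Lemma harmonicsD l (f g : sphere R d -> R) : harmonics l f -> harmonics l g ->
  harmonics l (fun x => f x + g x).
Proof.
move=> [p [hp Lp ->]] [q [hq Lq ->]]; exists (p + q); split; first exact: rpredD.
  by rewrite laplacianD Lp Lq addr0.
by apply/funext => x; rewrite poly_restrD.
Qed.

Lemma harmonics0 l : @harmonics R d l (fun=> 0).
Proof.
exists 0; split; [exact: rpred0|exact: laplacian0|].
by apply/funext => x; rewrite poly_restr0.
Qed.

Definition harmonic_sum (M : nat) (f : sphere R d -> R) : Prop :=
  exists2 h : nat -> sphere R d -> R, forall l, harmonics l (h l) &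
    forall x, f x = \sum_(l < M) h l x.

Lemma harmonic_sumD M f g : harmonic_sum M f -> harmonic_sum M g ->
  harmonic_sum M (fun x => f x + g x).
Proof.
move=> [h Hh fE] [k Hk gE]; exists (fun l x => h l x + k l x).
  by move=> l; exact: harmonicsD.
by move=> x; rewrite fE gE big_split.
Qed.

Lemma harmonic_sum_single M l f : (l < M)%N -> harmonics l f -> harmonic_sum M f.
Proof.
move=> lM hf; exists (fun j => if j == l then f else fun=> 0).
  by move=> j; case: eqP => [->|_] //; exact: harmonics0.
move=> x; rewrite (bigD1 (Ordinal lM)) //= eqxx big1 ?addr0 // => j jl.
by case: eqP => // E; case/eqP: jl; exact: val_inj.
Qed.

(** Since [rsq] is 1 on the sphere, the remainder of [harmonic_split] restricts like a homogeneous
    polynomial of degree two less. *)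
Lemma harmonic_sum_homog M k p : (k < M)%N -> p \is homog k ->
  harmonic_sum M (poly_restr p).
Proof.
elim/ltn_ind: k p => k IH p kM hp.
case: (ltnP k 2) => k2.
  apply: (harmonic_sum_single kM); exists p; split=> //.
  exact: laplacian_low hp.
case: k k2 IH kM hp => [|[|k]] // _ IH kM hp.
have [h [q [hh Lh hq ->]]] := harmonic_split hp.
have -> : poly_restr (h + rsq * q) = (fun x => poly_restr h x + poly_restr q x).
  by apply/funext => x; rewrite poly_restrD poly_restrM rsq_restr mul1r.
apply: harmonic_sumD.
  by apply: (harmonic_sum_single kM); exists h.
by apply: (IH k) => //; apply: leq_trans kM; rewrite ltnS leqW.
Qed.

Lemma Pi_space_harmonic_sum n f : @Pi_space R d n f -> harmonic_sum n.+1 f.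
Proof.
move=> [p hp ->]; rewrite (pihomog_partitionE hp).
have -> : poly_restr (\sum_(k < n.+1) pihomog (@mdeg d.+1) k p) =
  (fun x => \sum_(k < n.+1) poly_restr (pihomog (@mdeg d.+1) k p) x).
  by apply/funext => x; rewrite poly_restr_sum.
have H (k : 'I_n.+1) : harmonic_sum n.+1 (poly_restr (pihomog (@mdeg d.+1) k p)).
  exact: harmonic_sum_homog (ltn_ord k) (pihomogP _ _ _).
elim: (index_enum _) => [|k r IH].
  exists (fun _ _ => 0) => [l|x]; first exact: harmonics0.
  by rewrite big_nil big1.
have -> : (fun x => \sum_(j <- k :: r) poly_restr (pihomog (@mdeg d.+1) j p) x) =
   (fun x => poly_restr (pihomog (@mdeg d.+1) k p) x +
      \sum_(j <- r) poly_restr (pihomog (@mdeg d.+1) j p) x).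
  by apply/funext => x; rewrite big_cons.
exact: harmonic_sumD.
Qed.

End homogeneous.

(** * The spaces of spherical polynomials *)

Section Pi_space_theory.
Variables (R : realType) (d : nat).
Implicit Types (f g : sphere R d -> R).

Lemma Pi_space_continuous n f : Pi_space n f -> continuous f.
Proof. by move=> [p _ ->]; exact: poly_restr_continuous. Qed.

Lemma Pi_spaceD n f g : Pi_space n f -> Pi_space n g -> Pi_space n (fun x => f x + g x).
Proof.
move=> [p hp ->] [q hq ->]; exists (p + q).
  by apply: leq_trans (mmeasureD_le _ _ _) _; rewrite geq_max hp hq.
by apply/funext => x; rewrite poly_restrD.
Qed.

Lemma Pi_spaceZ n c f : Pi_space n f -> Pi_space n (fun x => c * f x).
Proof.
move=> [p hp ->]; exists (c *: p); first exact: leq_trans (mmeasureZ_le _ _ _) hp.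
by apply/funext => x; rewrite poly_restrZ.
Qed.

Lemma Pi_space0 n : Pi_space n (fun _ : sphere R d => 0).
Proof. by exists 0; [rewrite mmeasure0|apply/funext => x; rewrite poly_restr0]. Qed.

Lemma Pi_spaceB n f g : Pi_space n f -> Pi_space n g -> Pi_space n (fun x => f x - g x).
Proof.
move=> hf hg; have := Pi_spaceD hf (Pi_spaceZ (-1) hg).
by congr Pi_space; apply/funext => x; rewrite mulN1r.
Qed.

Lemma Pi_space_sum n (I : Type) (r : seq I) (P : pred I) (F : I -> sphere R d -> R) :
  (forall i, P i -> Pi_space n (F i)) ->
  Pi_space n (fun x => \sum_(i <- r | P i) F i x).
Proof.
move=> hF; elim: r => [|i r IH].
  by have := Pi_space0 n; congr Pi_space; apply/funext => x; rewrite big_nil.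
case: (boolP (P i)) => Pi.
  have := Pi_spaceD (hF i Pi) IH.
  by congr Pi_space; apply/funext => x; rewrite big_cons Pi.
by move: IH; congr Pi_space; apply/funext => x; rewrite big_cons (negbTE Pi).
Qed.

Lemma Pi_space_homog n k (p : mpoly d.+1 R) : (k <= n)%N ->
  p \is ishomog1 k (@mdeg d.+1) -> Pi_space n (poly_restr p).
Proof.
move=> kn /dhomogP hp; exists p => //; rewrite mmeasureE.
by apply/bigmax_leqP_seq => m mp _; rewrite hp.
Qed.

Lemma harmonics_Pi_space n l f : (l <= n)%N -> harmonics l f -> Pi_space n f.
Proof. by move=> ln [p [hp _ ->]]; exact: Pi_space_homog ln hp. Qed.

Lemma Pi_space_horner n (g : {poly R}) x : (size g <= n.+1)%N ->
  Pi_space n (fun y : sphere R d => g.[dotp x y]).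
Proof.
move=> sg.
have := @Pi_space_sum n _ (index_enum 'I_(size g)) xpredT
  (fun i y => g`_i * poly_restr (linp x ^+ i) y) _.
case=> [i _|].
  apply: Pi_spaceZ; apply: (Pi_space_homog _ (homog_linpX x i)).
  by rewrite -ltnS; apply: leq_trans sg.
move=> p hp /esym E; exists p => //; rewrite E; apply/funext => y.
by rewrite horner_coef; apply: eq_bigr => i _; rewrite poly_restrXn linp_restr.
Qed.

End Pi_space_theory.

(** * Expansions in spherical harmonics *)

Section harmonic_basis.
Variables (R : realType) (d : nat) (sigma : probability (borel_sphere R d) R).
Variables (N : nat -> nat) (Y : forall l, 'I_(N l) -> sphere R d -> R).
Hypothesis d_gt0 : (0 < d)%N.
Hypothesis rot_inv : rotation_invariant sigma.
Hypothesis onb : harmonic_orthonormal_basis sigma Y.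
Implicit Types (a b : forall l, 'I_(N l) -> R) (f g : sphere R d -> R).

Lemma onb_harmonics l k : harmonics l (@Y l k).
Proof. by have [H _ _] := onb l. Qed.

Lemma onb_continuous l k : continuous (@Y l k).
Proof. exact: harmonics_continuous (onb_harmonics k). Qed.

Lemma onb_inner l k : inner sigma (@Y l k) (@Y l k) = 1.
Proof. by have [_ H _] := onb l; rewrite H eqxx. Qed.

Lemma innerC f g : inner sigma f g = inner sigma g f.
Proof. by apply: int_ext => x; rewrite mulrC. Qed.

Lemma inner_sumr (I : Type) (r : seq I) (P : pred I) f (F : I -> sphere R d -> R) :
  continuous f -> (forall i, continuous (F i)) ->
  inner sigma f (fun x => \sum_(i <- r | P i) F i x) = \sum_(i <- r | P i) inner sigma f (F i).
Proof.
move=> cf cF; rewrite /inner -int_sum => [|i]; last by have := cF i => cFi; cont.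
by apply: int_ext => x; rewrite mulr_sumr.
Qed.

Lemma innerZr f g c : continuous f -> continuous g ->
  inner sigma f (fun x => c * g x) = c * inner sigma f g.
Proof.
move=> cf cg; rewrite /inner -intZ; last by cont.
by apply: int_ext => x; rewrite mulrCA.
Qed.

(** Coefficients are given in all degrees and cut at [M], so that one family can be truncated at
    several places. *)
Definition hsum (M : nat) a (x : sphere R d) : R :=
  \sum_(l < M) \sum_(k < N l) a l k * @Y l k x.

Definition energy a l : R := \sum_(k < N l) a l k ^+ 2.

Lemma energy_ge0 a l : 0 <= energy a l.
Proof. by apply: sumr_ge0 => k _; exact: sqr_ge0. Qed.

Lemma hsum_continuous M a : continuous (hsum M a).
Proof.
apply: continuous_sum => l; apply: continuous_sum => k.
have := @onb_continuous l k => cY; cont.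
Qed.

Lemma inner_hsum f M a : continuous f ->
  inner sigma f (hsum M a) = \sum_(l < M) \sum_(k < N l) a l k * inner sigma f (@Y l k).
Proof.
move=> cf; rewrite inner_sumr // => [|l]; last first.
  by apply: continuous_sum => k; have := @onb_continuous l k => cY; cont.
apply: eq_bigr => l _; rewrite inner_sumr // => [|k]; last first.
  by have := @onb_continuous l k => cY; cont.
by apply: eq_bigr => k _; rewrite innerZr //; exact: onb_continuous.
Qed.

Lemma inner_hsum_Y M a (l : 'I_M) (k : 'I_(N l)) : inner sigma (hsum M a) (@Y l k) = a l k.
Proof.
rewrite innerC inner_hsum; last exact: onb_continuous.
rewrite (bigD1 l) //= [X in _ + X]big1 => [|l' ll]; last first.
  rewrite big1 // => k' _.
  rewrite (harmonics_orth rot_inv d_gt0 _ (onb_harmonics k) (onb_harmonics k')) ?mulr0 //.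
  by rewrite eq_sym.
rewrite addr0 (bigD1 k) //= big1 => [|k' kk]; last first.
  by have [_ -> _] := onb l; rewrite eq_sym (negbTE kk) mulr0.
by rewrite onb_inner mulr1 addr0.
Qed.

Lemma inner_hsum_hsum M a b :
  inner sigma (hsum M a) (hsum M b) = \sum_(l < M) \sum_(k < N l) a l k * b l k.
Proof.
rewrite inner_hsum; last exact: hsum_continuous.
by apply: eq_bigr => l _; apply: eq_bigr => k _; rewrite inner_hsum_Y mulrC.
Qed.

Lemma hsum_energy M a : inner sigma (hsum M a) (hsum M a) = \sum_(l < M) energy a l.
Proof.
rewrite inner_hsum_hsum; apply: eq_bigr => l _; apply: eq_bigr => k _.
by rewrite expr2.
Qed.

Lemma hsum_Pi_space n M a : (M <= n.+1)%N -> Pi_space n (hsum M a).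
Proof.
move=> Mn; apply: Pi_space_sum => l _; apply: Pi_space_sum => k _.
apply: Pi_spaceZ; apply: harmonics_Pi_space (onb_harmonics k).
by rewrite -ltnS (leq_trans (ltn_ord l)).
Qed.

Lemma Pi_space_hsum n f : Pi_space n f -> exists a, f = hsum n.+1 a.
Proof.
move=> /Pi_space_harmonic_sum[h hh fE].
have H l : exists a : 'I_(N l) -> R, h l = fun x => \sum_k a k * @Y l k x.
  by have [_ _] := onb l; apply.
exists (fun l => projT1 (cid (H l))); apply/funext => x; rewrite fE.
by apply: eq_bigr => l _; rewrite [in LHS](projT2 (cid (H l))).
Qed.

Lemma hsum_zonal (g : {poly R}) M a x :
  \int[sigma]_y (g.[dotp x y] * hsum M a y) =
  hsum M (fun l k => zonal_eigen d g l * a l k) x.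
Proof.
rewrite -[LHS]/(inner sigma (fun y => g.[dotp x y]) (hsum M a)) inner_hsum; last first.
  exact: horner_dotp_continuous.
apply: eq_bigr => l _; apply: eq_bigr => k _.
rewrite /inner (funk_hecke rot_inv d_gt0 g x (onb_harmonics k)); ring.
Qed.

Lemma norm2_ge0 f : 0 <= norm2 sigma f.
Proof. exact: sqrtr_ge0. Qed.

Lemma norm2_sqr f : norm2 sigma f ^+ 2 = inner sigma f f.
Proof. by rewrite sqr_sqrtr // int_ge0 // => x; rewrite -expr2 sqr_ge0. Qed.

End harmonic_basis.

(** * Transfer of the upper bound to higher degrees *)

Section peak_integrals.
Variables (R : realType) (d : nat) (sigma : probability (borel_sphere R d) R).
Hypothesis d_gt0 : (0 < d)%N.
Hypothesis rot_inv : rotation_invariant sigma.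
Implicit Types x y : sphere R d.

Lemma zonal_eigenXn k l : zonal_eigen d ('X^k : {poly R}) l = zonal_mult R d k l.
Proof.
rewrite /zonal_eigen size_polyXn big_ord_recr /= coefXn eqxx mul1r big1 ?add0r //.
by move=> i _; rewrite coefXn ltn_eqF ?mul0r.
Qed.

Lemma int_dotpX x k : \int[sigma]_y (dotp x y ^+ k) = zonal_moment R d k.
Proof.
rewrite -[RHS]/(zonal_mult R d k 0) -zonal_eigenXn -(int_horner_dotp rot_inv d_gt0 _ x).
by apply: int_ext => y; rewrite hornerXn.
Qed.

Lemma dotp_exp_double_ge0 x y K : 0 <= dotp x y ^+ K.*2.
Proof. by rewrite -mul2n exprM exprn_ge0 // sqr_ge0. Qed.

(** Expanding one factor of the power replaces [J] by [J + K]. Of the [d - e] factors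
    [(J + K + 1) ^ (- 1 / 2)], one is bounded by [(K + 1) ^ (- 1 / 2)] and summed over [K], the
    others by [(J + 1) ^ (- 1 / 2)]. *)
Lemma int_geometric_le (M J e : nat) x : (e <= d)%N ->
  \int[sigma]_y (dotp x y ^+ J.*2 * (\sum_(K < M) dotp x y ^+ K.*2) ^+ e) <=
  Num.sqrt d`!%:R * (Num.sqrt J.+1%:R)^-1 ^+ (d - e) * (2 * Num.sqrt M%:R) ^+ e.
Proof.
elim: e J => [|e IH] J ed.
  rewrite subn0 expr0 mulr1.
  apply: le_trans (zonal_moment_double_le_pow R d J); rewrite -(int_dotpX x).
  by rewrite le_eqVlt; apply/orP; left; apply/eqP; apply: int_ext => y; rewrite expr0 mulr1.
have cS : continuous (fun y => \sum_(K < M) dotp x y ^+ K.*2) by cont.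
have -> : \int[sigma]_y (dotp x y ^+ J.*2 * (\sum_(K < M) dotp x y ^+ K.*2) ^+ e.+1) =
  \sum_(K < M) \int[sigma]_y (dotp x y ^+ (J + K).*2 * (\sum_(K < M) dotp x y ^+ K.*2) ^+ e).
  rewrite -int_sum => [|K]; last by cont.
  apply: int_ext => y; rewrite exprS mulrCA mulr_suml; apply: eq_bigr => K _.
  by rewrite doubleD exprD; ring.
set C := Num.sqrt d`!%:R; set D := 2 * _.
have C0 : 0 <= C by exact: sqrtr_ge0.
have D0 : 0 <= D by rewrite mulr_ge0 // sqrtr_ge0.
apply: (@le_trans _ _ (\sum_(K < M) (C * (Num.sqrt J.+1%:R)^-1 ^+ (d - e.+1) * D ^+ e) * (Num.sqrt K.+1%:R)^-1)).
  apply: ler_sum => K _; apply: le_trans (IH (J + K)%N (ltnW ed)) _.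
  rewrite -/C -/D [leRHS]mulrAC ler_wpM2r ?exprn_ge0 // -[leRHS]mulrA ler_wpM2l //.
  have -> : (d - e)%N = (d - e.+1).+1 by rewrite subnSK.
  rewrite exprSr; apply: ler_pM; rewrite ?exprn_ge0 ?invr_ge0 ?sqrtr_ge0 //.
    rewrite lerXn2r ?nnegrE ?invr_ge0 ?sqrtr_ge0 //.
    by rewrite lef_pV2 ?posrE ?sqrtr_gt0 ?ltr0n // ler_wsqrtr // ler_nat ltnS leq_addr.
  by rewrite lef_pV2 ?posrE ?sqrtr_gt0 ?ltr0n // ler_wsqrtr // ler_nat ltnS leq_addl.
rewrite -mulr_sumr exprSr mulrA ler_wpM2l ?mulr_ge0 ?exprn_ge0 ?invr_ge0 ?sqrtr_ge0 //.
exact: sum_inv_sqrt_le.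
Qed.

Lemma int_peak_le (N : nat) x : (0 < N)%N ->
  \int[sigma]_y ((peak R d N).[dotp x y] ^+ 2) <= Num.sqrt d`!%:R * (4 / N%:R) ^+ d.
Proof.
move=> N0; have Npos : 0 < N%:R :> R by rewrite ltr0n.
have cp := @horner_dotp_continuous R d (peak R d N) x.
have H := int_geometric_le (N ^ 2) 0 x (leqnn d).
apply: (@le_trans _ _ (\int[sigma]_y ((2 / (N ^ 2)%:R) ^+ d *
   (dotp x y ^+ 0.*2 * (\sum_(K < N ^ 2) dotp x y ^+ K.*2) ^+ d)))).
  apply: int_le => [||y]; try by cont.
  rewrite mul1r -exprMn; exact: peak_le_geometric N0 (dotp_itv x y).
rewrite intZ; last by cont.
apply: le_trans (ler_wpM2l _ H) _; first by rewrite exprn_ge0 // divr_ge0.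
rewrite subnn expr0 mulr1 mulrCA ler_wpM2l ?sqrtr_ge0 // -exprMn.
rewrite natrX sqrtr_sqr ger0_norm ?(ltW Npos) //.
have -> : 2 / N%:R ^+ 2 * (2 * N%:R) = 4 / N%:R :> R by field; rewrite gt_eqF.
by [].
Qed.

Section multiplier_bound.
Variables (N m K : nat).
Hypotheses (N0 : (0 < N)%N) (m0 : (0 < m)%N).
Hypothesis Km : (m + 2 * (m * (m + d)) <= K.*2)%N.
Hypothesis KN : (8 * d ^ 2 * N ^ 2 <= K.*2)%N.

Let q := peak R d N.
Definition peak_power : {poly R} := q ^+ 2 * 'X^(K.*2).
Local Notation g := peak_power.
Let mom : R := zonal_moment R d K.*2.

Lemma peak_powerE t : g.[t] = q.[t] ^+ 2 * t ^+ K.*2.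
Proof. by rewrite /g hornerM horner_exp hornerXn. Qed.

Lemma peak_power_ge0 x y : 0 <= g.[dotp x y].
Proof. by rewrite peak_powerE mulr_ge0 ?sqr_ge0 // dotp_exp_double_ge0. Qed.

Lemma peak_power_le_dotp x y : g.[dotp x y] <= dotp x y ^+ K.*2.
Proof.
rewrite peak_powerE ler_piMl ?dotp_exp_double_ge0 //.
exact: peak_le1 N0 (dotp_itv x y).
Qed.

Lemma peak_power_le_peak x y : g.[dotp x y] <= q.[dotp x y] ^+ 2.
Proof.
rewrite peak_powerE ler_piMr ?sqr_ge0 // -mul2n exprM exprn_ile1 ?sqr_ge0 //.
by case/andP: (dotp_itv x y) => ? ?; nra.
Qed.

Lemma int_peak_power_le x : \int[sigma]_y g.[dotp x y] <= mom.
Proof.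
rewrite /mom -(int_dotpX x); apply: int_le; [exact: horner_dotp_continuous|by cont|].
exact: peak_power_le_dotp.
Qed.

(** [peak_near1] loses [D * (1 - t ^ 2)], whose mean under [t ^ 2K] is [D * d / (2K + 1 + d)]; [KN]
    makes this at most [1 / 4]. *)
Lemma int_peak_power_ge x : 3 / 4 * mom <= \int[sigma]_y g.[dotp x y].
Proof.
have mom0 : 0 < mom by exact: zonal_moment_double_gt0.
set D : R := (2 * d)%:R * N%:R ^+ 2.
apply: (@le_trans _ _ (\int[sigma]_y (dotp x y ^+ K.*2 - D * (dotp x y ^+ K.*2 - dotp x y ^+ K.*2.+2)))); last first.
  apply: int_le => [||y]; [by cont|exact: horner_dotp_continuous|].
  rewrite peak_powerE; have := peak_near1 d N0 (dotp_itv x y).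
  rewrite -/q -/D => H; have := ler_wpM2r (dotp_exp_double_ge0 x y K) H.
  apply: le_trans; rewrite le_eqVlt; apply/orP; left; apply/eqP.
  rewrite -addn2 exprD; ring.
rewrite intB ?intZ ?intB ?int_dotpX; try by cont.
rewrite zonal_momentSS -/mom.
have k0 : 0 < (K.*2.+1 + d)%:R :> R by rewrite ltr0n.
have -> : mom - D * (mom - K.*2.+1%:R / (K.*2.+1 + d)%:R * mom) =
  mom - D * d%:R / (K.*2.+1 + d)%:R * mom.
  rewrite -{2}[mom]mul1r -mulrBl mulrA; congr (_ - _ * _); rewrite -mulrA; congr (_ * _).
  apply: (mulIf (lt0r_neq0 k0)); rewrite mulrBl !divfK ?gt_eqF // natrD; ring.
suff : D * d%:R / (K.*2.+1 + d)%:R <= 1 / 4 by nra.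
rewrite ler_pdivrMr // mulrC mulrA mul1r -(ler_pM2r (_ : 0 < 4)) // mulrAC [X in _ <= X]mulrAC mulVf // mul1r.
rewrite /D -natrX -!natrM ler_nat.
apply: leq_trans (leq_trans KN _); last by rewrite addSn -addnS leq_addr.
rewrite leq_mul2r; apply/orP; right.
by rewrite -mulnn (mulnC d) -!mulnA [(d * (d * 4))%N]mulnA [(d * d * 4)%N]mulnC !mulnA.
Qed.

(** At a maximum [x0] of [|Z|] the multipliers are integrals of the kernels against a function
    [h <= 1]. As [g <= t ^ 2K], comparing [g * (1 - h)] with [t ^ 2K * (1 - h)] leaves at least the
    fraction [3 / 4 - 1 + 1 / 2] of [mom]. *)
Lemma peak_power_eigen_ge l (Z : sphere R d -> R) : (l <= m)%N ->
  harmonics l Z -> (exists y, Z y != 0) ->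
  mom / 4 <= zonal_eigen d ('X^(odd l) * g) l.
Proof.
move=> lm hZ [y0 Zy0].
have cZ := harmonics_continuous hZ.
have [x0 Hx0] := sphere_continuous_max cZ.
have Zx0 : Z x0 != 0.
  by rewrite -normr_gt0; apply: lt_le_trans (Hx0 y0); rewrite normr_gt0.
have Z1 y : `|dotp x0 y ^+ odd l * (Z y / Z x0)| <= 1.
  rewrite normrM -[leRHS]mulr1; apply: ler_pM => //.
    rewrite normrX exprn_ile1 // ler_norml; exact: dotp_itv.
  by rewrite normf_div ler_pdivrMr ?normr_gt0 // mul1r.
have cg := @horner_dotp_continuous R d g x0.
have E1 : zonal_eigen d ('X^(odd l) * g) l =
    \int[sigma]_y (g.[dotp x0 y] * (dotp x0 y ^+ odd l * (Z y / Z x0))).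
  apply: (mulIf Zx0); rewrite -(funk_hecke rot_inv d_gt0 _ x0 hZ).
  rewrite [RHS]mulrC -intZ; last by cont.
  by apply: int_ext => y; rewrite hornerM hornerXn; field.
have E2 : zonal_mult R d (odd l + K.*2) l =
    \int[sigma]_y (dotp x0 y ^+ K.*2 * (dotp x0 y ^+ odd l * (Z y / Z x0))).
  rewrite -zonal_eigenXn; apply: (mulIf Zx0); rewrite -(funk_hecke rot_inv d_gt0 _ x0 hZ).
  rewrite [RHS]mulrC -intZ; last by cont.
  by apply: int_ext => y; rewrite hornerXn exprD; field.
have H1 := zonal_mult_half R m0 lm Km.
have H2 := int_peak_power_ge x0.
have : \int[sigma]_y (g.[dotp x0 y] * (1 - dotp x0 y ^+ odd l * (Z y / Z x0))) <=
       \int[sigma]_y (dotp x0 y ^+ K.*2 * (1 - dotp x0 y ^+ odd l * (Z y / Z x0))).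
  apply: int_le => [||y]; try by cont.
  rewrite ler_wpM2r ?peak_power_le_dotp // subr_ge0.
  exact: le_trans (ler_norm _) (Z1 y).
have F (h : sphere R d -> R) : continuous h ->
   \int[sigma]_y (h y * (1 - dotp x0 y ^+ odd l * (Z y / Z x0))) =
   \int[sigma]_y h y - \int[sigma]_y (h y * (dotp x0 y ^+ odd l * (Z y / Z x0))).
  by move=> ch; rewrite -intB; [apply: int_ext => y; ring|by cont|by cont].
rewrite !F; [|by cont|by cont].
rewrite -E1 -E2 int_dotpX -/mom; rewrite -/mom in H1.
lra.
Qed.

End multiplier_bound.
End peak_integrals.

(** [K] is large enough for both conditions of [peak_power_eigen_ge], yet small enough to keep the
    moment of order [2K] at least of order [m ^ - d]. *)
Lemma transfer_scale (d m p : nat) : (0 < d)%N -> (0 < m)%N -> (p <= 2 * m)%N ->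
  let K := (16 * d ^ 2 * m ^ 2)%N in
  [/\ (8 * d ^ 2 * p ^ 2 <= K.*2)%N, (m + 2 * (m * (m + d)) <= K.*2)%N
    & (K.*2 + d <= (6 * d * m) ^ 2)%N].
Proof.
move=> d0 m0 pm.
have h0 : (d ^ 2 * p ^ 2 <= d ^ 2 * (2 * m) ^ 2)%N by rewrite leq_mul2l leq_exp2r // pm orbT.
have d2 : (0 < d ^ 2)%N by rewrite expn_gt0 d0.
have m2 : (0 < m ^ 2)%N by rewrite expn_gt0 m0.
have h1 : (m <= d ^ 2 * m ^ 2)%N.
  by apply: leq_trans (leq_pmull _ d2); rewrite -mulnn leq_pmull.
have h2 : (m * m <= d ^ 2 * m ^ 2)%N by rewrite mulnn leq_pmull.
have h3 : (m * d <= d ^ 2 * m ^ 2)%N.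
  by rewrite mulnC leq_mul // -mulnn leq_pmulr.
have h4 : (d <= d ^ 2 * m ^ 2)%N.
  by apply: leq_trans (leq_pmulr _ m2); rewrite -mulnn leq_pmulr.
rewrite !expnMn in h0 *; rewrite mulnDr /=.
move: h0 h1 h2 h3 h4 d2 m2; move: (d ^ 2)%N (m ^ 2)%N (p ^ 2)%N (m * m)%N (m * d)%N => u v w a b.
by rewrite (_ : 6 ^ 2 = 36)%N // (_ : 2 ^ 2 = 4)%N // => h0 h1 h2 h3 h4 _ _; split; lia.
Qed.

(** * Sampled sums of polynomials of degree above [n] *)

Section level_transfer.
Variables (R : realType) (d : nat) (sigma : probability (borel_sphere R d) R).
Variables (N : nat -> nat) (Y : forall l, 'I_(N l) -> sphere R d -> R).
Hypothesis d_gt0 : (0 < d)%N.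
Hypothesis rot_inv : rotation_invariant sigma.
Hypothesis onb : harmonic_orthonormal_basis sigma Y.

Variables (n r : nat) (x : 'I_r -> sphere R d) (tau : 'I_r -> R) (B : R).
Hypothesis n_gt0 : (0 < n)%N.
Hypothesis tau_ge0 : forall k, 0 <= tau k.
Hypothesis upper : forall p, Pi_space n p ->
  \sum_(k < r) `|p (x k)| ^+ 2 * tau k <= B * norm2 sigma p ^+ 2.

Lemma onb_neq0 l k : exists y, @Y l k y != 0.
Proof.
apply: contrapT => /forallNP H.
have E : inner sigma (@Y l k) (@Y l k) = 0.
  transitivity (\int[sigma]_y (0 : R)); last by rewrite int_cst.
  apply: int_ext => y; have /negP := H y.
  by rewrite negbK => /eqP ->; rewrite mulr0.
by have := onb_inner onb k; rewrite E => /eqP; rewrite eq_sym oner_eq0.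
Qed.

Lemma upper_ge0 : 0 <= B.
Proof.
have sz : (size (1%R : {poly R}) <= n.+1)%N by rewrite size_poly1.
have := upper (@Pi_space_horner R d n 1 point sz); rewrite norm2_sqr.
have -> : inner sigma (fun y => 1.[dotp point y]) (fun y => 1.[dotp point y]) = 1.
  by rewrite /inner (int_ext _ (g := fun=> 1)) ?int_cst // => y; rewrite hornerC mulr1.
rewrite mulr1; apply: le_trans; apply: sumr_ge0 => k _.
by rewrite mulr_ge0 ?exprn_ge0.
Qed.

Section parity.
Variables (m Np K : nat) (e : bool).
Hypotheses (Np_gt0 : (0 < Np)%N) (m_gt0 : (0 < m)%N).
Hypothesis Km : (m + 2 * (m * (m + d)) <= K.*2)%N.
Hypothesis KN : (8 * d ^ 2 * Np ^ 2 <= K.*2)%N.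
Hypothesis Npn : (d * Np.-1 <= n)%N.
Variable a : forall l, 'I_(N l) -> R.
Hypothesis a_parity : forall l k, odd l != e -> @a l k = 0.

Let g := peak_power R d Np K.
Let mom : R := zonal_moment R d K.*2.
Let S : R := Num.sqrt d`!%:R * (4 / Np%:R) ^+ d.
Let lam l : R := zonal_eigen d ('X^e * g) l.
Let b : forall l, 'I_(N l) -> R := fun l k => (lam l)^-1 * @a l k.

(** The coefficients [b] undo the multipliers and cost at most [(4 / mom) ^ 2] in energy.
    Cauchy-Schwarz costs one factor [mom]. The sum of [tau k * g] over the samples is at most
    [B * S], by the upper bound for the peak centred at the integration variable [y]. *)
Lemma parity_transfer :
  \sum_(k < r) hsum Y m.+1 a (x k) ^+ 2 * tau k <=
  16 * (B * S) / mom * \sum_(l < m.+1) energy a l.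
Proof.
have mom0 : 0 < mom by exact: zonal_moment_double_gt0.
have B0 := upper_ge0.
have lam_ge (l : 'I_m.+1) (k : 'I_(N l)) : odd l == e -> mom / 4 <= lam l.
  move=> /eqP le; rewrite /lam -le.
  apply: (peak_power_eigen_ge d_gt0 rot_inv Np_gt0 m_gt0 Km KN _ (onb_harmonics onb k)).
    by rewrite -ltnS.
  exact: onb_neq0.
have cb := @hsum_continuous _ _ _ _ _ onb m.+1 b.
have cg z := @horner_dotp_continuous R d g z.
have cq z := @horner_dotp_continuous R d (peak R d Np) z.
have aE z : hsum Y m.+1 a z = \int[sigma]_y (g.[dotp z y] * (dotp z y ^+ e * hsum Y m.+1 b y)).
  transitivity (\int[sigma]_y (('X^e * g).[dotp z y] * hsum Y m.+1 b y)); last first.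
    by apply: int_ext => y; rewrite hornerM hornerXn; ring.
  rewrite (hsum_zonal d_gt0 rot_inv onb) /hsum; apply: eq_bigr => l _; apply: eq_bigr => k _.
  congr (_ * _); rewrite -/(lam l) /b mulrA.
  (* In the other parity [lam l] has no lower bound, but the coefficient of [a] is zero. *)
  have [le|le] := boolP (odd l == e); last by rewrite a_parity ?mulr0.
  rewrite divff ?mul1r // gt_eqF //; apply: lt_le_trans (lam_ge l k le).
  by rewrite divr_gt0.
have bE : \sum_(l < m.+1) energy b l <= 16 / mom ^+ 2 * \sum_(l < m.+1) energy a l.
  rewrite mulr_sumr; apply: ler_sum => l _; rewrite /energy mulr_sumr; apply: ler_sum => k _.
  rewrite /b; have [le|le] := boolP (odd l == e); last first.
    by rewrite a_parity // mulr0 expr0n mulr0.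
  rewrite exprMn ler_wpM2r ?sqr_ge0 //.
  have H := lam_ge l k le.
  have -> : 16 / mom ^+ 2 = ((mom / 4)^-1) ^+ 2 by field; rewrite gt_eqF.
  rewrite lerXn2r ?nnegrE ?invr_ge0 ?divr_ge0 ?(ltW mom0) //.
    by apply: le_trans H; rewrite divr_ge0 // ltW.
  rewrite lef_pV2 ?posrE ?divr_gt0 //; apply: lt_le_trans H; by rewrite divr_gt0.
have sq z : hsum Y m.+1 a z ^+ 2 <= mom * \int[sigma]_y (g.[dotp z y] * hsum Y m.+1 b y ^+ 2).
  have cgz := cg z.
  rewrite aE; apply: le_trans (int_cauchy_schwarz sigma _ _ _ _) _; try by cont.
    by move=> y; exact: peak_power_ge0.
  apply: ler_wpM2r.
    by apply: int_ge0 => y; rewrite mulr_ge0 ?sqr_ge0 // peak_power_ge0.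
  apply: le_trans (int_peak_power_le d_gt0 rot_inv K Np_gt0 z).
  apply: int_le => [||y]; try by cont.
  rewrite ler_piMr ?peak_power_ge0 // exprAC exprn_ile1 ?sqr_ge0 //.
  by case/andP: (dotp_itv z y) => ? ?; nra.
have ker y : \sum_(k < r) tau k * g.[dotp (x k) y] <= B * S.
  apply: (@le_trans _ _ (\sum_(k < r) `|(peak R d Np).[dotp y (x k)]| ^+ 2 * tau k)).
    apply: ler_sum => k _; rewrite mulrC ler_wpM2r // real_normK ?num_real // dotpC.
    by apply: peak_power_le_peak.
  apply: le_trans (upper (Pi_space_horner _ _)) _.
    by apply: leq_trans (size_peak R d Np_gt0) _; rewrite ltnS.
  rewrite norm2_sqr ler_wpM2l //; apply: le_trans (int_peak_le d_gt0 rot_inv y Np_gt0).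
  by rewrite le_eqVlt; apply/orP; left; apply/eqP; apply: int_ext => z; rewrite expr2.
apply: (@le_trans _ _ (mom * \int[sigma]_y ((\sum_(k < r) tau k * g.[dotp (x k) y]) * hsum Y m.+1 b y ^+ 2))).
  have -> : \int[sigma]_y ((\sum_(k < r) tau k * g.[dotp (x k) y]) * hsum Y m.+1 b y ^+ 2) =
    \sum_(k < r) tau k * \int[sigma]_y (g.[dotp (x k) y] * hsum Y m.+1 b y ^+ 2).
    transitivity (\int[sigma]_y (\sum_(k < r) tau k * (g.[dotp (x k) y] * hsum Y m.+1 b y ^+ 2))).
      by apply: int_ext => y; rewrite mulr_suml; apply: eq_bigr => k _; rewrite -mulrA.
    rewrite int_sum => [|k]; last by have := cg (x k) => cgk; cont.
    by apply: eq_bigr => k _; have := cg (x k) => cgk; rewrite intZ //; cont.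
  rewrite mulr_sumr; apply: ler_sum => k _.
  by rewrite [leRHS]mulrCA [leLHS]mulrC ler_wpM2l.
apply: (@le_trans _ _ (mom * (B * S * (16 / mom ^+ 2 * \sum_(l < m.+1) energy a l)))).
  rewrite ler_pM2l //.
  have S0 : 0 <= S by rewrite mulr_ge0 ?sqrtr_ge0 // exprn_ge0 // divr_ge0.
  apply: le_trans (ler_wpM2l (mulr_ge0 B0 S0) bE).
  rewrite -(hsum_energy d_gt0 rot_inv onb) /inner -intZ; last by cont.
  apply: int_le => [||y]; [|by cont|by rewrite expr2 ler_wpM2r // -expr2 sqr_ge0].
  apply: continuous_mul; last by cont.
  by apply: continuous_sum => k; have := cg (x k) => cgk; cont.
rewrite le_eqVlt; apply/orP; left; apply/eqP; field; by rewrite gt_eqF.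
Qed.

End parity.

(** [24 * d ^ 2] is [4 * d] from the peak, where [n < d * Np], times [6 * d] from
    [2K + d <= (6 * d * m) ^ 2]; [32] is the [16] of [parity_transfer] times the [2] lost in
    splitting parities. *)
Definition transfer_const : R :=
  32 * (Num.sqrt d`!%:R * Num.sqrt d.+1%:R * (24 * d%:R ^+ 2) ^+ d).

Lemma transfer_const_gt0 : 0 < transfer_const.
Proof.
rewrite /transfer_const !mulr_gt0 ?sqrtr_gt0 ?ltr0n ?fact_gt0 //.
by rewrite exprn_gt0 // mulr_gt0 // exprn_gt0 // ltr0n.
Qed.

Lemma level_transfer (m : nat) (a : forall l, 'I_(N l) -> R) : (n <= m)%N ->
  \sum_(k < r) hsum Y m.+1 a (x k) ^+ 2 * tau k <=
  transfer_const * B * (m%:R / n%:R) ^+ d * \sum_(l < m.+1) energy a l.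
Proof.
move=> nm; have m_gt0 : (0 < m)%N by apply: leq_trans nm.
have B0 := upper_ge0.
(* The largest [Np] with [d * (Np - 1) <= n], which keeps the peak in [Pi_space n]. *)
pose Np := (n %/ d).+1; pose K := (16 * d ^ 2 * m ^ 2)%N.
have Np2m : (Np <= 2 * m)%N.
  rewrite mul2n -addnn /Np -addn1 leq_add //.
  exact: leq_trans (leq_div _ _) nm.
have [KN Km Kd] := transfer_scale d_gt0 m_gt0 Np2m.
have Npn : (d * Np.-1 <= n)%N by rewrite /= mulnC leq_trunc_div.
pose ae (e : bool) : forall l, 'I_(N l) -> R := fun l k => if odd l == e then @a l k else 0.
have par e : \sum_(k < r) hsum Y m.+1 (ae e) (x k) ^+ 2 * tau k <=
    16 * (B * (Num.sqrt d`!%:R * (4 / Np%:R) ^+ d)) / zonal_moment R d K.*2 *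
     \sum_(l < m.+1) energy (ae e) l.
  apply: (@parity_transfer m Np K e) => // l k le.
  by rewrite /ae (negbTE le).
have aD z : hsum Y m.+1 a z = hsum Y m.+1 (ae false) z + hsum Y m.+1 (ae true) z.
  rewrite /hsum -big_split; apply: eq_bigr => l _ /=; rewrite -big_split; apply: eq_bigr => k _ /=.
  by rewrite -mulrDl /ae; case: (odd l); rewrite /= ?addr0 ?add0r.
have eD : \sum_(l < m.+1) energy a l =
    \sum_(l < m.+1) energy (ae false) l + \sum_(l < m.+1) energy (ae true) l.
  rewrite -big_split; apply: eq_bigr => l _ /=; rewrite /energy -big_split; apply: eq_bigr => k _ /=.
  by rewrite /ae; case: (odd l); rewrite /= expr0n ?addr0 ?add0r.
set W := 16 * _ / _ in par.
apply: (@le_trans _ _ (2 * (W * \sum_(l < m.+1) energy a l))).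
  apply: (@le_trans _ _ (2 * (\sum_(k < r) hsum Y m.+1 (ae false) (x k) ^+ 2 * tau k
     + \sum_(k < r) hsum Y m.+1 (ae true) (x k) ^+ 2 * tau k))); last first.
    by rewrite ler_pM2l // eD mulrDr lerD.
  rewrite -big_split /= mulr_sumr; apply: ler_sum => k _.
  rewrite -mulrDl mulrA ler_wpM2r // aD.
  have := sqr_ge0 (hsum Y m.+1 (ae false) (x k) - hsum Y m.+1 (ae true) (x k)); nra.
rewrite mulrA ler_wpM2r ?sumr_ge0 // => [l _|]; first exact: energy_ge0.
have mom0 : 0 < zonal_moment R d K.*2 by exact: zonal_moment_double_gt0.
have npos : 0 < n%:R :> R by rewrite ltr0n.
have dpos : 0 < d%:R :> R by rewrite ltr0n.
have h4 : (4 / Np%:R) ^+ d <= (4 * d%:R / n%:R) ^+ d :> R.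
  rewrite lerXn2r ?nnegrE ?divr_ge0 ?mulr_ge0 //.
  rewrite ler_pdivrMr ?ltr0n // mulrAC ler_pdivlMr // -!mulrA ler_wpM2l // -natrM ler_nat.
  by rewrite mulnC ltnW // ltn_ceil.
have hm : (zonal_moment R d K.*2)^-1 <= Num.sqrt d.+1%:R * (6 * d%:R * m%:R) ^+ d.
  rewrite -[leLHS]mul1r ler_pdivrMr //.
  have K0 : (0 < K)%N by rewrite !muln_gt0 d_gt0 m_gt0.
  have H := zonal_moment_double_ge_pow R d K0.
  rewrite -(@ler_pXn2r _ 2) ?nnegrE ?mulr_ge0 ?exprn_ge0 ?sqrtr_ge0 ?(ltW mom0) ?mulr_ge0 //.
  rewrite expr1n; apply: (le_trans H); rewrite mulrC exprMn ler_wpM2r ?sqr_ge0 //.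
  rewrite exprMn sqr_sqrtr // ler_wpM2l // exprAC lerXn2r ?nnegrE ?sqr_ge0 //.
  by rewrite -!natrM -natrX ler_nat.
rewrite /W /transfer_const.
apply: (@le_trans _ _ (2 * (16 * (B * (Num.sqrt d`!%:R * (4 * d%:R / n%:R) ^+ d)) *
    (Num.sqrt d.+1%:R * (6 * d%:R * m%:R) ^+ d)))).
  rewrite ler_pM2l //; apply: ler_pM; rewrite ?invr_ge0 ?(ltW mom0) //.
    by rewrite !mulr_ge0 ?sqrtr_ge0 ?exprn_ge0 ?divr_ge0.
  by rewrite ler_pM2l // ler_wpM2l // ler_wpM2l ?sqrtr_ge0.
have -> : (24 * d%:R ^+ 2) ^+ d = (4 * d%:R) ^+ d * (6 * d%:R) ^+ d :> R.
  by rewrite -exprMn; congr (_ ^+ _); ring.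
rewrite !exprMn !exprVn; set u := n%:R ^+ d; lra.
Qed.

End level_transfer.

(** * Approximation by zonal convolution *)

Section smoothing.
Variables (R : realType) (d : nat) (sigma : probability (borel_sphere R d) R).
Variables (N : nat -> nat) (Y : forall l, 'I_(N l) -> sphere R d -> R).
Hypothesis d_gt0 : (0 < d)%N.
Hypothesis rot_inv : rotation_invariant sigma.
Hypothesis onb : harmonic_orthonormal_basis sigma Y.
Implicit Types (f h : sphere R d -> R) (x y : sphere R d).

Definition zonal_conv k f x : R := \int[sigma]_y (dotp x y ^+ k * f y).

Lemma coord_mul_continuous f i : continuous f ->
  continuous (fun y => sphere_val y ord0 i * f y).
Proof. by move=> cf; apply: continuous_mul => //; exact: sphere_coord_continuous. Qed.

(** Splitting off one factor of the inner product separates [x] from [y]. Iterated, this shows that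
    the convolution is a polynomial in [x] and is symmetric, without a double integral. *)
Lemma zonal_convS k f x : continuous f -> zonal_conv k.+1 f x =
  \sum_i sphere_val x ord0 i * zonal_conv k (fun y => sphere_val y ord0 i * f y) x.
Proof.
move=> cf; rewrite /zonal_conv.
have cif i := @coord_mul_continuous f i cf.
transitivity (\int[sigma]_y (\sum_i sphere_val x ord0 i *
   (dotp x y ^+ k * (sphere_val y ord0 i * f y)))).
  apply: int_ext => y; rewrite exprS {1}/dotp mulr_suml mulr_suml.
  by apply: eq_bigr => i _; ring.
rewrite int_sum => [|i]; last by have := cif i => c; cont.
by apply: eq_bigr => i _; rewrite intZ //; have := cif i => c; cont.
Qed.

Lemma zonal_conv0 f x : zonal_conv 0 f x = \int[sigma]_y f y.
Proof. by apply: int_ext => y; rewrite expr0 mul1r. Qed.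

Lemma Pi_space_coordM k f i : Pi_space k f ->
  Pi_space k.+1 (fun x => sphere_val x ord0 i * f x).
Proof.
move=> [p hp ->]; exists (mpolyX R (mnm1 i) * p); last first.
  by apply/funext => x; rewrite poly_restrM poly_restrX.
have [->|p0] := eqVneq p 0; first by rewrite mulr0 mmeasure0.
rewrite msizeM // ?msizeX ?mdeg1 //.
by rewrite -(msize_poly_eq0 (mpolyX R (mnm1 i))) msizeX mdeg1.
Qed.

Lemma zonal_conv_Pi_space k f : continuous f -> Pi_space k (zonal_conv k f).
Proof.
elim: k f => [|k IH] f cf.
  have -> : zonal_conv 0 f = (fun x => \int[sigma]_y f y * (1 : {poly R}).[dotp point x]).
    by apply/funext => x; rewrite zonal_conv0 hornerC mulr1.
  by apply: Pi_spaceZ; apply: Pi_space_horner; rewrite size_poly1.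
have -> : zonal_conv k.+1 f = (fun x => \sum_i sphere_val x ord0 i *
    zonal_conv k (fun y => sphere_val y ord0 i * f y) x).
  by apply/funext => x; rewrite zonal_convS.
apply: Pi_space_sum => i _; apply: Pi_space_coordM; apply: IH.
exact: coord_mul_continuous.
Qed.

Lemma zonal_conv_continuous k f : continuous f -> continuous (zonal_conv k f).
Proof. by move=> cf; exact: Pi_space_continuous (zonal_conv_Pi_space k cf). Qed.

Lemma zonal_conv_sym k f h : continuous f -> continuous h ->
  inner sigma (zonal_conv k f) h = inner sigma f (zonal_conv k h).
Proof.
elim: k f h => [|k IH] f h cf ch.
  have E (u v : sphere R d -> R) : continuous v ->
      inner sigma (zonal_conv 0 u) v = \int[sigma]_y u y * \int[sigma]_y v y.
    by move=> cv; rewrite -intZ; [apply: int_ext => x; rewrite zonal_conv0|exact: cv].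
  by rewrite E // innerC E // mulrC.
have cif i := @coord_mul_continuous f i cf; have cih i := @coord_mul_continuous h i ch.
transitivity (\sum_i inner sigma (zonal_conv k (fun y => sphere_val y ord0 i * f y))
     (fun y => sphere_val y ord0 i * h y)).
  rewrite /inner -int_sum => [|i]; last first.
    by have := @zonal_conv_continuous k _ (cif i) => c1; have := cih i => c2; cont.
  apply: int_ext => x; rewrite zonal_convS // mulr_suml; apply: eq_bigr => i _; ring.
transitivity (\sum_i inner sigma (fun y => sphere_val y ord0 i * f y)
   (zonal_conv k (fun y => sphere_val y ord0 i * h y))).
  by apply: eq_bigr => i _; rewrite IH.
rewrite /inner -int_sum => [|i]; last first.
  by have := @zonal_conv_continuous k _ (cih i) => c1; have := cif i => c2; cont.
apply: int_ext => x; rewrite zonal_convS // mulr_sumr; apply: eq_bigr => i _; ring.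
Qed.

Lemma zonal_conv_harmonic k l f x : harmonics l f ->
  zonal_conv k f x = zonal_mult R d k l * f x.
Proof.
move=> hf; rewrite -zonal_eigenXn -(funk_hecke rot_inv d_gt0 _ x hf).
by apply: int_ext => y; rewrite hornerXn.
Qed.

Lemma kernel_ge0 x y K : 0 <= dotp x y ^+ K.*2 + dotp x y ^+ K.*2.+1.
Proof.
have -> : dotp x y ^+ K.*2 + dotp x y ^+ K.*2.+1 = (1 + dotp x y) * dotp x y ^+ K.*2.
  by rewrite exprS; ring.
apply: mulr_ge0; last exact: dotp_exp_double_ge0.
by have /andP[] := dotp_itv x y; lra.
Qed.

(** The kernel [t ^ 2K * (1 + t)] is nonnegative, so at a maximum of [|f|] its multiplier is at most
    its integral. Convolution with the normalised kernel therefore never enlarges a coefficient. *)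
Lemma zonal_mult_add_le K l f : harmonics l f -> (exists y, f y != 0) ->
  zonal_mult R d K.*2 l + zonal_mult R d K.*2.+1 l <= zonal_moment R d K.*2.
Proof.
move=> hf [y0 fy0]; have cf := harmonics_continuous hf.
have [x0 Hx0] := sphere_continuous_max cf.
have f0 : 0 < `|f x0| by apply: lt_le_trans (Hx0 y0); rewrite normr_gt0.
rewrite -(ler_pM2r f0); apply: le_trans (ler_norm _) _.
rewrite normrM normr_id -normrM mulrDl -!zonal_conv_harmonic //.
rewrite -intD; [|by cont|by cont].
apply: le_trans (int_norm_le _ _) _; first by cont.
have -> : zonal_moment R d K.*2 = zonal_moment R d K.*2 + zonal_moment R d K.*2.+1.
  by rewrite zonal_moment_odd addr0.
rewrite -!(int_dotpX d_gt0 rot_inv x0) -intD; [|by cont|by cont].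
rewrite mulrC -intZ; last by cont.
apply: int_le => [||y]; [by cont|by cont|].
have := dotp_itv x0 y => /andP[t1 t2].
have t0 := kernel_ge0 x0 y K.
rewrite -mulrDl normrM (ger0_norm t0) mulrC ler_wpM2r //.
Qed.

(* Convolve [f] with the normalised zonal kernel [t ^ 2K * (1 + t)]: it is
   nonnegative and the mean of [1 - t] under it is [d / (2K + 1 + d)]. *)
Lemma smoothing f (e : R) : continuous f -> 0 < e ->
  exists M (b : forall l, 'I_(N l) -> R),
    (forall l k, `|@b l k| <= `|inner sigma f (@Y l k)|) /\
    forall x, `|f x - hsum Y M b x| <= e.
Proof.
move=> cf e0.
have [C0 HC0] := sphere_uniform_continuity cf (divr_gt0 e0 (ltr0n R 2 : 0 < 2)).
pose C := Num.max C0 0.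
have C_ge0 : 0 <= C by rewrite le_max lexx orbT.
have HC x y : `|f x - f y| <= e / 2 + C * (1 - dotp x y).
  apply: le_trans (HC0 x y) _; rewrite lerD2l ler_wpM2r ?le_max ?lexx //.
  by rewrite subr_ge0; case/andP: (dotp_itv x y).
have [K HK] : exists K : nat, C * (d%:R / (K.*2.+1 + d)%:R) <= e / 2.
  pose K := Num.bound (2 * C * d%:R / e); exists K.
  have h : 2 * C * d%:R / e < K%:R.
    apply: archi_boundP.
    by rewrite divr_ge0 ?mulr_ge0 // ltW.
  rewrite mulrA ler_pdivrMr ?ltr0n //; move: h; rewrite ltr_pdivrMr // => h.
  have : K%:R <= (K.*2.+1 + d)%:R :> R 
    by rewrite ler_nat (leq_trans _ (leq_addr _ _)) // -addnn leqW // leq_addr.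
  nra.
pose mom := zonal_moment R d K.*2.
have mom0 : 0 < mom by exact: zonal_moment_double_gt0.
pose q x := mom^-1 * (zonal_conv K.*2 f x + zonal_conv K.*2.+1 f x).
have hq : Pi_space K.*2.+1 q.
  apply: Pi_spaceZ; apply: Pi_spaceD; last exact: zonal_conv_Pi_space.
  have [p hp ->] := zonal_conv_Pi_space K.*2 cf; exists p => //; exact: leq_trans hp _.
have [b qE] := Pi_space_hsum onb hq.
(* Only coefficients of degree below [K.*2.+2] are determined by [q]; the truncation makes the bound
   hold in every degree. *)
exists K.*2.+2, (fun l k => if (l < K.*2.+2)%N then @b l k else 0); split.
  move=> l k; case: ifPn => lK; last by rewrite normr0.
  have cY := @onb_continuous _ _ _ _ _ onb l k.
  have -> : @b l k = inner sigma q (@Y l k).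
    by rewrite qE (inner_hsum_Y d_gt0 rot_inv onb b (l := Ordinal lK)).
  have c1 := @zonal_conv_continuous K.*2 _ cf; have c2 := @zonal_conv_continuous K.*2.+1 _ cf.
  have -> : inner sigma q (@Y l k) = mom^-1 *
     (zonal_mult R d K.*2 l + zonal_mult R d K.*2.+1 l) * inner sigma f (@Y l k).
    transitivity (mom^-1 * (inner sigma (zonal_conv K.*2 f) (@Y l k) + inner sigma (zonal_conv K.*2.+1 f) (@Y l k))).
      rewrite /inner -intD -?intZ; [|by cont|by cont|by cont].
      by apply: int_ext => x; rewrite /q; ring.
    have E j : inner sigma (zonal_conv j f) (@Y l k) = zonal_mult R d j l * inner sigma f (@Y l k).
      rewrite zonal_conv_sym // -innerZr //; apply: int_ext => x.
      by rewrite (zonal_conv_harmonic _ _ (onb_harmonics onb k)).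
    by rewrite !E; ring.
  have z0 : 0 <= zonal_mult R d K.*2 l + zonal_mult R d K.*2.+1 l.
    by rewrite addr_ge0 ?zonal_mult_ge0.
  rewrite normrM ger0_norm ?mulr_ge0 ?invr_ge0 ?(ltW mom0) // ler_piMl //.
  rewrite mulrC ler_pdivrMr // mul1r.
  exact: zonal_mult_add_le (onb_harmonics onb k) (onb_neq0 onb k).
move=> x.
have -> : hsum Y K.*2.+2 (fun l k => if (l < K.*2.+2)%N then @b l k else 0) x = q x.
  by rewrite qE /hsum; apply: eq_bigr => l _; rewrite ltn_ord.
have fE : f x = mom^-1 * \int[sigma]_y ((dotp x y ^+ K.*2 + dotp x y ^+ K.*2.+1) * f x).
  under eq_Rintegral do rewrite mulrC.
  rewrite intZ; last by cont.
  rewrite intD; [|by cont|by cont].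
  by rewrite !(int_dotpX d_gt0 rot_inv) zonal_moment_odd addr0 mulrCA mulVf ?mulr1 // gt_eqF.
have -> : f x - q x = mom^-1 * \int[sigma]_y ((dotp x y ^+ K.*2 + dotp x y ^+ K.*2.+1) * (f x - f y)).
  rewrite {1}fE /q -mulrBr /zonal_conv -intD; [|by cont|by cont].
  rewrite -intB; [|by cont|by cont].
  by congr (_ * _); apply: int_ext => y; ring.
rewrite normrM ger0_norm ?invr_ge0 ?(ltW mom0) // mulrC ler_pdivrMr //.
apply: le_trans (int_norm_le _ _) _; first by cont.
apply: (@le_trans _ _ (\int[sigma]_y ((e / 2) * (dotp x y ^+ K.*2 + dotp x y ^+ K.*2.+1)
     + C * (dotp x y ^+ K.*2 - dotp x y ^+ K.*2.+2)))).
  apply: int_le => [||y]; [by cont|by cont|].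
  have := dotp_itv x y => /andP[t1 t2].
  have t0 := kernel_ge0 x y K.
  rewrite normrM (ger0_norm t0).
  have -> : e / 2 * (dotp x y ^+ K.*2 + dotp x y ^+ K.*2.+1) + C * (dotp x y ^+ K.*2 - dotp x y ^+ K.*2.+2)
     = (dotp x y ^+ K.*2 + dotp x y ^+ K.*2.+1) * (e / 2 + C * (1 - dotp x y)).
    by rewrite !exprS; ring.
  by rewrite ler_wpM2l.
rewrite intD; [|by cont|by cont].
rewrite !intZ; [|by cont|by cont].
rewrite intB; [|by cont|by cont].
rewrite intD; [|by cont|by cont].
rewrite !(int_dotpX d_gt0 rot_inv) zonal_moment_odd addr0 zonal_momentSS -/mom.
have k0 : 0 < (K.*2.+1 + d)%:R :> R by rewrite ltr0n.
have -> : mom - K.*2.+1%:R / (K.*2.+1 + d)%:R * mom = d%:R / (K.*2.+1 + d)%:R * mom.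
  rewrite -{1}[mom]mul1r -mulrBl; congr (_ * _).
  by apply: (mulIf (lt0r_neq0 k0)); rewrite mulrBl !divfK ?gt_eqF // natrD; ring.
rewrite mulrA -mulrDl ler_wpM2r ?(ltW mom0) //; lra.
Qed.

End smoothing.

(** * Dyadic decomposition *)

Section sobolev_tail.
Variables (R : realType) (d : nat) (s : R).
Hypothesis hs : d%:R / 2 < s.

Definition sobolev_weight (l : nat) : R := (1 + (l * (l + d - 1))%N%:R) `^ s.

(** Doubling the degree multiplies the transfer loss by [2 ^ d] and the lower bound on the Sobolev
    weight by [4 ^ s]. *)
Definition dyadic_ratio : R := 2 ^+ d / 4 `^ s.

Lemma s_gt0 : 0 < s.
Proof. by apply: le_lt_trans hs; rewrite divr_ge0. Qed.

Lemma dyadic_ratio_lt1 : 0 <= dyadic_ratio < 1.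
Proof.
have p4 : 0 < 4 `^ s :> R by rewrite powR_gt0.
apply/andP; split; first by rewrite divr_ge0 ?exprn_ge0 // ltW.
rewrite ltr_pdivrMr // mul1r.
have -> : 2 ^+ d = 4 `^ (d%:R / 2) :> R.
  rewrite (_ : 4 = 2 `^ 2 :> R); last by rewrite powR_mulrn // -natrX.
  by rewrite -powRrM mulrCA divff ?pnatr_eq0 // mulr1 powR_mulrn.
by rewrite /powR pnatr_eq0 /= ltr_expR ltr_pM2r // ln_gt0 // ltr1n.
Qed.

Lemma sobolev_weight_ge0 l : 0 <= sobolev_weight l.
Proof. exact: powR_ge0. Qed.

Lemma sobolev_weight_ge (m l : nat) : (0 < d)%N -> (m <= l)%N ->
  (m%:R ^+ 2) `^ s <= sobolev_weight l.
Proof.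
move=> d0 ml; apply: ge0_ler_powR; rewrite ?nnegrE ?sqr_ge0 ?addr_ge0 //.
  exact: ltW s_gt0.
rewrite -natrX (_ : 1 = 1%:R) // -natrD ler_nat -mulnn.
apply: leq_trans (leq_addl _ _); apply: leq_mul => //.
by rewrite -addnBA // (leq_trans ml) // leq_addr.
Qed.

Variables (sigma : probability (borel_sphere R d) R).
Variables (N : nat -> nat) (Y : forall l, 'I_(N l) -> sphere R d -> R).
Hypothesis d_gt0 : (0 < d)%N.
Hypothesis rot_inv : rotation_invariant sigma.
Hypothesis onb : harmonic_orthonormal_basis sigma Y.

Lemma hsum_widen (M M' : nat) (a : forall l, 'I_(N l) -> R) z : (M <= M')%N ->
  (forall l k, (M <= l)%N -> @a l k = 0) -> hsum Y M' a z = hsum Y M a z.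
Proof.
move=> MM a0; rewrite /hsum.
rewrite -(big_mkord xpredT (fun l => \sum_(k < N l) @a l k * @Y l k z)).
rewrite -(big_mkord xpredT (fun l => \sum_(k < N l) @a l k * @Y l k z)).
rewrite (big_cat_nat _ MM) //= [X in _ + X]big_nat_cond [X in _ + X]big1 ?addr0 //.
move=> l /andP[/andP[Ml _] _]; rewrite big1 // => k _.
by rewrite a0 ?mul0r.
Qed.

Definition high_part (n M : nat) (b : forall l, 'I_(N l) -> R) : forall l, 'I_(N l) -> R :=
  fun l k => if (n < l < M)%N then @b l k else 0.

Lemma high_part_norm (n M : nat) b : (0 < n)%N ->
  inner sigma (hsum Y M (high_part n M b)) (hsum Y M (high_part n M b)) <=
  ((n%:R ^+ 2) `^ s)^-1 * \sum_(l < M) sobolev_weight l * energy b l.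
Proof.
move=> n0; have p0 : 0 < (n%:R ^+ 2) `^ s :> R by rewrite powR_gt0 // exprn_gt0 // ltr0n.
rewrite (hsum_energy d_gt0 rot_inv onb) mulrC ler_pdivlMr // mulr_suml.
apply: ler_sum => l _; rewrite /energy /high_part ltn_ord andbT.
case: ltnP => nl.
  by rewrite mulrC ler_wpM2r ?energy_ge0 // sobolev_weight_ge // ltnW.
rewrite big1 => [|k _]; last by rewrite expr0n.
by rewrite mul0r mulr_ge0 ?sobolev_weight_ge0 ?energy_ge0.
Qed.

(** The factor [2 ^ d] arises because block [j] reaches degree [2 ^ j.+1 * n] while its weight is
    bounded below at [2 ^ j * n]; the denominator comes from [sqr_sum_geometric]. *)
Definition tail_const : R :=
  transfer_const R d * 2 ^+ d / (1 - Num.sqrt dyadic_ratio).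

Lemma tail_const_gt0 : 0 < tail_const.
Proof.
have /andP[r0 r1] := dyadic_ratio_lt1.
apply: divr_gt0; first by rewrite mulr_gt0 ?transfer_const_gt0 ?exprn_gt0.
by rewrite subr_gt0 -[ltRHS]sqrtr1 ltr_sqrt.
Qed.

(** Cauchy-Schwarz with weights [t ^ j]; in the induction step the gap is the square
    [(t * u 0 - (1 - t) * S) ^ 2 / t]. *)
Lemma sqr_sum_geometric (t : R) (J : nat) (u : nat -> R) : 0 < t < 1 ->
  (\sum_(j < J) u j) ^+ 2 <= (1 - t)^-1 * \sum_(j < J) u j ^+ 2 / t ^+ j.
Proof.
move=> /andP[t0 t1]; rewrite mulrC ler_pdivlMr ?subr_gt0 //.
elim: J u => [|J IH] u; first by rewrite !big_ord0 expr0n mul0r.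
rewrite !big_ord_recl /= expr0 divr1.
have := IH (fun j => u j.+1); set S := \sum_(j < J) _; set Q := \sum_(j < J) _.
have -> : \sum_(i < J) u (bump 0 i) ^+ 2 / t ^+ bump 0 i = t^-1 * Q.
  rewrite mulr_sumr; apply: eq_bigr => i _; rewrite -[bump 0 i]/(i.+1) [t ^+ _.+1]exprS invfM; ring.
move=> H.
have tQ : S ^+ 2 * (1 - t) / t <= t^-1 * Q by rewrite [leLHS]mulrC ler_pM2l ?invr_gt0.
apply: le_trans (lerD (lexx _) tQ).
rewrite -subr_ge0.
have -> : u 0 ^+ 2 + S ^+ 2 * (1 - t) / t - (u 0 + S) ^+ 2 * (1 - t) =
   (t * u 0 - (1 - t) * S) ^+ 2 / t by field; rewrite gt_eqF.
by rewrite divr_ge0 ?sqr_ge0 // ltW.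
Qed.

Variables (n r : nat) (x : 'I_r -> sphere R d) (tau : 'I_r -> R) (B : R).
Hypothesis n_gt0 : (0 < n)%N.
Hypothesis tau_ge0 : forall k, 0 <= tau k.
Hypothesis upper : forall p, Pi_space n p ->
  \sum_(k < r) `|p (x k)| ^+ 2 * tau k <= B * norm2 sigma p ^+ 2.

Section dyadic.
Variables (M : nat) (b : forall l, 'I_(N l) -> R).

Let chi (j l : nat) : R := (l <= 2 ^ j * n)%N%:R.
(** A difference of indicators, so that the blocks telescope to the degrees above [n]. *)
Let block (j : nat) : forall l, 'I_(N l) -> R :=
  fun l k => (chi j.+1 l - chi j l) * (if (l < M)%N then @b l k else 0).

Let chi_mono j l : chi j l <= chi j.+1 l.
Proof.
rewrite ler_nat; case: (leqP l (2 ^ j * n)) => // H.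
by rewrite (leq_trans H) // leq_mul2r leq_exp2l // leqnSn orbT.
Qed.

Let chi_sqr j l : (chi j.+1 l - chi j l) ^+ 2 = chi j.+1 l - chi j l.
Proof.
have := chi_mono j l; rewrite /chi; case: (_ <= _)%N; case: (_ <= _)%N => //=.
- by rewrite subrr expr0n.
- by rewrite ler10.
- by rewrite subr0 expr1n.
- by rewrite subrr expr0n.
Qed.

Let chi_tele l : (l < M)%N -> \sum_(j < M) (chi j.+1 l - chi j l) = (n < l)%N%:R.
Proof.
move=> lM; rewrite -(big_mkord xpredT (fun j => chi j.+1 l - chi j l)) telescope_sumr //.
(* [M] blocks suffice since [l < M < 2 ^ M]. *)
rewrite /chi expn0 mul1n (_ : (l <= 2 ^ M * n)%N); last first.
  by rewrite (leq_trans (ltnW lM)) // (leq_trans (ltnW (ltn_expl M (isT : 1 < 2)%N))) // leq_pmulr.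
by rewrite ltnNge; case: (l <= n)%N; rewrite ?subrr ?subr0.
Qed.

Lemma high_part_blocks z :
  hsum Y M (high_part n M b) z = \sum_(j < M) hsum Y M (block j) z.
Proof.
rewrite /hsum exchange_big; apply: eq_bigr => l _ /=; rewrite exchange_big.
apply: eq_bigr => k _ /=; rewrite -mulr_suml; congr (_ * _).
rewrite /block ltn_ord -mulr_suml chi_tele // /high_part ltn_ord andbT.
by case: (n < l)%N; rewrite ?mul1r ?mul0r.
Qed.

Let Hj (j : nat) : R := \sum_(l < M) sobolev_weight l * energy (block j) l.

Let Hj_ge0 j : 0 <= Hj j.
Proof. by apply: sumr_ge0 => l _; rewrite mulr_ge0 ?sobolev_weight_ge0 ?energy_ge0. Qed.

Lemma sum_Hj : \sum_(j < M) Hj j <= \sum_(l < M) sobolev_weight l * energy b l.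
Proof.
rewrite /Hj exchange_big; apply: ler_sum => l _ /=.
rewrite -mulr_sumr ler_wpM2l ?sobolev_weight_ge0 // /energy exchange_big.
apply: ler_sum => k _ /=; rewrite /block ltn_ord.
under eq_bigr do rewrite exprMn chi_sqr.
by rewrite -mulr_suml chi_tele // ler_piMl ?sqr_ge0 //; case: (n < l)%N; rewrite ?ler01.
Qed.

(** [level_transfer] at [m = 2 ^ j.+1 * n] loses [(2 ^ d) ^ j.+1], while on the block the Sobolev
    weight is at least [rho], the [s]-th power of [(2 ^ j * n) ^ 2]. *)
Lemma block_bound (j : nat) :
  \sum_(k < r) hsum Y M (block j) (x k) ^+ 2 * tau k <=
  transfer_const R d * 2 ^+ d * B / (n%:R ^+ 2) `^ s * dyadic_ratio ^+ j * Hj j.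
Proof.
have B0 : 0 <= B := upper_ge0 tau_ge0 upper.
pose m := (2 ^ j.+1 * n)%N.
have nm : (n <= m)%N by rewrite leq_pmull // expn_gt0.
have blockM l k : (M <= l)%N -> @block j l k = 0.
  by move=> Ml; rewrite /block ltnNge Ml mulr0.
have blockm l k : (m < l)%N -> @block j l k = 0.
  move=> ml; have c1 : chi j.+1 l = 0 by rewrite /chi -/m leqNgt ml.
  have := chi_mono j l; rewrite /block c1 /chi; case: (_ <= _)%N.
    by rewrite ler10.
  by rewrite subrr mul0r.
have blockn l k : (l <= 2 ^ j * n)%N -> @block j l k = 0.
  move=> ml; have c0 : chi j l = 1 by rewrite /chi ml.
  have := chi_mono j l; rewrite /block c0 /chi; case: (_ <= _)%N.
    by rewrite subrr mul0r.
  by rewrite ler10.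
have E k : hsum Y M (block j) (x k) = hsum Y m.+1 (block j) (x k).
  case: (leqP M m.+1) => Mm; first by rewrite (hsum_widen _ Mm).
  exact: hsum_widen (ltnW Mm) blockm.
under eq_bigr do rewrite E.
apply: le_trans (level_transfer d_gt0 rot_inv onb n_gt0 tau_ge0 upper (block j) nm) _.
have pn : 0 < (n%:R ^+ 2) `^ s :> R by rewrite powR_gt0 // exprn_gt0 // ltr0n.
have p4 : 0 < 4 `^ s :> R by rewrite powR_gt0.
pose rho : R := (4 `^ s) ^+ j * (n%:R ^+ 2) `^ s.
have rho0 : 0 < rho by rewrite mulr_gt0 // exprn_gt0.
have rhoE : ((2 ^ j * n)%N%:R ^+ 2) `^ s = rho.
  rewrite natrM exprMn powRM ?sqr_ge0 //; congr (_ * _).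
  rewrite -powR_mulrn ?powR_ge0 // -powRrM [s * _]mulrC powRrM; congr (_ `^ _).
  by rewrite powR_mulrn // natrX exprAC; congr (_ ^+ _); rewrite -natrX.
have en : \sum_(l < m.+1) energy (block j) l <= rho^-1 * Hj j.
  rewrite mulrC ler_pdivlMr //.
  have -> : \sum_(l < m.+1) energy (block j) l = \sum_(l < M) energy (block j) l.
    have W a c (ac : (a <= c)%N) : (forall l k, (a <= l)%N -> @block j l k = 0) ->
       \sum_(l < c) energy (block j) l = \sum_(l < a) energy (block j) l.
      move=> h; rewrite -(big_mkord xpredT (energy (block j))).
      rewrite -(big_mkord xpredT (energy (block j))) (big_cat_nat _ ac) //=.
      rewrite [X in _ + X]big_nat_cond [X in _ + X]big1 ?addr0 //.
      by move=> l /andP[/andP[Ml _] _]; rewrite /energy big1 // => k _; rewrite h ?expr0n.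
    by case: (leqP M m.+1) => Mm; [rewrite (W M)|rewrite (W m.+1 M) // ltnW].
  rewrite mulr_suml; apply: ler_sum => l _; rewrite mulrC.
  case: (leqP l (2 ^ j * n)) => lj.
    rewrite /energy big1 ?mulr0 // => k _; by rewrite blockn ?expr0n.
  by rewrite ler_wpM2r ?energy_ge0 // -rhoE sobolev_weight_ge // ltnW.
have T0 := ltW (transfer_const_gt0 R d_gt0).
apply: le_trans (ler_wpM2l _ en) _.
  by rewrite !mulr_ge0 // exprn_ge0 // divr_ge0.
rewrite mulrA ler_wpM2r //.
have -> : (m%:R / n%:R) ^+ d = (2 ^+ d) ^+ j * 2 ^+ d :> R.
  rewrite /m natrM mulfK ?pnatr_eq0 -?lt0n // natrX -exprM -exprSr -exprM.
  by rewrite mulnC.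
rewrite /rho /dyadic_ratio exprMn exprVn le_eqVlt; apply/orP; left; apply/eqP.
field; by rewrite expf_neq0 ?gt_eqF.
Qed.

(** The square root [t] of [dyadic_ratio] shares out the decay: [t ^ j] is the weight in
    Cauchy-Schwarz, and [dyadic_ratio ^ j <= t ^ j] pays for the division by it. The Sobolev
    energies of the blocks then add up to at most the whole. *)
Lemma high_part_samples :
  \sum_(k < r) hsum Y M (high_part n M b) (x k) ^+ 2 * tau k <=
  tail_const * B / (n%:R ^+ 2) `^ s * \sum_(l < M) sobolev_weight l * energy b l.
Proof.
have B0 : 0 <= B := upper_ge0 tau_ge0 upper.
have /andP[r0 r1] := dyadic_ratio_lt1.
have rpos : 0 < dyadic_ratio by rewrite divr_gt0 ?exprn_gt0 // powR_gt0.
pose t : R := Num.sqrt dyadic_ratio.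
have tt : t ^+ 2 = dyadic_ratio by rewrite sqr_sqrtr.
have t01 : 0 < t < 1 by rewrite sqrtr_gt0 rpos /= -[ltRHS]sqrtr1 ltr_sqrt.
have /andP[t0 t1] := t01.
have pn : 0 < (n%:R ^+ 2) `^ s :> R by rewrite powR_gt0 // exprn_gt0 // ltr0n.
have T0 := ltW (transfer_const_gt0 R d_gt0).
set W := transfer_const R d * 2 ^+ d * B / (n%:R ^+ 2) `^ s.
have W0 : 0 <= W by rewrite /W divr_ge0 ?(ltW pn) // !mulr_ge0.
apply: (@le_trans _ _ ((1 - t)^-1 * \sum_(j < M) (\sum_(k < r) hsum Y M (block j) (x k) ^+ 2 * tau k) / t ^+ j)).
  apply: (@le_trans _ _ (\sum_(k < r) ((1 - t)^-1 * \sum_(j < M) hsum Y M (block j) (x k) ^+ 2 / t ^+ j) * tau k)).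
    apply: ler_sum => k _; rewrite ler_wpM2r // high_part_blocks.
    exact: (sqr_sum_geometric M (fun j => hsum Y M (block j) (x k)) t01).
  rewrite le_eqVlt; apply/orP; left; apply/eqP.
  rewrite [in RHS]mulr_sumr.
  under [in RHS]eq_bigr do rewrite mulr_suml mulr_sumr.
  rewrite exchange_big /=; apply: eq_bigr => k _.
  rewrite mulr_sumr mulr_suml; apply: eq_bigr => j _; ring.
have -> : tail_const * B / (n%:R ^+ 2) `^ s * \sum_(l < M) sobolev_weight l * energy b l =
   (1 - t)^-1 * (W * \sum_(l < M) sobolev_weight l * energy b l).
  by rewrite /tail_const /W -/t; ring.
rewrite ler_wpM2l ?invr_ge0 ?subr_ge0 ?(ltW t1) //.
apply: (le_trans _ (ler_wpM2l W0 sum_Hj)); rewrite mulr_sumr; apply: ler_sum => j _.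
rewrite ler_pdivrMr ?exprn_gt0 //; apply: (le_trans (block_bound j)).
have rj : dyadic_ratio ^+ j <= t ^+ j.
  by rewrite -tt exprAC expr2 ler_piMr ?exprn_ge0 ?exprn_ile1 ?(ltW t0) ?(ltW t1).
by rewrite -/W -[leRHS]mulrA [Hj j * _]mulrC mulrA ler_wpM2r // ler_wpM2l.
Qed.

End dyadic.
End sobolev_tail.

(** * Least squares *)

Section least_squares_error.
Variables (R : realType) (d : nat) (s : R).
Hypothesis hs : d%:R / 2 < s.
Variables (sigma : probability (borel_sphere R d) R).
Variables (N : nat -> nat) (Y : forall l, 'I_(N l) -> sphere R d -> R).
Hypothesis d_gt0 : (0 < d)%N.
Hypothesis rot_inv : rotation_invariant sigma.
Hypothesis onb : harmonic_orthonormal_basis sigma Y.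
Variables (n r : nat) (x : 'I_r -> sphere R d) (tau : 'I_r -> R) (A B : R).
Hypothesis n_gt0 : (0 < n)%N.
Hypothesis A_gt0 : 0 < A.
Hypothesis tau_gt0 : forall k, 0 < tau k.
Hypothesis lower : forall p, Pi_space n p ->
  A * norm2 sigma p ^+ 2 <= \sum_(k < r) `|p (x k)| ^+ 2 * tau k.
Hypothesis upper : forall p, Pi_space n p ->
  \sum_(k < r) `|p (x k)| ^+ 2 * tau k <= B * norm2 sigma p ^+ 2.
Implicit Types (f p q : sphere R d -> R).

Let tau_ge0 k : 0 <= tau k. Proof. exact: ltW. Qed.
Let B_ge0 : 0 <= B. Proof. exact: upper_ge0 tau_ge0 upper. Qed.

(** The upper bound tested on the constant 1; it turns uniform closeness into closeness in the
    sampled norm. *)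
Lemma sum_tau_le : \sum_(k < r) tau k <= B.
Proof.
have sz : (size (1%R : {poly R}) <= n.+1)%N by rewrite size_poly1.
have := upper (@Pi_space_horner R d n 1 point sz); rewrite norm2_sqr.
have -> : inner sigma (fun y => 1.[dotp point y]) (fun y => 1.[dotp point y]) = 1.
  by rewrite /inner (int_ext _ (g := fun=> 1)) ?int_cst // => y; rewrite hornerC mulr1.
rewrite mulr1; apply: le_trans; apply: ler_sum => k _.
by rewrite hornerC normr1 expr1n mul1r.
Qed.

Definition is_minimizer f p := Pi_space n p /\
  forall q, Pi_space n q -> lsq_error x tau f p <= lsq_error x tau f q.

(** Write [f - p = (f - q) + qh + (p0 - p)], with [q = p0 + qh] the smoothed polynomial and [p0] its
    part of degree at most [n]. As [p0] competes with [p], the sampled energy of [p0 - p] is at most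
    [4] times the sampled error of [p0], which involves only [f - q] and [qh]. *)
Lemma minimizer_error_eps f p (F2 e : R) : continuous f -> is_minimizer f p ->
  (forall M, \sum_(l < M) sobolev_weight d s l *
     energy (fun l k => inner sigma f (@Y l k)) l <= F2) -> 0 < e ->
  inner sigma (fun y => f y - p y) (fun y => f y - p y) <=
  3 * (e ^+ 2 + ((n%:R ^+ 2) `^ s)^-1 * F2 +
       8 / A * (B * e ^+ 2 + tail_const d s * B / (n%:R ^+ 2) `^ s * F2)).
Proof.
move=> cf [hp pmin] HF e0.
have [M [b [bf fq]]] := smoothing d_gt0 rot_inv onb cf e0.
pose hi := high_part n M b.
pose lo : forall l, 'I_(N l) -> R := fun l k => if (n < l)%N then 0 else @b l k.
pose p0 := hsum Y M lo; pose qh := hsum Y M hi; pose q := hsum Y M b.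
have pn : 0 < (n%:R ^+ 2) `^ s :> R by rewrite powR_gt0 // exprn_gt0 // ltr0n.
have T0 := ltW (tail_const_gt0 hs d_gt0).
have qE y : q y = p0 y + qh y.
  rewrite /q /p0 /qh /hsum -big_split; apply: eq_bigr => l _ /=.
  rewrite -big_split; apply: eq_bigr => k _ /=; rewrite -mulrDl /lo /hi /high_part ltn_ord andbT.
  by case: (n < l)%N; rewrite ?add0r ?addr0.
have hp0 : Pi_space n p0.
  apply: Pi_space_sum => l _; apply: Pi_space_sum => k _; rewrite /lo.
  case: ltnP => nl; last by apply: Pi_spaceZ; apply: harmonics_Pi_space nl (onb_harmonics onb k).
  by have := @Pi_space0 R d n; congr Pi_space; apply/funext => y; rewrite mul0r.
have WF : \sum_(l < M) sobolev_weight d s l * energy b l <= F2.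
  apply: le_trans (HF M); apply: ler_sum => l _; rewrite ler_wpM2l ?sobolev_weight_ge0 //.
  by apply: ler_sum => k _; rewrite -[leLHS]real_normK ?num_real // -[leRHS]real_normK ?num_real // lerXn2r ?nnegrE.
have Nqh : inner sigma qh qh <= ((n%:R ^+ 2) `^ s)^-1 * F2.
  apply: le_trans (high_part_norm hs d_gt0 rot_inv onb M b n_gt0) _.
  by rewrite ler_wpM2l // invr_ge0 ltW.
have Sqh : \sum_(k < r) qh (x k) ^+ 2 * tau k <= tail_const d s * B / (n%:R ^+ 2) `^ s * F2.
  apply: le_trans (high_part_samples hs d_gt0 rot_inv onb n_gt0 tau_ge0 upper M b) _.
  by apply: ler_wpM2l => //; apply: divr_ge0; [exact: mulr_ge0|exact: ltW].
have sq_fq y : (f y - q y) ^+ 2 <= e ^+ 2.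
  by rewrite -[leLHS]real_normK ?num_real // lerXn2r ?nnegrE // ltW.
have Sfq : \sum_(k < r) (f (x k) - q (x k)) ^+ 2 * tau k <= B * e ^+ 2.
  apply: (@le_trans _ _ (\sum_(k < r) e ^+ 2 * tau k)).
    by apply: ler_sum => k _; rewrite ler_wpM2r.
  by rewrite -mulr_sumr mulrC ler_wpM2r ?sqr_ge0 // sum_tau_le.
have cq : continuous q := @hsum_continuous _ _ _ _ _ onb M b.
have cqh : continuous qh := @hsum_continuous _ _ _ _ _ onb M hi.
have cp := Pi_space_continuous hp; have cp0 := Pi_space_continuous hp0.
have Np : inner sigma (fun y => p0 y - p y) (fun y => p0 y - p y) <=
    8 / A * (B * e ^+ 2 + tail_const d s * B / (n%:R ^+ 2) `^ s * F2).
  rewrite mulrAC ler_pdivlMr // mulrC -norm2_sqr.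
  apply: le_trans (lower (Pi_spaceB hp0 hp)) _.
  apply: (@le_trans _ _ (4 * lsq_error x tau f p0)).
    apply: (@le_trans _ _ (2 * lsq_error x tau f p0 + 2 * lsq_error x tau f p)); last first.
      by have := pmin _ hp0; lra.
    rewrite /lsq_error !mulr_sumr -big_split; apply: ler_sum => k _ /=.
    rewrite !real_normK ?num_real //; move: (tau_ge0 k).
    move: (f (x k)) (p0 (x k)) (p (x k)) (tau k) => u v w t t0.
    have := mulr_ge0 t0 (sqr_ge0 ((u - v) + (u - w))); nra.
  have -> : 8 * (B * e ^+ 2 + tail_const d s * B / (n%:R ^+ 2) `^ s * F2) =
     4 * (2 * (B * e ^+ 2) + 2 * (tail_const d s * B / (n%:R ^+ 2) `^ s * F2)) by ring.
  rewrite ler_pM2l //; apply: le_trans (lerD (ler_wpM2l _ Sfq) (ler_wpM2l _ Sqh)) => //.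
  rewrite !mulr_sumr -big_split; apply: ler_sum => k _ /=.
  rewrite real_normK ?num_real // qE; move: (tau_ge0 k).
  move: (f (x k)) (p0 (x k)) (qh (x k)) (tau k) => u v w t t0.
  have := mulr_ge0 t0 (sqr_ge0 ((u - (v + w)) - w)); nra.
have Nfq : inner sigma (fun y => f y - q y) (fun y => f y - q y) <= e ^+ 2.
  rewrite -[leRHS](int_cst sigma); apply: int_le => [||y]; [by cont|by cont|].
  by rewrite -expr2.
apply: (@le_trans _ _ (3 * (inner sigma (fun y => f y - q y) (fun y => f y - q y) +
   inner sigma qh qh + inner sigma (fun y => p0 y - p y) (fun y => p0 y - p y)))); last first.
  by rewrite ler_pM2l // !lerD.
rewrite /inner -intD; [|by cont|by cont].
rewrite -intD; [|by cont|by cont].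
rewrite -intZ; last by cont.
apply: int_le => [||y]; [by cont|by cont|].
have -> : f y - p y = (f y - q y) + qh y + (p0 y - p y) by rewrite qE; ring.
move: (f y - q y) (qh y) (p0 y - p y) => u v w.
have := sqr_ge0 (u - v); have := sqr_ge0 (v - w); have := sqr_ge0 (u - w); nra.
Qed.

Lemma minimizer_error f p (F2 : R) : continuous f -> is_minimizer f p ->
  (forall M, \sum_(l < M) sobolev_weight d s l *
     energy (fun l k => inner sigma f (@Y l k)) l <= F2) ->
  inner sigma (fun y => f y - p y) (fun y => f y - p y) <=
  3 * (1 + 8 * tail_const d s * (B / A)) * (((n%:R ^+ 2) `^ s)^-1 * F2).
Proof.
move=> cf pmin HF; apply/ler_addgt0Pr => eps eps0.
(* [D] collects the coefficient of [e ^ 2] in [minimizer_error_eps]; [e] is then chosen so that this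
   part equals [eps]. *)
pose D : R := 3 * (1 + 8 / A * B).
have D0 : 0 < D by rewrite mulr_gt0 // ltr_pwDl // !mulr_ge0 // invr_ge0 ltW.
pose e := Num.sqrt (eps / D).
have e0 : 0 < e by rewrite sqrtr_gt0 divr_gt0.
have := minimizer_error_eps cf pmin HF e0.
have -> : e ^+ 2 = eps / D by rewrite sqr_sqrtr // ltW // divr_gt0.
move=> /le_trans; apply; rewrite le_eqVlt; apply/orP; left; apply/eqP.
have -> : 3 * (eps / D + ((n%:R ^+ 2) `^ s)^-1 * F2 +
  8 / A * (B * (eps / D) + tail_const d s * B / (n%:R ^+ 2) `^ s * F2)) =
  3 * (1 + 8 * tail_const d s * (B / A)) * (((n%:R ^+ 2) `^ s)^-1 * F2) + D * (eps / D).
  by rewrite /D; ring.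
by rewrite mulrC [D * _]mulrC divfK // gt_eqF.
Qed.

(** * The frame operator and the normal equations *)

Lemma Pi_space_basis : exists D (psi : 'I_D -> sphere R d -> R),
  [/\ forall i, Pi_space n (psi i),
      forall i j, inner sigma (psi i) (psi j) = (i == j)%:R
    & forall f, Pi_space n f -> exists c : 'rV[R]_D, f = fun y => \sum_i c ord0 i * psi i y].
Proof.
pose T := {l : 'I_n.+1 & 'I_(N l)}.
pose phi (t : T) := @Y (tag t) (tagged t).
have orth (t u : T) : inner sigma (phi t) (phi u) = (t == u)%:R.
  case: t u => [l k] [l' k']; rewrite /phi /=.
  have [ll|ll] := eqVneq l l'.
    subst l'; have [_ -> _] := onb l; congr (_%:R).
    by rewrite eq_Tagged.
  rewrite (harmonics_orth rot_inv d_gt0 _ (onb_harmonics onb k) (onb_harmonics onb k')) //.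
  by case: eqP => // /(congr1 (@tag _ _)) /= E; case/eqP: ll.
exists #|{: T}|, (fun i => phi (enum_val i)); split.
- move=> i; apply: harmonics_Pi_space (onb_harmonics onb _).
  by rewrite -ltnS.
- by move=> i j; rewrite orth (inj_eq enum_val_inj).
- move=> f /(Pi_space_hsum onb)[a ->].
  exists (\row_i @a (tag (enum_val i : T)) (tagged (enum_val i : T))).
  apply/funext => y; rewrite /hsum sig_big_dep /=.
  rewrite (reindex (fun i : 'I_#|{: T}| => enum_val i)) /=; last exact/onW_bij/enum_val_bij.
  by apply: eq_bigr => i _; rewrite mxE.
Qed.

(** The kernel is picked by [xget], so its properties follow once a kernel exists; the sum of
    [Y l k y * Y l k z] over degrees up to [n] is one. *)
Lemma repr_kernelP :
  (forall z, Pi_space n (fun y => repr_kernel sigma n y z)) /\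
  (forall p, Pi_space n p -> forall z, p z = inner sigma p (fun y => repr_kernel sigma n y z)).
Proof.
rewrite /repr_kernel; set S := [set E | _].
suff H : exists E, S E by have := xgetPex (fun _ _ => 0) H.
exists (fun y z => hsum Y n.+1 (fun l k => @Y l k z) y); split=> [z|p hp z].
  exact: hsum_Pi_space.
have [a ->] := Pi_space_hsum onb hp.
by rewrite (inner_hsum_hsum d_gt0 rot_inv onb).
Qed.

Local Notation E := (repr_kernel sigma n).
Local Notation fv := (frame_vector sigma n x tau).
Local Notation fop := (frame_operator sigma n x tau).
Local Notation dual := (dual_frame_vector sigma n x tau).

Lemma frame_vector_Pi k : Pi_space n (fv k).
Proof. by have [H _] := repr_kernelP; apply: Pi_spaceZ; exact: H. Qed.

Lemma inner_frame_vector p k : Pi_space n p ->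
  inner sigma p (fv k) = Num.sqrt (tau k) * p (x k).
Proof.
have [H1 H2] := repr_kernelP; move=> hp; rewrite /frame_vector innerZr.
- by rewrite -H2.
- exact: Pi_space_continuous hp.
- exact: Pi_space_continuous (H1 _).
Qed.

Lemma frame_operatorE p y : Pi_space n p ->
  fop p y = \sum_(k < r) Num.sqrt (tau k) * p (x k) * fv k y.
Proof. by move=> hp; apply: eq_bigr => k _; rewrite inner_frame_vector. Qed.

(** In an orthonormal basis the frame operator is the Gram matrix [G] of the samples, and the lower
    bound makes [G] definite. Surjectivity turns the partial inverse in [dual_frame_vector] into a
    right inverse on [Pi_space n]. *)
Lemma frame_operator_surj : set_surj (Pi_space n) (Pi_space n) fop.
Proof.
have [D [psi [psiP psi_orth psi_span]]] := Pi_space_basis.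
pose G : 'M[R]_D := \matrix_(i, j) \sum_(k < r) tau k * (psi i (x k) * psi j (x k)).
pose lin (c : 'rV[R]_D) y := \sum_i c ord0 i * psi i y.
have linP c : Pi_space n (lin c) by apply: Pi_space_sum => i _; exact: Pi_spaceZ.
have cpsi i := Pi_space_continuous (psiP i).
have inner_lin c j : inner sigma (lin c) (psi j) = c ord0 j.
  rewrite innerC /lin inner_sumr => [||i]; [|exact: cpsi|by have := cpsi i => ci; cont].
  rewrite (bigD1 j) //= innerZr; [|exact: cpsi|exact: cpsi].
  rewrite psi_orth eqxx mulr1 big1 ?addr0 // => i ij.
  by rewrite innerZr; [rewrite psi_orth eq_sym (negbTE ij) mulr0|exact: cpsi|exact: cpsi].
have norm_lin c : inner sigma (lin c) (lin c) = \sum_j c ord0 j ^+ 2.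
  rewrite {2}/lin inner_sumr => [||i]; [|exact: Pi_space_continuous (linP c)|by have := cpsi i => ci; cont].
  apply: eq_bigr => j _; rewrite innerZr; [|exact: Pi_space_continuous (linP c)|exact: cpsi].
  by rewrite inner_lin expr2.
have Gform c : (c *m G *m c^T) ord0 ord0 = \sum_(k < r) `|lin c (x k)| ^+ 2 * tau k.
  rewrite mxE.
  under eq_bigr => j _.
    rewrite mxE [c^T j ord0]mxE.
    rewrite (eq_bigr (fun i => \sum_(k < r) c ord0 i * (tau k * (psi i (x k) * psi j (x k))))); last first.
      by move=> i _; rewrite mxE mulr_sumr.
    rewrite exchange_big /= mulr_suml.
    over.
  rewrite exchange_big /=; apply: eq_bigr => k _.
  rewrite real_normK ?num_real // expr2 {1}/lin mulr_suml mulr_suml.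
  under eq_bigr => j _ do rewrite mulr_suml.
  rewrite exchange_big /=; apply: eq_bigr => i _.
  rewrite /lin mulr_sumr mulr_suml; apply: eq_bigr => j _; ring.
have Gunit : G \in unitmx.
  rewrite -row_free_unit; apply: inj_row_free => v vG.
  have := lower (linP v); rewrite -Gform vG mul0mx mxE norm2_sqr norm_lin => H.
  have S0 : \sum_j v ord0 j ^+ 2 <= 0 by rewrite -(pmulr_rle0 _ A_gt0).
  have /eqP := le_anti (introT andP (conj S0 (sumr_ge0 _ (fun j _ => sqr_ge0 (v ord0 j))))).
  rewrite psumr_eq0 => [/allP H2|j _]; last exact: sqr_ge0.
  apply/rowP => j; rewrite mxE; apply/eqP; rewrite -sqrf_eq0.
  by apply: H2; rewrite mem_index_enum.
have Epsi z y : E y z = \sum_i psi i z * psi i y.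
  have [H1 H2] := repr_kernelP.
  have [c Ec] := psi_span _ (H1 z).
  rewrite (congr1 (fun g => g y) Ec); apply: eq_bigr => i _; congr (_ * _).
  by rewrite (H2 _ (psiP i) z) Ec innerC inner_lin.
move=> g /psi_span[c ->]; exists (lin (c *m invmx G)); first exact: linP.
apply/funext => y; rewrite frame_operatorE //; set a := c *m invmx G.
have aG : a *m G = c by rewrite mulmxKV.
transitivity (\sum_(k < r) \sum_i tau k * lin a (x k) * (psi i (x k) * psi i y)).
  apply: eq_bigr => k _; rewrite /frame_vector Epsi; move: (lin a (x k)) => L.
  rewrite mulr_sumr mulr_sumr.
  apply: eq_bigr => i _; rewrite -[in RHS](sqr_sqrtr (tau_ge0 k)); ring.
rewrite exchange_big /=; apply: eq_bigr => i _.
rewrite -aG mxE mulr_suml.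
under [in RHS]eq_bigr => j _ do rewrite [G _ _]mxE mulr_sumr mulr_suml.
rewrite exchange_big /=; apply: eq_bigr => k _.
rewrite /lin mulr_sumr mulr_suml; apply: eq_bigr => j _; ring.
Qed.

Lemma dual_frame_vectorP k : Pi_space n (dual k) /\ fop (dual k) = fv k.
Proof.
have H := frame_operator_surj; split.
  apply: (surjpinv_image_sub H (dflt := fun _ _ => 0)).
  by exists (fv k) => //; exact: frame_vector_Pi.
apply: (surjpK (fun _ _ => 0) H); rewrite inE; exact: frame_vector_Pi.
Qed.

Definition lsq_solution f : sphere R d -> R :=
  fun y => \sum_(k < r) Num.sqrt (tau k) * f (x k) * dual k y.

Lemma lsq_solution_Pi f : Pi_space n (lsq_solution f).
Proof.
by apply: Pi_space_sum => k _; apply: Pi_spaceZ; case: (dual_frame_vectorP k).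
Qed.

(** The frame operator maps each dual vector to its frame vector, so the samples of [u] and those of
    [f] give the same combination of frame vectors; pair it with [q]. *)
Lemma lsq_solution_normal f q : Pi_space n q ->
  \sum_(k < r) (f (x k) - lsq_solution f (x k)) * q (x k) * tau k = 0.
Proof.
move=> hq; set u := lsq_solution f; have hu : Pi_space n u := lsq_solution_Pi f.
have cq := Pi_space_continuous hq.
have cfv k := Pi_space_continuous (frame_vector_Pi k).
have Eu y : fop u y = \sum_(k < r) Num.sqrt (tau k) * f (x k) * fv k y.
  rewrite frame_operatorE //.
  transitivity (\sum_(k < r) Num.sqrt (tau k) * f (x k) * fop (dual k) y); last first.
    by apply: eq_bigr => k _; have [_ ->] := dual_frame_vectorP k.
  rewrite /u /lsq_solution.
  under eq_bigr => j _ do rewrite mulr_sumr mulr_suml.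
  rewrite exchange_big /=; apply: eq_bigr => k _.
  rewrite frame_operatorE; last by case: (dual_frame_vectorP k).
  rewrite mulr_sumr; apply: eq_bigr => j _; ring.
have key c : inner sigma q (fun y => \sum_(k < r) Num.sqrt (tau k) * c k * fv k y) =
    \sum_(k < r) c k * q (x k) * tau k.
  rewrite inner_sumr => [||k]; [|exact: cq|by have := cfv k => ck; cont].
  apply: eq_bigr => k _; rewrite innerZr; [|exact: cq|exact: cfv].
  rewrite inner_frame_vector // -[in RHS](sqr_sqrtr (tau_ge0 k)); ring.
have := key (fun k => f (x k)); have := key (fun k => u (x k)).
have -> : (fun y => \sum_(k < r) Num.sqrt (tau k) * u (x k) * fv k y) =
          (fun y => \sum_(k < r) Num.sqrt (tau k) * f (x k) * fv k y).
  by apply/funext => y; rewrite -Eu frame_operatorE.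
move=> -> H; under eq_bigr do rewrite mulrBl mulrBl.
by rewrite sumrB H subrr.
Qed.

(** Pythagoras in the sampled norm: the normal equations remove the cross term. *)
Lemma lsq_solution_min f : is_minimizer f (lsq_solution f).
Proof.
split=> [|q hq]; first exact: lsq_solution_Pi.
have H := lsq_solution_normal f (Pi_spaceB (lsq_solution_Pi f) hq).
rewrite -subr_ge0 /lsq_error -sumrB.
have -> : \sum_(k < r) (`|f (x k) - q (x k)| ^+ 2 * tau k -
      `|f (x k) - lsq_solution f (x k)| ^+ 2 * tau k) =
   \sum_(k < r) (lsq_solution f (x k) - q (x k)) ^+ 2 * tau k +
   2 * \sum_(k < r) (f (x k) - lsq_solution f (x k)) * (lsq_solution f (x k) - q (x k)) * tau k.
  rewrite mulr_sumr -big_split; apply: eq_bigr => k _ /=.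
  rewrite !real_normK ?num_real //; ring.
rewrite H mulr0 addr0; apply: sumr_ge0 => k _.
by rewrite mulr_ge0 ?sqr_ge0.
Qed.

(** [lsq_solution] witnesses that minimizers exist, hence [xget] returns one. Since
    [minimizer_error] covers every minimizer, the two need not be identified. *)
Lemma least_squares_min f : is_minimizer f (least_squares n x tau f).
Proof.
rewrite /least_squares; set S := [set p | _].
have H : exists p, S p by exists (lsq_solution f); exact: lsq_solution_min.
exact: (xgetPex (fun=> 0) H).
Qed.

Lemma lsq_quadratureE f :
  lsq_quadrature sigma n x tau f = \int[sigma]_y lsq_solution f y.
Proof.
have cd k : continuous (dual k).
  by have [H _] := dual_frame_vectorP k; exact: Pi_space_continuous H.
rewrite /lsq_solution int_sum => [|k]; last by have := cd k => ck; cont.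
apply: eq_bigr => k _; rewrite intZ; last exact: cd.
by rewrite /lsq_weight mulrAC.
Qed.

End least_squares_error.

(** * The two error bounds *)

Lemma sobolev_partial_sum (R : realType) (d : nat) (s : R)
    (sigma : probability (borel_sphere R d) R) (N : nat -> nat)
    (Y : forall l, 'I_(N l) -> sphere R d -> R) (f : sphere R d -> R) (M : nat) :
  sobolev sigma Y s f ->
  \sum_(l < M) sobolev_weight d s l * energy (fun l k => inner sigma f (@Y l k)) l
    <= fine (sobolev_sum sigma Y s f).
Proof.
move=> [_ fin]; set u := fun l => (sobolev_weight d s l *
  \sum_(k < N l) `|inner sigma f (@Y l k)| ^+ 2).
have u0 l : (0 <= (u l)%:E)%E.
  by rewrite lee_fin mulr_ge0 ?sobolev_weight_ge0 // sumr_ge0 // => k _; exact: exprn_ge0.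
have S0 : (0 <= sobolev_sum sigma Y s f)%E by apply: nneseries_ge0 => l _ _; exact: u0.
rewrite -lee_fin fineK ?ge0_fin_numE //.
have -> : \sum_(l < M) sobolev_weight d s l *
    energy (fun l k => inner sigma f (@Y l k)) l = \sum_(0 <= l < M) u l.
  rewrite big_mkord; apply: eq_bigr => l _; congr (_ * _); apply: eq_bigr => k _.
  by rewrite real_normK ?num_real.
by rewrite -sumEFin; apply: nneseries_lim_ge => l _ _; exact: u0.
Qed.

(** Cauchy-Schwarz against the constant 1, whose norm is 1 for a probability measure. *)
Lemma int_le_norm2 (R : realType) (d : nat) (sigma : probability (borel_sphere R d) R)
    (f : sphere R d -> R) : continuous f -> `|\int[sigma]_y f y| <= norm2 sigma f.
Proof.
move=> cf; rewrite -ler_sqr ?nnegrE ?norm2_ge0 // norm2_sqr real_normK ?num_real //.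
have c1 := @continuous_const R (sphere R d) 1.
have := int_cauchy_schwarz sigma c1 c1 cf (fun=> ler01).
have E1 : \int[sigma]_y (1 * (1 * f y)) = \int[sigma]_y f y.
  by apply: int_ext => y; rewrite !mul1r.
have E2 : \int[sigma]_y (1 * f y ^+ 2) = inner sigma f f.
  by apply: int_ext => y; rewrite mul1r expr2.
by rewrite expr1n mulr1 int_cst mul1r E1 E2.
Qed.

Unset Implicit Arguments.

Theorem theorem1p2 (R : realType) (d : nat) (s : R)
    (hd : (2 <= d)%N) (hs : d%:R / 2 < s) :
  exists2 c : R, 0 < c &
    forall (sigma : probability (borel_sphere R d) R)
      (N : nat -> nat) (Y : forall l, 'I_(N l) -> sphere R d -> R),
    rotation_invariant sigma ->
    harmonic_orthonormal_basis sigma Y ->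
    forall (l : nat -> nat) (x : forall n, 'I_(l n) -> sphere R d)
      (tau : forall n, 'I_(l n) -> R) (A B : R),
    MZ_family sigma x tau A B ->
    let kappa := B / A in
    forall f : sphere R d -> R,
    sobolev sigma Y s f -> continuous f ->
    forall n : nat, (0 < n)%N ->
      norm2 sigma (fun y => f y - least_squares n (x n) (tau n) f y)
        <= c * Num.sqrt (1 + kappa ^+ 2) * n%:R `^ (- s)
           * sobolev_norm sigma Y s f
      /\
      `| \int[sigma]_y f y - lsq_quadrature sigma n (x n) (tau n) f |
        <= c * Num.sqrt (1 + kappa ^+ 2) * n%:R `^ (- s)
           * sobolev_norm sigma Y s f.
Proof.
have d_gt0 : (0 < d)%N by apply: leq_trans hd.
have T0 := tail_const_gt0 hs d_gt0.
set T := tail_const d s in T0.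
have c2 : 0 < 3 * (1 + 4 * T) by lra.
(* From [2 * kappa <= 1 + kappa ^ 2], the factor [1 + 8 * T * kappa] of [minimizer_error] is at most
   [(1 + 4 * T) * (1 + kappa ^ 2)]. *)
exists (Num.sqrt (3 * (1 + 4 * T))); first by rewrite sqrtr_gt0.
move=> sigma N Y rot_inv onb l x tau A B [A0 B0 tau0 MZ] kappa f sob cf n n0.
have lower p (hp : Pi_space n p) := (MZ n n0 p hp).1.
have upper p (hp : Pi_space n p) := (MZ n n0 p hp).2.
have tau_gt0 k : 0 < tau n k by exact: tau0.
set F2 := fine (sobolev_sum sigma Y s f).
have F2_ge0 : 0 <= F2.
  by have := sobolev_partial_sum 0 sob; rewrite big_ord0.
have npos : 0 < n%:R :> R by rewrite ltr0n.
have bound p : is_minimizer n (x n) (tau n) f p ->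
    norm2 sigma (fun y => f y - p y) <=
    Num.sqrt (3 * (1 + 4 * T)) * Num.sqrt (1 + kappa ^+ 2) * n%:R `^ (- s)
      * sobolev_norm sigma Y s f.
  move=> pmin.
  have := minimizer_error hs d_gt0 rot_inv onb n0 A0 tau_gt0 lower upper cf pmin
    (fun M => sobolev_partial_sum M sob).
  rewrite -/T -/kappa -/F2 => H; clearbody kappa.
  have k2 : 0 <= 1 + kappa ^+ 2 by rewrite addr_ge0 ?sqr_ge0.
  rewrite -ler_sqr ?nnegrE ?norm2_ge0 //; last first.
    by rewrite !mulr_ge0 ?sqrtr_ge0 ?powR_ge0.
  rewrite norm2_sqr !exprMn !sqr_sqrtr ?(ltW c2) //.
  apply: (le_trans H).
  have -> : ((n%:R ^+ 2) `^ s)^-1 = (n%:R `^ (- s)) ^+ 2 :> R.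
    by rewrite -powR_mulrn ?(ltW npos) // -powRrM mulrC powRrM powR_mulrn ?powR_ge0 // powRN exprVn.
  rewrite mulrA ler_wpM2r // ler_wpM2r ?sqr_ge0 //.
  have := mulr_ge0 (ltW T0) (sqr_ge0 (kappa - 1)); have := sqr_ge0 kappa; nra.
split.
  exact: bound (least_squares_min d_gt0 rot_inv onb A0 tau_gt0 lower f).
rewrite (lsq_quadratureE d_gt0 rot_inv onb A0 tau_gt0 lower f).
have hu := lsq_solution_min d_gt0 rot_inv onb A0 tau_gt0 lower f.
have cu := Pi_space_continuous hu.1.
rewrite -intB //; apply: le_trans (bound _ hu).
by apply: int_le_norm2; cont.
Qed.
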